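(* The family of elementary nilsequences is closed under complex conjugation, the shift, taking (pointwise) products, and uniform limits.
   Context: Sequences are complex valued and indexed by $\mathbb Z$. The shift is $\sigma\mathbf a=(a_{n+1})_{n\in\mathbb Z}$. $S^1$ is the unit circle in $\mathbb C$. A sequence is almost periodic if it is a uniform limit of finite linear combinations of the sequences $(\exp(2\pi i nt))_{n\in\mathbb Z}$, $t\in\mathbb R/\mathbb Z$. For a group $G$, $G_2$ denotes its commutator subgroup; $G$ is $2$-step nilpotent if $G_2$ is contained in the center of $G$. A $2$-step nilmanifold is $X=G/\Gamma$ with $G$ a $2$-step nilpotent Lie group and $\Gamma$ a discrete cocompact subgroup; $G$ acts on $X$ by left translation. A $2$-step nilsystem is $(X,T)$ with $T\colon x\mapsto\tau\cdot x$ for some fixed $\tau\in G$. An elementary nilsystem is a $2$-step nilsystem $(X=G/\Gamma,T)$, given with the presentation $X=G/\Gamma$, such that $G_2$ is the circle group (with a fixed identification $G_2=S^1$; both identifications are allowed). Then $\mathcal C_1(X)$ is the space of continuous $f\colon X\to\mathbb C$ with $f(u\cdot x)=u f(x)$ for all $u\in G_2=S^1$, $x\in X$. A basic elementary nilsequence is a sequence $(f(T^nx_0))_{n\in\mathbb Z}$ with $(X,T)$ an elementary nilsystem, $f\in\mathcal C_1(X)$ and $x_0\in X$. An elementary nilsequence is a uniform limit of basic elementary nilsequences; by convention every almost periodic sequence is also an elementary nilsequence. *)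

(* Defs.v *)
From HB Require Import structures.
From mathcomp Require Import all_boot all_order all_algebra.
From mathcomp Require Import all_classical all_reals all_analysis.
From mathcomp Require Import complex.

Set Implicit Arguments.
Unset Strict Implicit.
Unset Printing Implicit Defensive.

Import Order.TTheory GRing.Theory Num.Theory.
Import numFieldNormedType.Exports.

Local Open Scope classical_set_scope.
Local Open Scope ring_scope.
Local Open Scope quotient_scope.
Local Open Scope complex_scope.

(** The topology and uniform structure of [R[i]] given by the modulus. *)
HB.instance Definition _ (R : realType) := PseudoPointedMetric.copy R[i] R[i]^o.
HB.instance Definition _ (R : realType) :=
  PseudoMetricNormedZmod.copy R[i] R[i]^o.

(** Smooth maps between finite-dimensional normed spaces, on an open set [U].
    Derivatives are taken in all directions [v], hence in particular along any
    basis; this makes the definition coordinate-free. *)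

Fixpoint C_on (R : realType) (V W : normedModType R) (k : nat) (U : set V)
    (f : V -> W) : Prop :=
  (forall x, U x -> {for x, continuous f}) /\
  match k with
  | 0%N => True
  | k'.+1 => forall v : V,
      (forall x, U x -> derivable f x v) /\ C_on k' U ('D_v f)
  end.

Definition smooth_on (R : realType) (V W : normedModType R) (U : set V)
    (f : V -> W) : Prop :=
  forall k, C_on k U f.

(** [chart_map] and [chart_inv] are total functions, only meaningful on
    [chart_dom] and [chart_img] respectively. *)

Record chart (R : realType) (T : topologicalType) (n : nat) := Chart {
  chart_dom : set T;
  chart_img : set 'rV[R]_n;
  chart_map :> T -> 'rV[R]_n;
  chart_inv : 'rV[R]_n -> T;
  chart_dom_open : open chart_dom;
  chart_img_open : open chart_img;
  chart_map_sub : chart_map @` chart_dom `<=` chart_img;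
  chart_inv_sub : chart_inv @` chart_img `<=` chart_dom;
  chart_mapK : forall x, chart_dom x -> chart_inv (chart_map x) = x;
  chart_invK : forall y, chart_img y -> chart_map (chart_inv y) = y;
  chart_map_continuous : {within chart_dom, continuous chart_map};
  chart_inv_continuous : {within chart_img, continuous chart_inv} }.

Definition chart_compatible (R : realType) (T : topologicalType) (n : nat)
    (a b : chart R T n) : Prop :=
  smooth_on (chart_img a `&` chart_inv a @^-1` chart_dom b)
            (b \o chart_inv a).

HB.mixin Record isManifold (R : realType) T of Topological T := {
  mdim : nat;
  atlas : set (chart R T mdim);
  manifold_hausdorff : hausdorff_space T;
  manifold_second_countable : @second_countable T;
  atlas_cover : forall x : T, exists2 a, atlas a & chart_dom a x;
  atlas_compatible : forall a b, atlas a -> atlas b -> chart_compatible a b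
}.

#[short(type="manifoldType")]
HB.structure Definition Manifold (R : realType) :=
  {T of Topological T & isManifold R T}.

Arguments mdim {R} T : rename.
Arguments atlas {R} T : rename.

Definition smooth_curve (R : realType) (M : manifoldType R) (f : R -> M)
    : Prop :=
  continuous f /\
  forall a, atlas M a ->
    smooth_on (f @^-1` chart_dom a) (a \o f : R^o -> 'rV[R]_(mdim M)).

Definition smooth (R : realType) (M N : manifoldType R) (f : M -> N) : Prop :=
  continuous f /\
  forall a b, atlas M a -> atlas N b ->
    smooth_on (chart_img a `&` (f \o chart_inv a) @^-1` chart_dom b)
              (b \o f \o chart_inv a).

(** Smoothness on the product manifold, read in products of charts. *)
Definition smooth2 (R : realType) (M N P : manifoldType R) (f : M -> N -> P)
    : Prop :=
  continuous (fun z : M * N => f z.1 z.2) /\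
  forall a b c, atlas M a -> atlas N b -> atlas P c ->
    let g (z : 'rV[R]_(mdim M) * 'rV[R]_(mdim N)) :=
      f (chart_inv a z.1) (chart_inv b z.2) in
    smooth_on ((chart_img a `*` chart_img b) `&` g @^-1` chart_dom c) (c \o g).

HB.mixin Record isLieGroup (R : realType) G of Group G & Manifold R G := {
  smooth_mulg : smooth2 (fun x y : G => (x * y)%g);
  smooth_invg : smooth (fun x : G => x^-1%g)
}.

#[short(type="lieGroupType")]
HB.structure Definition LieGroup (R : realType) :=
  {G of Group G & Manifold R G & isLieGroup R G}.

Definition commutator_subgroup (G : groupType) : set G :=
  smallest (fun H : set G => group_closed [in H])
           (range (fun p : G * G => [~ p.1, p.2]%g)).

Arguments commutator_subgroup : clear implicits.

Definition two_step_nilpotent (G : groupType) : Prop :=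
  forall u x : G, commutator_subgroup G u -> commute u x.

Section coset_space.
Variables (R : realType) (G : lieGroupType R) (Gamma : groupClosed G).

Definition coset_rel (x y : G) : bool := (x^-1 * y)%g \in Gamma.

Lemma coset_rel_refl : reflexive coset_rel.
Proof. by move=> x; rewrite /coset_rel mulVg gpred1. Qed.

Lemma coset_rel_sym : symmetric coset_rel.
Proof. by move=> x y; rewrite /coset_rel -gpredV invgM invgK. Qed.

Lemma coset_rel_trans : transitive coset_rel.
Proof.
move=> y x z xy yz; rewrite /coset_rel.
by have := gpredM _ _ xy yz; rewrite mulgA mulgK.
Qed.

Canonical coset_equiv :=
  EquivRel coset_rel coset_rel_refl coset_rel_sym coset_rel_trans.

(** The space [G / Gamma] of cosets [x Gamma], with the quotient topology. *)
Definition coset_space : Type := {eq_quot coset_equiv}.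

HB.instance Definition _ :=
  Topological.copy coset_space (quotient_topology {eq_quot coset_equiv}).
HB.instance Definition _ := Quotient.on coset_space.

Definition translation (g : G) (x : coset_space) : coset_space :=
  \pi_coset_space (g * repr x)%g.

Lemma translation_pi (g x : G) :
  translation g (\pi_coset_space x) = \pi_coset_space (g * x)%g.
Proof.
rewrite /translation; apply/eqmodP => /=; rewrite /coset_rel.
rewrite invgM -mulgA mulKg.
suff : coset_equiv (repr (\pi_coset_space x)) x by [].
by apply/eqmodP; rewrite reprK.
Qed.

End coset_space.

Record nilmanifold (R : realType) := Nilmanifold {
  nil_group : lieGroupType R;
  nil_lattice : groupClosed nil_group;
  nil_two_step : two_step_nilpotent nil_group;
  nil_lattice_discrete : [set` nil_lattice] `<=` isolated [set` nil_lattice];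
  nil_cocompact : compact [set: coset_space nil_lattice] }.

Definition nil_space (R : realType) (X : nilmanifold R) : topologicalType :=
  coset_space (nil_lattice X).

(** The [n]-th iterate of the translation by [tau]; its inverse is the
    translation by [tau^-1]. *)
Definition translation_iter (R : realType) (X : nilmanifold R)
    (tau : nil_group X) (n : int) : nil_space X -> nil_space X :=
  match n with
  | Posz k => iter k (translation tau)
  | Negz k => iter k.+1 (translation tau^-1%g)
  end.

Definition circle (R : realType) : set R[i] := [set z | `|z| = 1].

Arguments circle : clear implicits.

Definition expi (R : realType) (t : R) : R[i] := cos t +i* sin t.

(** An identification of the Lie group [S^1] with the subgroup [G_2]: a group
    isomorphism [iota] from [S^1] onto [G_2] which is smooth as a map
    [S^1 -> G], the smooth structure of [S^1] being read through the covering
    [expi]. The values of [iota] outside [circle] are irrelevant. *)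
Record circle_identification (R : realType) (G : lieGroupType R)
    (iota : R[i] -> G) : Prop := CircleIdentification {
  circle_morph :
    {in circle R &, {morph iota : u v / u * v >-> (u * v)%g}};
  circle_bij : set_bij (circle R) (commutator_subgroup G) iota;
  circle_smooth : smooth_curve (fun t : R => iota (expi t)) }.

Definition C1 (R : realType) (X : nilmanifold R) (iota : R[i] -> nil_group X)
    : set (nil_space X -> R[i]) :=
  [set f : nil_space X -> R[i] | continuous f /\
    forall u x, circle R u -> f (translation (iota u) x) = u * f x].

Definition basic_elementary_nilsequence (R : realType) (a : int -> R[i])
    : Prop :=
  exists (X : nilmanifold R) (iota : R[i] -> nil_group X) (tau : nil_group X)
         (f : nil_space X -> R[i]) (x0 : nil_space X),
    [/\ circle_identification iota, C1 iota f
      & forall n, a n = f (translation_iter tau n x0)].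

Definition trigonometric_polynomial (R : realType) (a : int -> R[i]) : Prop :=
  exists s : seq (R[i] * R),
    forall n, a n = \sum_(p <- s) p.1 * expi (2 * pi * n%:~R * p.2).

Definition uniform_limit_of (R : realType) (P : (int -> R[i]) -> Prop)
    (a : int -> R[i]) : Prop :=
  exists2 u : nat -> int -> R[i],
    forall k, P (u k) & {uniform, u @ \oo --> a}.

Definition almost_periodic (R : realType) : (int -> R[i]) -> Prop :=
  uniform_limit_of (@trigonometric_polynomial R).

Definition elementary_nilsequence (R : realType) (a : int -> R[i]) : Prop :=
  almost_periodic a \/ uniform_limit_of (@basic_elementary_nilsequence R) a.

Definition shift_seq (R : realType) (a : int -> R[i]) : int -> R[i] :=
  fun n => a (n + 1).

(* Main.v *)
(** Almost periodic sequences and elementary nilsequences are handled by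
    approximation once basic elementary nilsequences and trigonometric
    polynomials are stable under the operations. Conjugation exchanges the two
    identifications of [G_2] with [S^1]. A basic elementary nilsequence is
    [h (tau ^ n * x0)] with [h] on [G] right invariant under [Gamma] and
    equivariant under [G_2]; its product with a trigonometric polynomial is of
    this form on [G x R^k], with lattice [Gamma x Z^k]. The product of two of
    them lives on the quotient of [G x G'] by the antidiagonal circle
    [{(u, u^-1)}] of [G_2 x G'_2], whose commutator subgroup is again a circle.
    That these groups are Lie groups is shown through a local criterion: a
    topological group with a chart at [1] in which multiplication, inversion and
    conjugations are smooth at [1] is a Lie group. For the quotient, the chart is
    a hyperplane slice transverse to the circle, given by the scalar implicit
    function theorem. *)

From HB Require Import structures.
Require Import Defs.
From mathcomp Require Import all_boot all_order all_algebra.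
From mathcomp Require Import all_classical all_reals all_analysis.
From mathcomp Require Import complex ring lra.

Set Implicit Arguments.
Unset Strict Implicit.
Unset Printing Implicit Defensive.

Import Order.TTheory GRing.Theory Num.Theory.
Import numFieldNormedType.Exports.

Local Open Scope classical_set_scope.
Local Open Scope ring_scope.
Local Open Scope complex_scope.

(** * Smooth maps *)

(** A product of two basic elementary nilsequences has weight [u * v] under the two-dimensional
    torus [G_2 x G'_2]; the antidiagonal is the kernel of the character [(u, v) |-> u * v], so
    dividing by it leaves one circle acting with weight one. A trigonometric polynomial carries no
    such weight and needs another construction. [R^k] suits it: being abelian it adds nothing to the
    commutator subgroup, and it is its own chart. Three facts about the quotient are not part of the
    data and have to be proved. The circle has nonzero velocity at [0], since a one-parameter group
    with zero velocity is locally constant. Two small elements of a coset differ by a small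
    parameter of the circle, and the image of [Gamma x Gamma'] is discrete: both rest on compactness
    of a segment that parametrises the circle. Products of uniform limits also require bounded
    approximants; the bounds come from compactness of the nilmanifold and from the finiteness of a
    trigonometric sum. *)

Lemma cvg_is_derive {R : realType} {V W : normedModType R} (f : V -> W) x v l :
  h^-1 *: (f (h *: v + x) - f x) @[h --> 0^'] --> l -> is_derive x v f l.
Proof. by move=> h; apply: DeriveDef; [exact: cvgP h|exact: cvg_lim h]. Qed.

Section directional.
Context {R : realType} {V W : normedModType R}.

(** [f] is only derivable in the single direction [v], so the chain rule is applied in one variable:
    to [F h = f (h *: v + y)] and the affine map [l t = (t - s) * c]. *)
Lemma is_derive_line (f : V -> W) (z v : V) (s c : R) :
  derivable f (z + (s * c) *: v) v ->
  is_derive s 1 (fun t : R => f (z + (t * c) *: v))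
    (c *: 'D_v f (z + (s * c) *: v)).
Proof.
set y := z + (s * c) *: v => dfy.
pose F (h : R) := f (h *: v + y).
have dF : differentiable F 0 by apply/derivable1_diffP/(derivable1P _ _ _).1.
pose l (t : R) := (t - s) * c.
have dl : is_derive s (1 : R) l c.
  have -> : l = c \*: (id - cst s).
    by apply/funext => t /=; rewrite /l mulrC.
  by apply: is_derive_eq; rewrite subr0 /GRing.scale /= mulr1.
have dl' : differentiable l s by apply/derivable1_diffP; apply: ex_derive.
have ls : l s = 0 by rewrite /l subrr mul0r.
have -> : (fun t : R => f (z + (t * c) *: v)) = F \o l.
  apply/funext => t /=; rewrite /F /l /y mulrBl scalerBl.
  by rewrite addrCA subrK.
have dFl : differentiable (F \o l) s by apply: differentiable_comp => //; rewrite ls.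
apply: DeriveDef; first exact: diff_derivable.
have E : 'd l s 1 = c by rewrite -(deriveE _ dl') (@derive_val _ _ _ _ _ _ _ dl).
rewrite deriveE// diff_comp//= ?ls// E.
have -> : 'd F 0 c = c *: 'd F 0 1 by rewrite -linearZ /= [_%:A]mulr1.
rewrite -deriveE//; congr (_ *: _); rewrite /derive.
suff -> : (fun h : R => h^-1 *: ((F \o shift 0) (h *: 1) - F 0)) =
    (fun h => h^-1 *: ((f \o shift y) (h *: v) - f y)) by [].
by apply/funext => h; rewrite /F /= addr0 scale0r add0r [_%:A]mulr1.
Qed.

Lemma is_derive_linear (Z : normedModType R) (L : {linear W -> Z}) (f : V -> W) x v :
  continuous L -> derivable f x v -> is_derive x v (L \o f) (L ('D_v f x)).
Proof.
move=> cL fxv; apply: cvg_is_derive.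
have -> : (fun h => h^-1 *: ((L \o f) (h *: v + x) - (L \o f) x)) =
    L \o (fun h => h^-1 *: (f (h *: v + x) - f x)).
  by apply/funext => h; rewrite [RHS]linearZ; congr (_ *: _); rewrite linearB.
by apply: continuous_cvg; [exact: cL|exact: fxv].
Qed.

End directional.

(** Continuity of the coordinate forms is part of the data because a linear form on a normed space
    need not be continuous. As a class, it is inferred for scalars, row vectors and products. *)
Class findim (R : realType) (V : normedModType R) : Prop := Findim {
  findim_basis : exists n (e : 'I_n -> V) (c : 'I_n -> {linear V -> R^o}),
    (forall i, continuous (c i)) /\ forall x, x = \sum_i c i x *: e i }.

(** * Continuous directional derivatives give differentiability *)

Section C1_differentiable.
Context {R : realType} {V : normedModType R}.

Lemma linear_bounds n (c : 'I_n -> {linear V -> R^o}) :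
  (forall i, continuous (c i)) ->
  exists2 k : R, 0 < k & forall i x, `|c i x| <= k * `|x|.
Proof.
move=> cc.
have /choice[k kP] i : exists k : R, 0 < k /\ forall x, `|c i x| <= k * `|x|.
  by have [k k0 kc] := linear_lipschitz (@cc i); exists k.
have k_ge0 i : 0 <= k i by have [/ltW] := kP i.
exists (1 + \sum_i k i); first by rewrite ltr_pwDl// sumr_ge0.
move=> i x; have [_ /(_ x)/le_trans] := kP i; apply.
rewrite ler_wpM2r// (bigD1 i)//= addrCA lerDl addr_ge0// sumr_ge0//.
Qed.

(** The increment is made one frame vector at a time, by induction on the number [j] of vectors
    used. Each new one costs a mean value theorem in one variable, and continuity of the partial
    derivative replaces its value at the intermediate point by its value at [x]. *)
Lemma C1_expansion (U : set V) (f : V -> R) x n (e : 'I_n -> V)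
    (c : 'I_n -> {linear V -> R^o}) :
  open U -> U x -> (forall i, continuous (c i)) ->
  (forall i y, U y -> derivable f y (e i)) ->
  (forall i, {for x, continuous ('D_(e i) f)}) ->
  forall eps : R, 0 < eps -> \forall h \near (0 : V),
   `|f (x + \sum_i c i h *: e i) - f x - \sum_i c i h * 'D_(e i) f x|
     <= eps * `|h|.
Proof.
move=> oU Ux cc df cDf.
have [k k0 kc] := linear_bounds cc.
pose S : R := 1 + \sum_i `|e i|.
have S0 : 0 < S by rewrite /S ltr_pwDl// sumr_ge0.
suff main j : forall eps : R, 0 < eps -> \forall h \near (0 : V),
   `|f (x + \sum_(i < n | (i < j)%N) c i h *: e i) - f x
      - \sum_(i < n | (i < j)%N) c i h * 'D_(e i) f x| <= eps * `|h|.
  move=> eps eps0; have := main n eps eps0; apply: filterS => h.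
  have T (M : nmodType) (F : 'I_n -> M) : \sum_(i < n | (i < n)%N) F i = \sum_i F i.
    by apply: eq_bigl => i; rewrite ltn_ord.
  by rewrite !T.
elim: j => [|j IH] eps eps0.
  near=> h; rewrite !big_pred0// addr0 subrr subr0 normr0.
  by apply: mulr_ge0 => //; apply: ltW.
have [jn|nj] := ltnP j n; last first.
  have := IH _ eps0; apply: filterS => h.
  have T (M : nmodType) (F : 'I_n -> M) :
      \sum_(i < n | (i < j.+1)%N) F i = \sum_(i < n | (i < j)%N) F i.
    by apply: eq_bigl => i; rewrite !(leq_trans (ltn_ord i)) // leqW.
  by rewrite !T.
pose j' := Ordinal jn.
have sumS (M : nmodType) (F : 'I_n -> M) :
    \sum_(i < n | (i < j.+1)%N) F i = \sum_(i < n | (i < j)%N) F i + F j'.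
  rewrite (bigD1 j') /=; last by rewrite ltnS.
  rewrite addrC; congr (_ + _); apply: eq_bigl => i.
  by rewrite ltnS leq_eqVlt -val_eqE /=; case: eqP => [->|]; rewrite ?ltnn ?andbF//= andbT.
(* Half of [eps] goes to the induction hypothesis; the other half is divided by [k], since the new
   coordinate of [h] is at most [k] times the norm of [h]. *)
have eps20 : 0 < eps / 2 by rewrite divr_gt0.
have epsk0 : 0 < eps / 2 / k by rewrite divr_gt0.
have [d d0 dP] : exists2 d : R, 0 < d & forall y, `|y| < d ->
    U (x + y) /\ `|'D_(e j') f (x + y) - 'D_(e j') f x| <= eps / 2 / k.
  have : \forall y \near x, U y /\ `|'D_(e j') f y - 'D_(e j') f x| <= eps / 2 / k.
    near=> y; split; first by near: y; exact: open_nbhs_nbhs.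
    rewrite distrC; near: y.
    by have /cvgrPdist_le := cDf j'; apply.
  move=> /nbhs_ballP[d /= d0 dP]; exists d => // y yd; apply: dP.
  by rewrite -ball_normE /= opprD addrA subrr sub0r normrN.
have IHe := IH _ eps20.
near=> h.
have IHh : `|f (x + \sum_(i < n | (i < j)%N) c i h *: e i) - f x
    - \sum_(i < n | (i < j)%N) c i h * 'D_(e i) f x| <= eps / 2 * `|h|.
  by near: h.
(* [S] dominates the norms of all frame vectors together, so the whole current segment of the path
   stays within [d] of [x]. *)
have hS : k * `|h| * S < d.
  rewrite mulrC mulrA -ltr_pdivlMl ?mulr_gt0//.
  near: h; have /cvgr0Pnorm_lt := @cvg_id _ (nbhs (0:V)); apply.
  by rewrite mulr_gt0// invr_gt0 mulr_gt0.
set p := \sum_(i < n | (i < j)%N) c i h *: e i.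
pose z := c j' h.
have inU (s : R) : 0 <= s -> s <= 1 -> `|p + (s * z) *: e j'| < d.
  move=> s0 s1; apply: le_lt_trans hS.
  have -> : k * `|h| * S = k * `|h| + \sum_i k * `|h| * `|e i|.
    by rewrite /S mulrDr mulr1 mulr_sumr.
  apply: (@le_trans _ _ (\sum_i k * `|h| * `|e i|)); last first.
    by rewrite lerDr mulr_ge0// ltW.
  apply: (@le_trans _ _ (\sum_(i < n | (i < j.+1)%N) k * `|h| * `|e i|)); last first.
    rewrite [leRHS](bigID (fun i : 'I_n => (i < j.+1)%N))/= lerDl.
    by apply: sumr_ge0 => i _; rewrite !mulr_ge0// ltW.
  rewrite sumS; apply: (le_trans (ler_normD _ _)); apply: lerD.
    apply: (le_trans (ler_norm_sum _ _ _)); apply: ler_sum => i _.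
    by rewrite normrZ ler_wpM2r.
  rewrite normrZ ler_wpM2r// normrM (ger0_norm s0).
  by apply: (le_trans _ (kc j' h)); rewrite ler_piMl.
pose phi (t : R) := f (x + p + (t * z) *: e j').
have dphi (t : R) : 0 <= t -> t <= 1 ->
    is_derive t 1 phi (z * 'D_(e j') f (x + p + (t * z) *: e j')).
  move=> t0 t1; apply: is_derive_line; apply: df; rewrite -addrA.
  by have [] := dP _ (inU _ t0 t1).
have [xi xi01 E] : exists2 xi, xi \in `[0, 1]%R &
    phi 1 - phi 0 = z * 'D_(e j') f (x + p + (xi * z) *: e j') * (1 - 0).
  apply: MVT_segment => // [t|].
    by rewrite in_itv /= => /andP[t0 t1]; apply: dphi; apply: ltW.
  apply: derivable_within_continuous => t; rewrite in_itv /= => /andP[t0 t1].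
  by have h1 := dphi t t0 t1; apply: ex_derive.
move: xi01; rewrite in_itv /= => /andP[xi0 xi1].
have [_ dD] := dP _ (inU _ xi0 xi1).
rewrite !sumS -/p -/z.
have -> : f (x + (p + z *: e j')) = f (x + p) + z * 'D_(e j') f (x + p + (xi * z) *: e j').
  move: E; rewrite subr0 mulr1 /phi mul1r mul0r scale0r addr0 => <-.
  by rewrite addrA [RHS]addrC subrK.
set A : R := \sum_(i < n | _) c i h * _ in IHh *.
rewrite addrA in dD; set Dx : R := 'D_ _ _ _ in dD *; set Dy : R := 'D_ _ _ _ in dD *.
rewrite -/p in IHh.
have -> : f (x + p) + z * Dx - f x - (A + z * Dy) = (f (x + p) - f x - A) + z * (Dx - Dy).
  by ring.
rewrite (splitr eps) mulrDl; apply: (le_trans (ler_normD _ _)); apply: lerD => //.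
rewrite normrM; apply: (@le_trans _ _ (k * `|h| * (eps / 2 / k))).
  exact: (ler_pM (normr_ge0 _) (normr_ge0 _) (kc j' h) dD).
by rewrite [leLHS](_ : _ = eps / 2 * `|h|)//; field; rewrite gt_eqF.
Unshelve. all: by end_near. Qed.


Lemma C1_differentiable_scalar {hV : findim V} (U : set V) (f : V -> R) x :
  open U -> U x -> (forall v y, U y -> derivable f y v) ->
  (forall v, {for x, continuous ('D_v f)}) -> differentiable f x.
Proof.
move=> oU Ux df cf; have [n [e [c [cc eE]]]] := @findim_basis _ _ hV.
pose L (h : V) : R^o := \sum_i c i h * 'D_(e i) f x.
have L_lin : linear L.
  move=> a u w; rewrite /L scaler_sumr -big_split/=; apply: eq_bigr => i _.
  by rewrite linearP mulrDl -scalerAl.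
pose Lm := GRing.isLinear.Build _ _ _ _ _ L_lin.
pose LL : {linear V -> R^o} := HB.pack L Lm.
have cL : continuous LL.
  apply: continuous_big; first exact: add_continuous.
  by move=> i _ y; apply: cvgM; [exact: cc|exact: cvg_cst].
have H : f \o shift x = cst (f x) + LL +o_ 0 id.
  apply/eqaddoP => eps eps0.
  have := @C1_expansion U f x n e c oU Ux cc (fun i => df (e i)) (fun i => cf (e i)) eps eps0.
  apply: filterS => h /=; rewrite -eE; congr (_ <= _); congr (`| _ |).
  by rewrite !fctE /= opprD addrA [h + x]addrC.
apply/diff_locallyP; rewrite (diff_unique cL H); split => //.
Qed.


(** [C_on 1] speaks of directional derivatives only; the chain rule needs the total differential
    obtained here, coordinate by coordinate in the target. *)
Lemma C1_differentiable {W : normedModType R} {hV : findim V} {hW : findim W}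
    (U : set V) (f : V -> W) x :
  open U -> U x -> C_on 1 U f -> differentiable f x.
Proof.
move=> oU Ux [cf df].
have [n [e [c [cc eE]]]] := @findim_basis _ _ hW.
have dcf i v y : U y -> is_derive y v (fun z => c i (f z)) (c i ('D_v f y)).
  move=> Uy; have [fyv _] := df v; apply: is_derive_linear => //.
  exact: fyv.
have -> : f = \sum_i (fun y => c i (f y) *: e i).
  by apply/funext => y; rewrite [LHS]eE fct_sumE.
apply: differentiable_sum => i; apply: differentiableZl.
apply: (@C1_differentiable_scalar _ U) => // v.
  by move=> y Uy; have h := dcf i v y Uy; apply: ex_derive.
have dE : {near x, (fun y => c i ('D_v f y)) =1 'D_v (fun y => c i (f y))}.
  near=> y; have Uy : U y by near: y; exact: open_nbhs_nbhs.
  by have h := dcf i v y Uy; rewrite derive_val.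
have [_ [cDf _]] := df v.
rewrite /prop_for /continuous_at -(nbhs_singleton dE).
apply: cvg_trans; first by apply: near_eq_cvg; exact: dE.
by apply: continuous_cvg; [exact: cc|exact: cDf].
Unshelve. all: by end_near.
Qed.

End C1_differentiable.

(** * Closure properties of maps of class C^k *)

Section C_on_theory.
Context {R : realType}.
Implicit Types V W Z : normedModType R.

Lemma C_on_continuous V W k (U : set V) (f : V -> W) x :
  C_on k U f -> U x -> {for x, continuous f}.
Proof. by case: k => [|k] [cf _]; apply: cf. Qed.

Lemma C_onW V W k (U : set V) (f : V -> W) : C_on k.+1 U f -> C_on k U f.
Proof.
elim: k f => [|k IH] f [cf df]; split=> // v; have [? ?] := df v.
by split=> //; apply: IH.
Qed.

Lemma sub_C_on V W k (A B : set V) (f : V -> W) :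
  A `<=` B -> C_on k B f -> C_on k A f.
Proof.
move=> AB; elim: k f => [|k IH] f [cf df]; first by split=> // x /AB/cf.
split=> [x /AB/cf//|v]; have [dfv Df] := df v.
by split=> [x /AB/dfv//|]; apply: IH.
Qed.

Lemma eq_C_on V W k (U : set V) (f g : V -> W) : open U ->
  (forall x, U x -> f x = g x) -> C_on k U f -> C_on k U g.
Proof.
move=> oU; elim: k f g => [|k IH] f g fg [cf df].
all: have nfg x : U x -> {near x, f =1 g}
       by move=> Ux; near=> y; apply: fg; near: y; exact: open_nbhs_nbhs.
all: have cg x : U x -> {for x, continuous g}
       by move=> Ux; rewrite /prop_for /continuous_at -(fg x Ux);
          apply: cvg_trans (cf _ Ux); apply: near_eq_cvg; exact: nfg.
all: split=> //.
move=> v; have [dfv Df] := df v; split=> [x Ux|].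
  exact: near_eq_derivable (nfg x Ux) (dfv x Ux).
apply: IH Df => x Ux; exact: near_eq_derive (nfg x Ux).
Unshelve. all: by end_near. Qed.

Lemma C_on_cst V W k (U : set V) (a : W) : C_on k U (fun _ : V => a).
Proof.
elim: k a => [|k IH] a; split=> //; try by move=> x _; apply: cvg_cst.
move=> v; split=> [x _|]; first exact: derivable_cst.
have -> : 'D_v (fun _ : V => a) = (fun _ : V => 0).
  by apply/funext => x; apply: derive_cst.
exact: IH.
Qed.

Lemma C_on_linear V W k (U : set V) (L : {linear V -> W}) :
  continuous L -> C_on k U L.
Proof.
move=> cL; case: k => [|k]; split=> //; try by move=> x _; exact: cL.
have dL v x : is_derive x v L (L v).
  by have := @is_derive_linear _ _ _ _ L id x v cL (@derivable_id _ _ x v); rewrite derive_id.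
move=> v; split=> [x _|]; first by apply: ex_derive.
have -> : 'D_v L = (fun _ : V => L v) by apply/funext => x; rewrite derive_val.
exact: C_on_cst.
Qed.

Lemma C_onD V W k (U : set V) (f g : V -> W) : open U ->
  C_on k U f -> C_on k U g -> C_on k U (fun x => f x + g x).
Proof.
move=> oU; elim: k f g => [|k IH] f g [cf df] [cg dg]; split=> //;
  try by move=> x Ux; apply: cvgD; [exact: cf|exact: cg].
move=> v; have [dfv Df] := df v; have [dgv Dg] := dg v; split=> [x Ux|].
  by apply: derivableD; [exact: dfv|exact: dgv].
apply: eq_C_on (IH _ _ Df Dg) => // x Ux.
by rewrite -[RHS]/('D_v (f + g) x) deriveD//; [exact: dfv|exact: dgv].
Qed.

Lemma C_on_sum V W k (U : set V) n (f : 'I_n -> V -> W) : open U ->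
  (forall i, C_on k U (f i)) -> C_on k U (fun x => \sum_i f i x).
Proof.
move=> oU hf.
have -> : (fun x => \sum_i f i x) = \sum_i f i.
  by apply/funext => x; rewrite fct_sumE.
elim/big_ind: _ => [|g h Cg Ch|i _]; first exact: C_on_cst.
  exact: C_onD.
exact: hf.
Qed.

Lemma C_on_linl V W Z k (U : set V) (L : {linear W -> Z}) (f : V -> W) :
  open U -> continuous L -> C_on k U f -> C_on k U (L \o f).
Proof.
move=> oU cL; elim: k f => [|k IH] f [cf df]; split=> //;
  try by move=> x Ux; apply: continuous_cvg; [exact: cL|exact: cf].
move=> v; have [dfv Df] := df v.
have dLf x : U x -> is_derive x v (L \o f) (L ('D_v f x)).
  by move=> Ux; apply: is_derive_linear => //; apply: dfv.
split=> [x /dLf h|]; first by apply: ex_derive.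
apply: eq_C_on (IH _ Df) => // x /dLf h.
by rewrite derive_val.
Qed.

Lemma is_derive_scale V W (a : V -> R) (f : V -> W) x v :
  derivable a x v -> derivable f x v ->
  is_derive x v (fun y => a y *: f y) (a x *: 'D_v f x + 'D_v a x *: f x).
Proof.
move=> da df; apply: cvg_is_derive.
have -> : (fun h : R => h^-1 *: (a (h *: v + x) *: f (h *: v + x) - a x *: f x)) =
   (fun h => a (h *: v + x) *: (h^-1 *: (f (h *: v + x) - f x))
             + (h^-1 *: (a (h *: v + x) - a x)) *: f x).
  apply/funext => h; rewrite scalerA mulrC -scalerA -[h^-1 *: (a _ - _)]/(h^-1 * _).
  rewrite -scalerA -scalerDr; congr (_ *: _).
  by rewrite scalerBr scalerBl addrA subrK.
apply: cvgD; last first.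
  by apply: (@cvgZr_tmp _ _ _ _ _ (fun h : R => h^-1 *: (a (h *: v + x) - a x))); exact: da.
apply: cvgZ; last exact: df.
suff : {for 0, continuous (fun h : R => a (h *: v + x))}.
  by move=> /continuous_withinNx; rewrite scale0r add0r.
exact/differentiable_continuous/derivable1_diffP/(derivable1P _ _ _).1.
Qed.

Lemma C_onZ V W k (U : set V) (a : V -> R) (f : V -> W) : open U ->
  C_on k U a -> C_on k U f -> C_on k U (fun x => a x *: f x).
Proof.
move=> oU; elim: k a f => [|k IH] a f Ca Cf; have [ca da] := Ca; have [cf df] := Cf.
all: split=> //; try by move=> x Ux; apply: cvgZ; [exact: ca|exact: cf].
move=> v; have [dav Da] := da v; have [dfv Df] := df v.
have daf x : U x -> is_derive x v (fun y => a y *: f y) (a x *: 'D_v f x + 'D_v a x *: f x).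
  by move=> Ux; apply: is_derive_scale; [exact: dav|exact: dfv].
split=> [x /daf h|]; first by apply: ex_derive.
apply: eq_C_on (C_onD oU (IH _ _ (C_onW Ca) Df) (IH _ _ Da (C_onW Cf))) => // x /daf h.
by rewrite derive_val.
Qed.

(** Induction works because the derivative, minus [a^-2] times ['D_v a], involves the inverse only
    at the previous order. *)
Lemma C_onV V k (U : set V) (a : V -> R) : open U ->
  (forall x, U x -> a x != 0) ->
  C_on k U a -> C_on k U (fun x => (a x)^-1).
Proof.
move=> oU a0; elim: k => [|k IH] Ca; have [ca da] := Ca.
all: split=> //; try by move=> x Ux; apply: cvgV; [exact: a0|exact: ca].
move=> v; have [dav Da] := da v.
split=> [x Ux|]; first by apply: derivableV; [exact: a0|exact: dav].
have IHa := IH (C_onW Ca).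
have C2 := C_onZ oU IHa (C_onZ oU IHa Da).
have C3 := C_onZ oU (@C_on_cst V R k U (-1)) C2.
apply: (eq_C_on oU _ C3) => x Ux.
rewrite deriveV; [|exact: a0|exact: dav].
by rewrite scaleN1r scaleNr [in LHS]scalerA -invfM -expr2.
Qed.

(** Only [g] is differentiable; restricting [f] to the line through [x] along [v] makes the inner
    map a differentiable function of one variable. *)
Lemma is_derive_comp V W Z (f : V -> W) (g : W -> Z) x v :
  derivable f x v -> differentiable g (f x) ->
  is_derive x v (g \o f) ('d g (f x) ('D_v f x)).
Proof.
move=> df dg.
have E : f x = f (0 *: v + x) by rewrite scale0r add0r.
pose F (h : R) := f (h *: v + x).
have dF : differentiable F 0 by apply/derivable1_diffP/(derivable1P _ _ _).1.
have dgF : differentiable (g \o F) 0 by apply: differentiable_comp => //; rewrite /F -E.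
have D1 (Y : normedModType R) (u : V -> Y) :
    'D_1 (fun h : R => u (h *: v + x)) 0 = 'D_v u x.
  rewrite /derive.
  suff -> : (fun h : R => h^-1 *: (((fun k : R => u (k *: v + x)) \o shift 0) (h *: 1)
       - u (0 *: v + x))) = (fun h => h^-1 *: ((u \o shift x) (h *: v) - u x)) by [].
  by apply/funext => h; rewrite /= addr0 scale0r add0r [_%:A]mulr1.
apply: DeriveDef.
  by apply/derivable1P; apply: diff_derivable; exact: dgF.
rewrite -D1 -[LHS]/('D_1 (g \o F) 0) deriveE// diff_comp//=; last by rewrite /F -E.
by rewrite -(deriveE _ dF) /F D1 -E.
Qed.

(** The direction ['D_v f x] in which [g] is differentiated varies with [x]. Expanding it in the
    frame of [W] leaves the fixed directions [e i], and the induction hypothesis applies to each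
    ['D_(e i) g \o f]. *)
Lemma C_on_comp V W Z {hW : findim W} {hZ : findim Z} k (U : set V) (T : set W)
    (f : V -> W) (g : W -> Z) : open U -> open T -> f @` U `<=` T ->
  C_on k U f -> C_on k T g -> C_on k U (g \o f).
Proof.
move=> oU oT UT; have {}UT x : U x -> T (f x) by move=> Ux; apply: UT; exists x.
elim: k f g UT => [|k IH] f g UT Cf Cg; have [cf df] := Cf; have [cg dg] := Cg.
all: split=> //; try by move=> x Ux; apply: continuous_comp; [exact: cf|exact/cg/UT].
move=> v; have [dfv Df] := df v.
have [n [e [c [cc eE]]]] := @findim_basis _ _ hW.
have Cg1 : C_on 1 T g by elim: (k) Cg => // m IHm /C_onW.
have dgf x : U x -> is_derive x v (g \o f) (\sum_i c i ('D_v f x) *: 'D_(e i) g (f x)).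
  move=> Ux; have dgfx : differentiable g (f x) by apply: (C1_differentiable oT _ Cg1); exact: UT.
  have H := is_derive_comp (dfv x Ux) dgfx.
  apply: is_derive_eq; rewrite [in LHS](eE ('D_v f x)) linear_sum.
  by apply: eq_bigr => i _; rewrite (deriveE _ dgfx) -[RHS]linearZ.
split=> [x /dgf h|]; first by apply: ex_derive.
apply: (@eq_C_on _ _ _ _ (fun x => \sum_i c i ('D_v f x) *: 'D_(e i) g (f x))) => //.
  by move=> x /dgf h; rewrite derive_val.
apply: C_on_sum => // i; apply: C_onZ => //; first exact: (C_on_linl (L := c i)).
have [_ Dg] := dg (e i).
exact: (IH f _ UT (C_onW Cf) Dg).
Qed.

End C_on_theory.

Definition to_linear (R : pzRingType) (V W : lmodType R) (f : V -> W) (fl : linear f)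
  : {linear V -> W} := HB.pack f (GRing.isLinear.Build R V W _ f fl).

Lemma pair_continuous_at (T U V : topologicalType) (f : T -> U) (g : T -> V) (x : T) :
  {for x, continuous f} -> {for x, continuous g} ->
  {for x, continuous (fun y => (f y, g y))}.
Proof. by move=> cf cg; exact: (cvg_pair cf cg). Qed.

Lemma cvg_dnbhs (T U : topologicalType) (f : T -> U) (x : T) (l : U) :
  f y @[y --> x] --> l -> f y @[y --> x^'] --> l.
Proof. by move=> fl A /fl; exact: nbhs_dnbhs. Qed.

(** * Finite-dimensional spaces *)

Section findim_instances.
Context {R : realType}.
Implicit Types V W : normedModType R.

Lemma findim_linear_continuous V W {hV : findim V} (f : V -> W) :
  linear f -> continuous f.
Proof.
move=> fl; pose L := to_linear fl.
have [n [e [c [cc eE]]]] := @findim_basis _ _ hV.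
have -> : f = fun x => \sum_i c i x *: L (e i).
  apply/funext => x; rewrite -[LHS]/(L x) [in LHS](eE x) linear_sum.
  by apply: eq_bigr => i _; rewrite linearZ.
apply: continuous_big; first exact: add_continuous.
by move=> i _ x; apply: cvgZr_tmp; apply: cc.
Qed.

#[global] Instance findim_regular : findim R^o.
Proof.
have il : linear (id : R^o -> R^o) by [].
split; exists 1%N, (fun _ => 1), (fun _ => to_linear il); split=> [i|x].
  by move=> x; exact: cvg_id.
by rewrite big_ord1 /= [_ *: _]mulr1.
Qed.

#[global] Instance findim_real : findim (R : normedModType R).
Proof. exact: findim_regular. Qed.

Lemma coord_linear m n i j : linear (fun M : 'M[R]_(m, n) => M i j : R^o).
Proof. by move=> a u v; rewrite !mxE. Qed.

#[global] Instance findim_rV n : findim 'rV[R]_n.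
Proof.
split; exists n, (fun i => delta_mx 0 i), (fun i => to_linear (coord_linear 0 i)).
split=> [i|x]; first exact: coord_continuous.
by rewrite [LHS]row_sum_delta.
Qed.

Lemma fst_linear V W : linear (fst : V * W -> V). Proof. by []. Qed.
Lemma snd_linear V W : linear (snd : V * W -> W). Proof. by []. Qed.
Lemma inl_linear V W : linear (fun x : V => (x, 0) : V * W).
Proof. by move=> a u v; congr pair; rewrite /= scaler0 addr0. Qed.
Lemma inr_linear V W : linear (fun x : W => (0, x) : V * W).
Proof. by move=> a u v; congr pair; rewrite /= scaler0 addr0. Qed.

#[global] Instance findim_prod V W {hV : findim V} {hW : findim W} :
  findim (V * W)%type.
Proof.
have [n [e [c [cc eE]]]] := @findim_basis _ _ hV.
have [m [d [b [cb dE]]]] := @findim_basis _ _ hW.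
have cl i : linear (fun x : V * W => c i x.1) by move=> a u v; rewrite linearP.
have dl i : linear (fun x : V * W => b i x.2) by move=> a u v; rewrite linearP.
pose C (i : 'I_(n + m)) := match fintype.split i with
  | inl j => to_linear (cl j) | inr j => to_linear (dl j) end.
pose E (i : 'I_(n + m)) : V * W := match fintype.split i with
  | inl j => (e j, 0) | inr j => (0, d j) end.
split; exists (n + m)%N, E, C; split=> [i|[x y]].
  rewrite /C; case: (fintype.split i) => j z /=.
    by apply: continuous_comp; [exact: cvg_fst|exact: cc].
  by apply: continuous_comp; [exact: cvg_snd|exact: cb].
rewrite big_split_ord /=.
rewrite (eq_bigr (fun i => (c i x *: e i, 0))); last first.
  by move=> i _; rewrite /C /E (unsplitK (inl i)) /=; congr pair; rewrite /= scaler0.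
rewrite [X in _ + X](eq_bigr (fun i => (0, b i y *: d i))); last first.
  by move=> i _; rewrite /C /E (unsplitK (inr i)) /=; congr pair; rewrite /= scaler0.
have S1 (F : 'I_n -> V) : \sum_i (F i, 0 : W) = (\sum_i F i, 0).
  by elim/big_rec2 : _ => // i ? ? _ ->; congr pair; rewrite /= addr0.
have S2 (F : 'I_m -> W) : \sum_i (0 : V, F i) = (0, \sum_i F i).
  by elim/big_rec2 : _ => // i ? ? _ ->; congr pair; rewrite /= addr0.
by rewrite S1 S2 -eE -dE; congr pair; rewrite /= ?addr0 ?add0r.
Qed.

End findim_instances.

(** * Germs of smooth maps *)

Section smooth_at.
Context {R : realType}.
Implicit Types V W Z : normedModType R.

(** The neighbourhood is chosen before the order of differentiability: one [U] serves for all
    orders. *)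
Definition smooth_at V W (x : V) (f : V -> W) : Prop :=
  exists2 U, open_nbhs x U & smooth_on U f.

(** Each order of differentiability is a local property, so neighbourhoods may depend on the point.
    Smoothness conditions on charts thereby become statements about germs. *)
Lemma smooth_onP V W (U : set V) (f : V -> W) : open U ->
  smooth_on U f <-> forall x, U x -> smooth_at x f.
Proof.
move=> oU; split=> [Uf x Ux|sf k]; first by exists U.
have {}sf x : U x -> exists A, [/\ open A, A x & C_on k A f].
  by move=> /sf[A [oA Ax] Af]; exists A; split=> //; exact: Af.
elim: k f sf => [|k IH] f sf; split=> //.
- by move=> x /sf[A [_ Ax [cf _]]]; exact: cf.
- by move=> x /sf[A [_ Ax [cf _]]]; exact: cf.
move=> v; split=> [x /sf[A [_ Ax [_ df]]]|]; first by have [+ _] := df v; exact.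
apply: IH => x /sf[A [oA Ax [_ df]]]; have [_ Df] := df v.
by exists A.
Qed.

Lemma smooth_at_continuous V W x (f : V -> W) :
  smooth_at x f -> {for x, continuous f}.
Proof. by move=> [U [_ Ux] /(_ 0%N)/C_on_continuous]; exact. Qed.

Lemma smooth_at_near V W x (f : V -> W) :
  smooth_at x f -> \forall y \near x, smooth_at y f.
Proof.
move=> [U [oU Ux] sf]; near=> y; exists U => //; split=> //.
by near: y; exact: open_nbhs_nbhs.
Unshelve. all: by end_near. Qed.

Lemma smooth_at_ext V W x (f g : V -> W) : (\forall y \near x, f y = g y) ->
  smooth_at x f -> smooth_at x g.
Proof.
rewrite -[X in X -> _]/(nbhs x _) nbhsE => -[A [oA Ax] fg] [U [oU Ux] sf].
exists (U `&` A) => [|k]; first by split; [exact: openI|].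
apply: (@eq_C_on _ _ _ _ _ f); first exact: openI.
  by move=> y [_ Ay]; apply: fg.
by apply: sub_C_on (sf k).
Qed.

Lemma smooth_at_comp V W Z {hW : findim W} {hZ : findim Z} x (f : V -> W)
    (g : W -> Z) : smooth_at x f -> smooth_at (f x) g -> smooth_at x (g \o f).
Proof.
move=> [U [oU Ux] sf] [T [oT Tfx] sg].
have [A [oA Ax] AT] : exists2 A, open_nbhs x A & A `<=` U `&` f @^-1` T.
  have : nbhs x (U `&` f @^-1` T).
    apply: filterI; first exact: open_nbhs_nbhs.
    by apply: (C_on_continuous (sf 0%N) Ux); exact: open_nbhs_nbhs.
  by rewrite nbhsE.
exists A => // k; apply: (C_on_comp (T := T)) => //.
- by move=> _ [y /AT[_ Ty] <-].
- by apply: sub_C_on (sf k) => y /AT[].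
Qed.

Lemma smooth_at_cst V W x (a : W) : smooth_at x (fun _ : V => a).
Proof.
by exists setT => [|k]; [split=> //; exact: openT|exact: C_on_cst].
Qed.

Lemma smooth_at_linear V W {hV : findim V} x (f : V -> W) :
  linear f -> smooth_at x f.
Proof.
move=> fl; exists setT => [|k]; first by split=> //; exact: openT.
by apply: (@C_on_linear _ _ _ k setT (to_linear fl)); exact: findim_linear_continuous.
Qed.

Lemma smooth_at_id V {hV : findim V} (x : V) : smooth_at x id.
Proof. exact: smooth_at_linear. Qed.

Lemma smooth_atD V W x (f g : V -> W) : smooth_at x f -> smooth_at x g ->
  smooth_at x (fun y => f y + g y).
Proof.
move=> [A [oA Ax] sf] [B [oB Bx] sg]; have oAB := openI oA oB.
exists (A `&` B) => // k; apply: C_onD => //.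
  by apply: sub_C_on (sf k).
by apply: sub_C_on (sg k).
Qed.

Lemma smooth_at_linl V W Z {hW : findim W} x (L : W -> Z) (f : V -> W) :
  linear L -> smooth_at x f -> smooth_at x (fun y => L (f y)).
Proof.
move=> lL [U [oU Ux] sf]; exists U => // k.
by apply: (@C_on_linl _ _ _ _ k U (to_linear lL)) => //; exact: findim_linear_continuous.
Qed.

Lemma smooth_at_pair V W Z {hW : findim W} {hZ : findim Z} x (f : V -> W)
    (g : V -> Z) : smooth_at x f -> smooth_at x g ->
  smooth_at x (fun y => (f y, g y)).
Proof.
move=> sf sg.
apply: smooth_at_ext (smooth_atD (smooth_at_linl (@inl_linear _ W Z) sf)
                   (smooth_at_linl (@inr_linear _ W Z) sg)).
apply: nearW => y.
by congr pair; rewrite /= ?addr0 ?add0r.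
Qed.

Lemma smooth_at_addr V {hV : findim V} x (a : V) : smooth_at x (fun y => y + a).
Proof. by apply: smooth_atD; [exact: smooth_at_id|exact: smooth_at_cst]. Qed.

Lemma smooth_at_derive V W x v (f : V -> W) : smooth_at x f ->
  smooth_at x ('D_v f).
Proof.
move=> [U Ux sf]; exists U => // k.
by have [_ /(_ v)[]] := sf k.+1.
Qed.

Lemma smooth_at_derivable V W x v (f : V -> W) : smooth_at x f -> derivable f x v.
Proof. by move=> [U [_ Ux] /(_ 1%N)[_ /(_ v)[+ _]]]; exact. Qed.

Lemma smooth_at_differentiable V W {hV : findim V} {hW : findim W} x (f : V -> W) :
  smooth_at x f -> differentiable f x.
Proof. by move=> [U [oU Ux] sf]; apply: (C1_differentiable oU Ux); exact: sf. Qed.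

End smooth_at.

(** * The scalar implicit function theorem *)

Section implicit_function.
Context {R : realType} {V : normedModType R} {hV : findim V}.
Variables (F : R^o * V -> R^o).
Hypothesis (F0 : F (0, 0) = 0) (sF : smooth_at (0, 0) F).

Lemma is_derive_fst t y : derivable F (t, y) (1, 0) ->
  is_derive t 1 (fun s : R => F (s, y)) ('D_(1, 0) F (t, y)).
Proof.
move=> df; apply: cvg_is_derive.
have -> : (fun h : R => h^-1 *: (F (h *: 1 + t, y) - F (t, y))) =
    (fun h => h^-1 *: (F (h *: (1, 0) + (t, y)) - F (t, y))); last exact: df.
apply/funext => h; congr (_ *: (F _ - _)); congr pair.
by rewrite /= scaler0 add0r.
Qed.

Let dt (z : R^o * V) : R := 'D_(1, 0) F z.
Let theta (r : R) (y : V) : R^o := xget 0 [set t : R | `|t| < r /\ F (t, y) = 0].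

(** Near the origin [F] is strictly increasing in [t]: the intermediate value theorem gives a root,
    monotonicity makes it unique and continuous in [y], the mean value theorem differentiates it,
    and the formula for its derivative bootstraps smoothness. Uniqueness in a fixed interval is what
    the quotient chart relies on. *)
Lemma implicit_function_pos : 0 < 'D_(1, 0) F (0, 0) ->
  exists2 theta : V -> R^o, theta 0 = 0 /\ smooth_at 0 theta &
    (\forall y \near (0 : V), F (theta y, y) = 0) /\
    exists2 e : R, 0 < e & \forall y \near (0 : V), forall t : R,
      `|t| < e -> F (t, y) = 0 -> t = theta y.
Proof.
move=> dF0; have [U [oU U0] sU] := sF.
have sD : smooth_at (0, 0) dt := smooth_at_derive _ sF.
have [r r0 rP] : exists2 r : R, 0 < r & forall (t : R) (y : V), `|t| <= r -> `|y| < r ->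
    U (t, y) /\ 0 < dt (t, y).
  have : \forall z \near (0 : R^o, 0 : V), U z /\ 0 < dt z.
    near=> z; split; first by near: z; exact: open_nbhs_nbhs.
    near: z; apply: (@cvgr_gt _ _ _ _ dt) dF0.
    exact: (smooth_at_continuous sD).
  (* Halving the radius makes room for the closed condition on [t], which includes the endpoints
     where the sign of [F] is read. *)
  move=> /nbhs_ballP[d /= d0 dP]; exists (d / 2); first by rewrite divr_gt0.
  move=> t y tr yr; apply: dP; split; rewrite -ball_normE /= sub0r normrN.
    by apply: le_lt_trans tr _; rewrite gtr_pMr// invf_lt1// ltr1n.
  by apply: lt_trans yr _; rewrite gtr_pMr// invf_lt1// ltr1n.
have dtP (t : R) (y : V) : `|t| <= r -> `|y| < r -> is_derive t 1 (fun s : R => F (s, y)) (dt (t, y)).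
  move=> tr yr; apply: is_derive_fst.
  by have [Uty _] := rP _ _ tr yr; have [_ /(_ (1, 0))[+ _]] := sU 1%N; exact.
have rI (a b x : R) : `|a| <= r -> `|b| <= r -> a <= x <= b -> `|x| <= r.
  by move=> /ler_normlP[? ?] /ler_normlP[? ?] /andP[? ?]; apply/ler_normlP; split; lra.
have cF (a b : R) (y : V) : `|a| <= r -> `|b| <= r -> `|y| < r ->
    {within `[a, b], continuous (fun s : R => F (s, y))}.
  move=> ar br yr; apply: derivable_within_continuous => x; rewrite in_itv /= => xab.
  by have h := dtP _ _ (rI _ _ _ ar br xab) yr; apply: ex_derive.
have mvt (a b : R) (y : V) : `|a| <= r -> `|b| <= r -> `|y| < r -> a <= b ->
    exists2 c, a <= c <= b & F (b, y) - F (a, y) = dt (c, y) * (b - a).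
  move=> ar br yr ab.
  have Hd x : x \in `]a, b[%R -> is_derive x 1 (fun s : R => F (s, y)) (dt (x, y)).
    rewrite in_itv /= => /andP[/ltW ax /ltW xb].
    by apply: dtP yr; apply: (rI a b x ar br); apply/andP; split.
  have [c] := MVT_segment ab Hd (cF _ _ _ ar br yr).
  by rewrite in_itv /= => cab E; exists c.
have incr (a b : R) (y : V) : `|a| <= r -> `|b| <= r -> `|y| < r -> a < b -> F (a, y) < F (b, y).
  move=> ar br yr ab; have [c cab E] := mvt _ _ _ ar br yr (ltW ab).
  rewrite -subr_gt0 E mulr_gt0 ?subr_gt0//.
  by have [] := rP c y (rI _ _ _ ar br cab) yr.
have rr : `|r| <= r by rewrite ger0_norm// ltW.
have rN : `|- r| <= r by rewrite normrN.
have n0 : `|0 : V| < r by rewrite normr0.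
have r00 : `|0 : R| <= r by rewrite normr0 ltW.
have cFy (t : R) (y : V) : `|t| <= r -> `|y| < r -> {for y, continuous (fun z => F (t, z))}.
  move=> tr yr; have [Uty _] := rP _ _ tr yr.
  have cFz := C_on_continuous (sU 0%N) Uty.
  apply: (@continuous_comp _ _ _ (fun z : V => (t : R^o, z)) F) => //.
  by apply: pair_continuous_at; [exact: cvg_cst|exact: cvg_id].
(* The signs at [- r] and [r] are strict for [y = 0], hence persist nearby; [d <= r] keeps [y] in
   the region of monotonicity. *)
have [d d0 [dr dP]] : exists2 d : R, 0 < d & d <= r /\ forall y, `|y| < d ->
    F (- r, y) < 0 < F (r, y).
  have : \forall y \near (0 : V), F (- r, y) < 0 < F (r, y).
    have H1 := cFy _ _ rN n0; have H2 := cFy _ _ rr n0.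
    near=> y; apply/andP; split.
      near: y; apply: (@cvgr_lt _ _ _ _ (fun z => F (- r, z))); first exact: H1.
      by rewrite -F0; apply: incr => //; rewrite oppr_lt0.
    near: y; apply: (@cvgr_gt _ _ _ _ (fun z => F (r, z))); first exact: H2.
    by rewrite -F0; apply: incr.
  move=> /nbhs_ballP[d /= d0 dP]; exists (Num.min d r); first by rewrite lt_min d0.
  split=> [|y]; first by rewrite ge_min lexx orbT.
  by rewrite lt_min => /andP[yd _]; apply: dP; rewrite -ball_normE /= sub0r normrN.
pose th := theta r.
have thP (y : V) : `|y| < d -> `|th y| < r /\ F (th y, y) = 0.
  move=> yd; have yr := lt_le_trans yd dr; have /andP[Fn Fp] := dP _ yd.
  have [c cr Fc] : exists2 c, c \in `[-r, r]%R & F (c, y) = 0.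
    apply: (@IVT _ (fun s : R => F (s, y)) (- r) r 0); first by rewrite ge0_cp// ltW.
      exact: cF.
    by rewrite ge_min (ltW Fn)/= le_max (ltW Fp) orbT.
  rewrite /th /theta; apply: (xgetPex 0 (P := [set t : R | `|t| < r /\ F (t, y) = 0])).
  exists c; split=> //; move: cr; rewrite in_itv /= ltr_norml => /andP[c1 c2].
  apply/andP; split; rewrite lt_neqAle ?c1 ?c2 andbT; apply/eqP => E.
    by move: Fn; rewrite E Fc ltxx.
  by move: Fp; rewrite -E Fc ltxx.
have thU (y : V) (t : R) : `|y| < d -> `|t| < r -> F (t, y) = 0 -> t = th y.
  move=> yd tr Ft; have [thr Fth] := thP _ yd; have yr := lt_le_trans yd dr.
  case: (ltgtP t (th y)) => // lt.
    by have := incr _ _ _ (ltW tr) (ltW thr) yr lt; rewrite Ft Fth ltxx.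
  by have := incr _ _ _ (ltW thr) (ltW tr) yr lt; rewrite Ft Fth ltxx.
have cth (y : V) : `|y| < d -> {for y, continuous th}.
  move=> yd; apply/cvgrPdist_le => /= e e0.
  have [thr Fth] := thP _ yd; have yr := lt_le_trans yd dr.
  (* Small enough that [th y - s] and [th y + s] stay in the interval of monotonicity; the opposite
     signs of [F] there trap the root for nearby [z]. *)
  pose s := Num.min e ((r - `|th y|) / 2).
  have s0 : 0 < s by rewrite lt_min e0 divr_gt0// subr_gt0.
  have se : s <= e by rewrite ge_min lexx.
  have sr : s < r - `|th y|.
    rewrite gt_min; apply/orP; right.
    by rewrite gtr_pMr ?subr_gt0// invf_lt1// ltr1n.
  have tn : `|th y - s| < r.
    by apply: le_lt_trans (ler_normB _ _) _; rewrite (gtr0_norm s0) -ltrBrDl.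
  have tp : `|th y + s| < r.
    by apply: le_lt_trans (ler_normD _ _) _; rewrite (gtr0_norm s0) -ltrBrDl.
  have H1 := cFy _ _ (ltW tn) yr; have H2 := cFy _ _ (ltW tp) yr.
  have N : F (th y - s, y) < 0.
    by rewrite -Fth; apply: incr (ltW tn) (ltW thr) yr _; rewrite ltrBlDr ltrDl.
  have P : 0 < F (th y + s, y).
    by rewrite -[ltLHS]Fth; apply: incr (ltW thr) (ltW tp) yr _; rewrite ltrDl.
  near=> z.
  have zd : `|z| < d.
    by near: z; apply: (@cvgr_lt _ _ _ _ (fun z : V => `|z|)) yd; exact: cvg_norm.
  have zr := lt_le_trans zd dr.
  have [thzr Fthz] := thP _ zd.
  have Nz : F (th y - s, z) < 0.
    by near: z; apply: (@cvgr_lt _ _ _ _ (fun z => F (th y - s, z))) N; exact: H1.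
  have Pz : 0 < F (th y + s, z).
    by near: z; apply: (@cvgr_gt _ _ _ _ (fun z => F (th y + s, z))) P; exact: H2.
  apply: le_trans se; rewrite ler_distlC; apply/andP; split; rewrite leNgt; apply/negP => lt.
    by have := lt_trans (incr _ _ _ (ltW thzr) (ltW tn) zr lt) Nz; rewrite Fthz ltxx.
  by have := lt_trans Pz (incr _ _ _ (ltW tp) (ltW thzr) zr lt); rewrite Fthz ltxx.
  Unshelve. all: try by end_near.
pose D (v : V) (z : R^o * V) : R := 'D_(0, v) F z.
(* The value forced by differentiating [F (th y, y) = 0] along [v]. *)
have dth y v : `|y| < d -> is_derive y v th (- (dt (th y, y))^-1 * D v (th y, y)).
  move=> yd; have yr := lt_le_trans yd dr; have [thr Fth] := thP _ yd.
  have [Uy dt0] := rP _ _ (ltW thr) yr.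
  pose line (h : R) : V := h *: v + y.
  have cline : {for 0, continuous line}.
    by apply: cvgD; [apply: cvgZr_tmp; exact: cvg_id|exact: cvg_cst].
  have line0 : line 0 = y by rewrite /line scale0r add0r.
  have clth : {for 0, continuous (th \o line)}.
    by apply: continuous_comp => //; rewrite line0; exact: cth.
  (* A mean value point between [th y] and [th (line h)], chosen for each [h]; the bound on its
     distance to [th y] makes it converge, by continuity of [th]. When [line h] leaves the ball,
     [th y] is a dummy value. *)
  have /choice[xi xiP] (h : R) : exists c : R,
      `|c - th y| <= `|th (line h) - th y| /\
      (`|line h| < d -> F (th (line h), line h) - F (th y, line h)
         = dt (c, line h) * (th (line h) - th y)).
    case: (ltP `|line h| d) => [lhd|_]; last by exists (th y); rewrite subrr normr0.
    have [thlr _] := thP _ lhd; have lr := lt_le_trans lhd dr.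
    case: (leP (th y) (th (line h))) => hle.
      have [c /andP[c1 c2] E] := mvt _ _ _ (ltW thr) (ltW thlr) lr hle.
      exists c; split=> [|_ //]; rewrite !ger0_norm ?subr_ge0// lerD2r//.
    have [c /andP[c1 c2] E] := mvt _ _ _ (ltW thlr) (ltW thr) lr (ltW hle).
    exists c; split=> [|_].
      by rewrite distrC [leRHS]distrC !ger0_norm ?subr_ge0 ?(ltW hle)// lerD2l lerN2.
    by rewrite -opprB E -mulrN opprB.
  have cxi : xi h @[h --> (0 : R)] --> th y.
    apply/cvgrPdist_le => e e0; near=> h; rewrite distrC.
    have [+ _] := xiP h => /le_trans; apply; rewrite distrC; near: h.
    by have /cvgrPdist_le := clth; rewrite /= line0; apply.
  have cdt : {for (th y, y), continuous dt}.
    by have [_ /(_ (1, 0))[_ [Dc _]]] := sU 1%N; exact: Dc.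
  have cG : dt (xi h, line h) @[h --> (0 : R)] --> dt (th y, y).
    have cp : (xi h, line h) @[h --> (0 : R)] --> (th y : R^o, y).
      have cl : line h @[h --> (0 : R)] --> y by rewrite -[X in _ --> X]line0; exact: cline.
      exact: (cvg_pair cxi cl).
    exact: (cvg_comp _ _ cp cdt).
  have dD : h^-1 *: (F (th y, line h) - F (th y, y)) @[h --> 0^'] --> D v (th y, y).
    have [_ /(_ (0, v))[/(_ _ Uy) + _]] := sU 1%N.
    suff -> : (fun h : R => h^-1 *: (F (th y, line h) - F (th y, y))) =
       (fun h => h^-1 *: (F (h *: (0, v) + (th y, y)) - F (th y, y))) by [].
    apply/funext => h; congr (_ *: (F _ - _)); congr pair.
    by rewrite /= scaler0 add0r.
  apply: cvg_is_derive.
  have cQ : - (dt (xi h, line h))^-1 * (h^-1 *: (F (th y, line h) - F (th y, y)))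
      @[h --> 0^'] --> - (dt (th y, y))^-1 * D v (th y, y).
    apply: cvgM; last exact: dD.
    apply: cvgN; apply: cvgV; first by rewrite gt_eqF.
    exact: cvg_dnbhs.
  apply: cvg_trans cQ; apply: near_eq_cvg; near=> h.
  have lhd : `|line h| < d.
    near: h; apply: (@cvgr_lt _ _ _ _ (fun h : R => `|line h|)) yd.
    have H : `|line h| @[h --> (0 : R)] --> `|y|.
      have cn : {for 0, continuous (fun h => `|line h|)}.
        by apply: (continuous_comp cline); exact: norm_continuous.
      by rewrite -[in X in _ --> X]line0; exact: cn.
    exact: cvg_dnbhs.
  have dtx : dt (xi h, line h) != 0.
    rewrite gt_eqF//; near: h; apply: (@cvgr_gt _ _ _ _ (fun h => dt (xi h, line h))) dt0.
    exact: cvg_dnbhs.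
  have [_ /(_ lhd) E] := xiP h; have [_ Fl] := thP _ lhd.
  have E2 : F (th y, line h) - F (th y, y) = - (dt (xi h, line h) * (th (line h) - th y)).
    by rewrite -E Fth Fl sub0r opprK subr0.
  rewrite E2 -/(line h) scalerN mulrN mulNr opprK -scalerAr.
  by rewrite mulrA mulVf// mul1r.
  Unshelve. all: try by end_near.
(* If [th] is of class C^k, so is the right-hand side of its derivative formula, a composite with
   [y |-> (th y, y)]; hence [th] is of class C^(k+1). *)
have thS : forall k, C_on k (ball (0 : V) d) th.
  have ob : open (ball (0 : V) d) by exact: ball_open.
  have bE y : ball (0 : V) d y -> `|y| < d by rewrite -ball_normE /= sub0r normrN.
  elim=> [|k IH]; split=> //; try by move=> y /bE; exact: cth.
  move=> v; split=> [y /bE yd|]; first by have h := dth y v yd; apply: ex_derive.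
  have Cp : C_on k (ball (0 : V) d) (fun y => (th y, y) : R^o * V).
    have C1 : C_on k (ball (0 : V) d) (fun y => (th y, 0) : R^o * V).
      apply: (@C_on_linl _ _ _ _ k _ (to_linear (@inl_linear _ R^o V))) => //.
      exact: (findim_linear_continuous (@inl_linear _ R^o V)).
    have C2 : C_on k (ball (0 : V) d) (fun y => (0, y) : R^o * V).
      apply: (@C_on_linear _ _ _ k _ (to_linear (@inr_linear _ R^o V))) => //.
      exact: (findim_linear_continuous (@inr_linear _ R^o V)).
    apply: eq_C_on (C_onD ob C1 C2) => // y _.
    by congr pair; rewrite /= ?addr0 ?add0r.
  have pU : (fun y => (th y, y) : R^o * V) @` ball (0 : V) d `<=` U.
    move=> _ [y /bE yd <-]; have [thr _] := thP _ yd.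
    by have [] := rP _ _ (ltW thr) (lt_le_trans yd dr).
  have Cdt : C_on k U dt by have [_ /(_ (1, 0))[]] := sU k.+1.
  have CD : C_on k U (D v) by have [_ /(_ (0, v))[]] := sU k.+1.
  have Cdtp : C_on k (ball (0 : V) d) (dt \o (fun y : V => (th y, y) : R^o * V)).
    exact: C_on_comp ob oU pU Cp Cdt.
  have CDp : C_on k (ball (0 : V) d) (D v \o (fun y : V => (th y, y) : R^o * V)).
    exact: C_on_comp ob oU pU Cp CD.
  have dtp0 y : ball (0 : V) d y -> dt (th y, y) != 0.
    move=> /bE yd; have [thr _] := thP _ yd; rewrite gt_eqF//.
    by have [] := rP _ _ (ltW thr) (lt_le_trans yd dr).
  have Cm := @C_on_cst _ V R k (ball (0 : V) d) (-1).
  have CV := C_onZ ob Cm (C_onZ ob (C_onV ob dtp0 Cdtp) CDp).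
  apply: (eq_C_on ob _ CV) => y /bE yd; have h := dth y v yd; rewrite derive_val.
  by rewrite scaleN1r mulNr.
have near_d : \forall y \near (0 : V), `|y| < d.
  by apply/nbhs_ballP; exists d => //= y; rewrite -ball_normE /= sub0r normrN.
exists th; split.
- by apply/esym/thU; rewrite ?normr0.
- by exists (ball (0 : V) d) => //; split; [exact: ball_open|exact: ballxx].
- by apply: filterS near_d => y yd; have [] := thP _ yd.
- by exists r => //; apply: filterS near_d => y yd t; exact: thU.
Qed.

End implicit_function.

Lemma implicit_function (R : realType) (V : normedModType R) {hV : findim V}
    (F : R^o * V -> R^o) : F (0, 0) = 0 -> smooth_at (0, 0) F ->
  'D_(1, 0) F (0, 0) != 0 ->
  exists2 theta : V -> R^o, theta 0 = 0 /\ smooth_at 0 theta &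
    (\forall y \near (0 : V), F (theta y, y) = 0) /\
    exists2 e : R, 0 < e & \forall y \near (0 : V), forall t : R,
      `|t| < e -> F (t, y) = 0 -> t = theta y.
Proof.
move=> F0 sF; rewrite neq_lt => /orP[neg|]; last exact: implicit_function_pos.
have Nlin : linear (-%R : R^o -> R^o) by move=> a u v; rewrite opprD scalerN.
have sNF : smooth_at (0, 0) (fun z => - F z).
  exact: (smooth_at_linl Nlin sF).
have [||th [th0 sth] [Fth [e e0 eP]]] := @implicit_function_pos _ _ _ (fun z => - F z) _ sNF.
- by rewrite F0 oppr0.
- by rewrite (_ : (fun z => - F z) = - F)// deriveN ?oppr_gt0//; exact: smooth_at_derivable.
exists th; split=> //.
  by apply: filterS Fth => y /eqP; rewrite oppr_eq0 => /eqP.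
exists e => //; apply: filterS eP => y H t te Ft; apply: H => //.
by rewrite Ft oppr0.
Qed.

(** * Lie groups from a chart at the identity *)

Lemma near_continuous (X Y : topologicalType) (f : X -> Y) (x : X) (P : set Y) :
  {for x, continuous f} -> (\forall y \near f x, P y) -> \forall z \near x, P (f z).
Proof. by move=> cf; exact: cf. Qed.

Lemma open_setX (X Y : topologicalType) (A : set X) (B : set Y) :
  open A -> open B -> open (A `*` B).
Proof.
move=> oA oB; have -> : A `*` B = fst @^-1` A `&` snd @^-1` B by [].
by apply: openI; apply: open_comp => // z _; [exact: cvg_fst|exact: cvg_snd].
Qed.

Lemma smooth_at_eq (R : realType) (V W : normedModType R) (x : V) (f g : V -> W) :
  (forall y, f y = g y) -> smooth_at x f -> smooth_at x g.
Proof. by move=> /funext ->. Qed.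

(** The separation and countability axioms are those of a manifold; a chart at the identity cannot
    provide them. *)
HB.mixin Record isTopGroup T of Topological T := {
  tg_one : T;
  tg_inv : T -> T;
  tg_mul : T -> T -> T;
  tg_mulA : associative tg_mul;
  tg_mul1 : left_id tg_one tg_mul;
  tg_mulV : left_inverse tg_one tg_inv tg_mul;
  tg_mul1r : right_id tg_one tg_mul;
  tg_mulVr : right_inverse tg_one tg_inv tg_mul;
  tg_mul_continuous : continuous (fun z : T * T => tg_mul z.1 z.2);
  tg_inv_continuous : continuous tg_inv;
  topgroup_hausdorff : hausdorff_space T;
  topgroup_second_countable : @second_countable T
}.

(* The operations are repeated in the mixin because a structure joining [Group]
   and [Topological] can no longer be inserted above [LieGroup]. *)
#[short(type="topGroupType")]
HB.structure Definition TopGroup := {T of Topological T & isTopGroup T}.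

HB.instance Definition _ (T : topGroupType) :=
  isGroup.Build T tg_mulA tg_mul1 tg_mul1r tg_mulV tg_mulVr.

HB.instance Definition _ (R : realType) (G : lieGroupType R) :=
  @isTopGroup.Build G 1%g (fun x => x^-1)%g (fun x y => x * y)%g
    (@mulgA G) (@mul1g G) (@mulVg G) (@mulg1 G) (@mulgV G)
    (@smooth_mulg R G).1 (@smooth_invg R G).1
    (@manifold_hausdorff R G) (@manifold_second_countable R G).

Section topgroup.
Variable T : topGroupType.

Lemma mulg_continuous : continuous (fun z : T * T => (z.1 * z.2)%g).
Proof. exact: tg_mul_continuous. Qed.

Lemma invg_continuous : continuous (fun x : T => x^-1%g).
Proof. exact: tg_inv_continuous. Qed.

Lemma mulg_continuous_at (X : topologicalType) (f g : X -> T) x :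
  {for x, continuous f} -> {for x, continuous g} ->
  {for x, continuous (fun y => f y * g y)%g}.
Proof.
move=> cf cg; apply: (@continuous_comp _ _ _ (fun y => (f y, g y)) (fun z : T * T => (z.1 * z.2)%g)).
  exact: pair_continuous_at.
exact: mulg_continuous.
Qed.

Lemma invg_continuous_at (X : topologicalType) (f : X -> T) x :
  {for x, continuous f} -> {for x, continuous (fun y => (f y)^-1)%g}.
Proof. by move=> cf; apply: (continuous_comp cf); exact: invg_continuous. Qed.

Lemma mulgl_continuous (g : T) : continuous (fun x : T => (g * x)%g).
Proof. by move=> x; apply: mulg_continuous_at; [exact: cvg_cst|exact: cvg_id]. Qed.

Lemma mulgr_continuous (g : T) : continuous (fun x : T => (x * g)%g).
Proof. by move=> x; apply: mulg_continuous_at; [exact: cvg_id|exact: cvg_cst]. Qed.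

End topgroup.

(** [phi] and [psi] are total maps of which only the germs at [1] and [0] matter. Conjugation is
    required for every [g]: on a disconnected group, multiplication near [1] does not control it. *)
Record local_lie (R : realType) (T : topGroupType) (n : nat)
    (phi : T -> 'rV[R]_n) (psi : 'rV[R]_n -> T) : Prop := LocalLie {
  ll_phi1 : phi 1%g = 0;
  ll_psi0 : psi 0 = 1%g;
  ll_phiK : \forall x \near (1%g : T), psi (phi x) = x;
  ll_psiK : \forall y \near (0 : 'rV[R]_n), phi (psi y) = y;
  ll_phic : \forall x \near (1%g : T), {for x, continuous phi};
  ll_psic : \forall y \near (0 : 'rV[R]_n), {for y, continuous psi};
  ll_mul : smooth_at (0, 0) (fun z : 'rV[R]_n * 'rV[R]_n => phi (psi z.1 * psi z.2)%g);
  ll_inv : smooth_at 0 (fun y : 'rV[R]_n => phi (psi y)^-1%g);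
  ll_conj : forall g, smooth_at 0 (fun y : 'rV[R]_n => phi (g * psi y * g^-1)%g) }.

Section lie_of.
Variables (R : realType) (T : topGroupType) (n : nat).
Variables (phi : T -> 'rV[R]_n) (psi : 'rV[R]_n -> T).
Hypothesis H : local_lie phi psi.
Local Notation E := 'rV[R]_n.

Let mu (z : E * E) : E := phi (psi z.1 * psi z.2)%g.

(** The points at which the chart may be used. [good_mul1] makes left translation by [x] smooth at
    [1], and [good_mulV] makes left translation by [x^-1] smooth at [x]: these compare the chart
    with its translates. *)
Record good (x : T) : Prop := Good {
  good_K : psi (phi x) = x;
  good_VK : psi (phi x^-1%g) = x^-1%g;
  good_phic : {for x, continuous phi};
  good_psiK : \forall y \near phi x, phi (psi y) = y;
  good_psic : {for phi x, continuous psi};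
  good_mul1 : smooth_at (phi x, 0) mu;
  good_mulV : smooth_at (phi x^-1%g, phi x) mu }.

Let phic1 : {for 1%g, continuous phi}.
Proof. exact: (nbhs_singleton (ll_phic H)). Qed.

Let near_phi (P : set E) : (\forall y \near (0 : E), P y) -> \forall x \near (1%g : T), P (phi x).
Proof. by move=> NP; apply: phic1; rewrite (ll_phi1 H). Qed.

Let near_inv (P : set T) : (\forall x \near (1%g : T), P x) -> \forall x \near (1%g : T), P x^-1%g.
Proof. by move=> NP; apply: invg_continuous; rewrite invg1. Qed.

Lemma good_near1 : \forall x \near (1%g : T), good x.
Proof.
have K := ll_phiK H; have VK := near_inv K.
have c := ll_phic H; have psic := near_phi (ll_psic H).
have pK : \forall x \near (1%g : T), \forall y \near phi x, phi (psi y) = y.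
  by apply: (@near_phi (fun z => \forall y \near z, phi (psi y) = y)); apply: nbhs_interior; exact: ll_psiK H.
have smu := smooth_at_near (ll_mul H).
have m1 : \forall x \near (1%g : T), smooth_at (phi x, 0) mu.
  have cp : {for 1%g, continuous (fun x => (phi x, 0 : E))}.
    by apply: pair_continuous_at; [exact: phic1|exact: cvg_cst].
  by have := @near_continuous _ _ _ _ (fun z : E * E => smooth_at z mu) cp; apply; rewrite (ll_phi1 H).
have mV : \forall x \near (1%g : T), smooth_at (phi x^-1%g, phi x) mu.
  have cp : {for 1%g, continuous (fun x : T => (phi x^-1%g, phi x))}.
    apply: pair_continuous_at; last exact: phic1.
    apply: (@continuous_comp _ _ _ (fun x : T => x^-1%g) phi); first exact: invg_continuous.
    by rewrite invg1.
  by have := @near_continuous _ _ _ _ (fun z : E * E => smooth_at z mu) cp; apply; rewrite invg1 (ll_phi1 H).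
by near do split.
Unshelve. all: by end_near. Qed.

Definition unit_dom : set T := interior good.

Let unit_dom_open : open unit_dom. Proof. exact: open_interior. Qed.
Let unit_dom_good x : unit_dom x -> good x. Proof. exact: interior_subset. Qed.
Let unit_dom1 : unit_dom 1%g. Proof. exact: good_near1. Qed.

Section translated_chart.
Variable g : T.

Definition tdom : set T := [set x | unit_dom (g^-1 * x)%g].
Definition timg : set E := phi @` unit_dom.
Definition tmap (x : T) : E := phi (g^-1 * x)%g.
Definition tinv (y : E) : T := (g * psi y)%g.

Lemma tdom_open : open tdom.
Proof.
by apply: (@open_comp _ _ (fun x : T => (g^-1 * x)%g)) => // x _; exact: mulgl_continuous.
Qed.

Lemma timg_open : open timg.
Proof.
rewrite openE => _ [x Wx <-]; have gx := unit_dom_good Wx.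
have psiW : \forall y \near phi x, unit_dom (psi y).
  by apply: (good_psic gx); rewrite (good_K gx); exact: open_nbhs_nbhs.
near=> y; exists (psi y); first by near: y.
by near: y; exact: good_psiK gx.
Unshelve. all: by end_near. Qed.

Lemma tmap_sub : tmap @` tdom `<=` timg.
Proof. by move=> _ [x Wx <-]; exists (g^-1 * x)%g. Qed.

Lemma timgP y : timg y -> unit_dom (psi y) /\ phi (psi y) = y.
Proof. by move=> [x Wx <-]; have gx := unit_dom_good Wx; rewrite (good_K gx). Qed.

Lemma tinv_sub : tinv @` timg `<=` tdom.
Proof. by move=> _ [y /timgP[Wy _] <-]; rewrite /tdom /tinv /= mulKg. Qed.

Lemma tmapK x : tdom x -> tinv (tmap x) = x.
Proof. by move=> /unit_dom_good gx; rewrite /tinv /tmap (good_K gx) mulVKg. Qed.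

Lemma tinvK y : timg y -> tmap (tinv y) = y.
Proof. by move=> /timgP[_ e]; rewrite /tinv /tmap mulKg. Qed.

Lemma tmap_continuous_at x : tdom x -> {for x, continuous tmap}.
Proof.
move=> /unit_dom_good gx; apply: (@continuous_comp _ _ _ (fun x : T => (g^-1 * x)%g) phi).
  exact: mulgl_continuous.
exact: good_phic gx.
Qed.

Lemma psi_continuous_at y : timg y -> {for y, continuous psi}.
Proof. by move=> [x Wx <-]; exact: good_psic (unit_dom_good Wx). Qed.

Lemma tinv_continuous_at y : timg y -> {for y, continuous tinv}.
Proof.
move=> Iy; apply: (@continuous_comp _ _ _ psi (fun x : T => (g * x)%g)).
  exact: psi_continuous_at.
exact: mulgl_continuous.
Qed.

Lemma tmap_continuous : {within tdom, continuous tmap}.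
Proof.
by apply: continuous_in_subspaceT => x; rewrite inE; exact: tmap_continuous_at.
Qed.

Lemma tinv_continuous : {within timg, continuous tinv}.
Proof.
by apply: continuous_in_subspaceT => y; rewrite inE; exact: tinv_continuous_at.
Qed.

Definition tchart : chart R T n :=
  Chart tdom_open timg_open tmap_sub tinv_sub tmapK tinvK tmap_continuous tinv_continuous.

End translated_chart.

Section relative_smoothness.
Context {V : normedModType R} {hV : findim V}.

(** Left translation brings [f z0] to [1], so smoothness at any point is read in the single chart
    [phi]. *)
Definition lie_smooth_at (z0 : V) (f : V -> T) : Prop :=
  {for z0, continuous f} /\ smooth_at z0 (fun z => phi ((f z0)^-1 * f z)%g).

Let rel_continuous (z0 : V) (f : V -> T) : {for z0, continuous f} ->
  (fun z => (f z0)^-1 * f z)%g z @[z --> z0] --> (1%g : T).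
Proof.
move=> cf; rewrite -(mulVg (f z0)).
exact: (mulg_continuous_at (f := fun=> (f z0)^-1%g) (cvg_cst _) cf).
Qed.

Let rel_K (z0 : V) (f : V -> T) : {for z0, continuous f} ->
  \forall z \near z0, psi (phi ((f z0)^-1 * f z)%g) = ((f z0)^-1 * f z)%g.
Proof. by move=> cf; exact: (rel_continuous cf (ll_phiK H)). Qed.

(** With [v = h^-1 * f z0] one has [h^-1 * f z = v * ((f z0)^-1 * f z)], the normalised map
    translated by a good element. *)
Lemma lie_smooth_chart (z0 : V) (f : V -> T) h : tdom h (f z0) ->
  lie_smooth_at z0 f -> smooth_at z0 (tchart h \o f).
Proof.
move=> /unit_dom_good gv [cf sf]; set v := (h^-1 * f z0)%g in gv.
have s2 : smooth_at z0 (fun z => (phi v, phi ((f z0)^-1 * f z)%g) : E * E).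
  by apply: smooth_at_pair => //; exact: smooth_at_cst.
have s3 : smooth_at z0 (mu \o (fun z => (phi v, phi ((f z0)^-1 * f z)%g))).
  apply: (smooth_at_comp s2); rewrite mulVg (ll_phi1 H); exact: good_mul1 gv.
apply: smooth_at_ext s3; apply: filterS (rel_K cf) => z e.
by rewrite /mu /= e (good_K gv) /tmap /v -mulgA mulVKg.
Qed.

(** The normalised product is [(g z0)^-1 * ((f z0)^-1 * f z) * g z0] times [(g z0)^-1 * g z]; its
    first factor is where conjugation enters. *)
Lemma lie_smoothM (z0 : V) (f g : V -> T) : lie_smooth_at z0 f -> lie_smooth_at z0 g ->
  lie_smooth_at z0 (fun z => f z * g z)%g.
Proof.
move=> [cf sf] [cg sg]; split; first exact: mulg_continuous_at.
have s1 : smooth_at z0 ((fun y => phi ((g z0)^-1 * psi y * (g z0)^-1^-1)%g)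
    \o (fun z => phi ((f z0)^-1 * f z)%g)).
  by apply: (smooth_at_comp sf); rewrite mulVg (ll_phi1 H); exact: ll_conj H _.
have s3 : smooth_at z0 (mu \o (fun z => (phi ((g z0)^-1 * psi (phi ((f z0)^-1 * f z)) *
    (g z0)^-1^-1)%g, phi ((g z0)^-1 * g z)%g))).
  apply: (smooth_at_comp (smooth_at_pair s1 sg)).
  by rewrite /= !mulVg (ll_phi1 H) (ll_psi0 H) mulg1 mulgV (ll_phi1 H); exact: ll_mul H.
have cconj : (fun z => (g z0)^-1 * ((f z0)^-1 * f z) * g z0)%g z @[z --> z0] --> (1%g : T).
  have c1 : {for z0, continuous (fun z => (g z0)^-1 * ((f z0)^-1 * f z) * g z0)%g}.
    have ck (k : T) : {for z0, continuous (fun _ : V => k)} by exact: cvg_cst.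
    exact: mulg_continuous_at (mulg_continuous_at (ck _) (mulg_continuous_at (ck _) cf)) (ck _).
  by move: c1; rewrite /prop_for /continuous_at mulVg mulg1 mulVg.
have cK : \forall z \near z0, psi (phi ((g z0)^-1 * ((f z0)^-1 * f z) * g z0)%g) =
    ((g z0)^-1 * ((f z0)^-1 * f z) * g z0)%g by exact: (cconj _ (ll_phiK H)).
apply: smooth_at_ext s3.
apply: filterS3 (rel_K cf) (rel_K cg) cK => z ef eg ec.
by rewrite /mu /= ef invgK ec eg invgM !mulgA mulgK.
Qed.

(** [f z0 * (f z)^-1] is the inverse of [(f z0)^-1 * f z] conjugated by [f z0]. *)
Lemma lie_smoothV (z0 : V) (f : V -> T) : lie_smooth_at z0 f ->
  lie_smooth_at z0 (fun z => (f z)^-1)%g.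
Proof.
move=> [cf sf]; split; first exact: invg_continuous_at.
have s1 : smooth_at z0 ((fun y => phi (psi y)^-1%g) \o (fun z => phi ((f z0)^-1 * f z)%g)).
  by apply: (smooth_at_comp sf); rewrite mulVg (ll_phi1 H); exact: ll_inv H.
have s2 : smooth_at z0 ((fun y => phi (f z0 * psi y * (f z0)^-1)%g) \o
    ((fun y => phi (psi y)^-1%g) \o (fun z => phi ((f z0)^-1 * f z)%g))).
  apply: (smooth_at_comp s1).
  by rewrite /= mulVg (ll_phi1 H) (ll_psi0 H) invg1 (ll_phi1 H); exact: ll_conj H _.
have cV : (fun z => ((f z0)^-1 * f z)^-1)%g z @[z --> z0] --> (1%g : T).
  have c1 : {for z0, continuous (fun z => ((f z0)^-1 * f z)^-1)%g}.
    by apply: invg_continuous_at; apply: mulg_continuous_at => //; exact: cvg_cst.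
  by move: c1; rewrite /prop_for /continuous_at mulVg invg1.
have cK : \forall z \near z0, psi (phi ((f z0)^-1 * f z)^-1%g) =
    ((f z0)^-1 * f z)^-1%g by exact: (cV _ (ll_phiK H)).
apply: smooth_at_ext s2; apply: filterS2 (rel_K cf) cK => z ef eV.
by rewrite /= ef eV invgK invgM invgK !mulgA mulgK.
Qed.

End relative_smoothness.

(** The translation [g] cancels in the normalised map, leaving [(psi y)^-1 * psi z], which is the
    case of [good_mulV]. Transition maps between translated charts are smooth as a consequence. *)
Lemma lie_smooth_tinv g y : timg y -> lie_smooth_at y (tinv g).
Proof.
move=> Iy; split; first exact: tinv_continuous_at.
have [Wy yK] := timgP Iy; have gy := unit_dom_good Wy.
have s2 : smooth_at y (fun z => (phi (psi y)^-1%g, z) : E * E).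
  by apply: smooth_at_pair; [exact: smooth_at_cst|exact: smooth_at_id].
have s3 : smooth_at y (mu \o (fun z => (phi (psi y)^-1%g, z))).
  by apply: (smooth_at_comp s2); have := good_mulV gy; rewrite yK.
apply: smooth_at_eq s3 => z.
by rewrite /mu /= (good_VK gy) /tinv invgM -mulgA mulKg.
Qed.

Lemma lie_smooth_comp_linear (V V' : normedModType R) {hV : findim V} {hV' : findim V'}
    (L : V -> V') (z : V) (f : V' -> T) : linear L ->
  lie_smooth_at (L z) f -> lie_smooth_at z (f \o L).
Proof.
move=> lL [cf sf]; have sL : smooth_at z L by exact: smooth_at_linear.
split.
  exact: continuous_comp (smooth_at_continuous sL) cf.
exact: smooth_at_comp sL sf.
Qed.

(** The proof is a dummy argument of the alias, so that the manifold structure, which depends on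
    [phi] and [psi], can be inferred from the type. *)
Definition lie_of (_ : local_lie phi psi) : Type := T.
Local Notation LT := (lie_of H).

HB.instance Definition _ := Group.on LT.
HB.instance Definition _ := Topological.on LT.

Lemma lie_of_cover (x : LT) : exists2 a, range tchart a & chart_dom a x.
Proof. by exists (tchart x); [exists x|rewrite /= /tdom /= mulVg]. Qed.

Let open_dom (V : normedModType R) (U : set V) (f : V -> T) (h : T) : open U ->
  (forall z, U z -> {for z, continuous f}) -> open (U `&` f @^-1` tdom h).
Proof.
move=> oU cf; rewrite openE => z [Uz fz]; apply: filterI; first exact: open_nbhs_nbhs.
by apply: cf => //; apply: open_nbhs_nbhs; split=> //; exact: tdom_open.
Qed.

Lemma lie_of_compatible (a b : chart R LT n) :
  range tchart a -> range tchart b -> chart_compatible a b.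
Proof.
move=> [g _ <-] [h _ <-]; apply/smooth_onP.
  by apply: open_dom; [exact: timg_open|exact: tinv_continuous_at].
by move=> y [Iy hy]; apply: lie_smooth_chart => //; exact: lie_smooth_tinv.
Qed.

HB.instance Definition _ := isManifold.Build R LT topgroup_hausdorff
  topgroup_second_countable lie_of_cover lie_of_compatible.

Lemma lie_of_smooth_mulg : smooth2 (fun x y : LT => (x * y)%g).
Proof.
split; first exact: mulg_continuous.
move=> _ _ _ [g _ <-] [h _ <-] [k _ <-] /=; set m := (fun z : E * E => _).
have lm z : (timg `*` timg) z -> lie_smooth_at z m.
  move=> [I1 I2]; apply: lie_smoothM.
    by apply: (lie_smooth_comp_linear (L := fst)) => //; exact: lie_smooth_tinv.
  by apply: (lie_smooth_comp_linear (L := snd)) => //; exact: lie_smooth_tinv.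
apply/smooth_onP.
  apply: open_dom => [|z /lm[]//].
  by apply: open_setX; exact: timg_open.
by move=> z [/lm lz mz]; apply: lie_smooth_chart.
Qed.

Lemma lie_of_smooth_invg : smooth (fun x : LT => x^-1%g).
Proof.
split; first exact: invg_continuous.
move=> _ _ [g _ <-] [h _ <-] /=.
have lm z : timg z -> lie_smooth_at z (fun y => (tinv g y)^-1%g).
  by move=> Iz; apply: lie_smoothV; exact: lie_smooth_tinv.
apply/smooth_onP; first by apply: open_dom => [|z /lm[]//]; exact: timg_open.
by move=> z [/lm lz mz]; apply: (lie_smooth_chart (f := fun y => (tinv g y)^-1%g)).
Qed.

HB.instance Definition _ := isLieGroup.Build R LT lie_of_smooth_mulg lie_of_smooth_invg.

(** [(c t0)^-1 * c t = c (t - t0)], so the germ at [0] decides smoothness everywhere. *)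
Lemma lie_of_smooth_curve (c : R -> LT) :
  (forall s t, c (s + t) = (c s * c t)%g) -> {for 0, continuous c} ->
  smooth_at (0 : R^o) (phi \o c) -> smooth_curve c.
Proof.
move=> cD cc sc.
have c0 : c 0 = 1%g by apply: (@mulgI _ (c 0)); rewrite -cD addr0 mulg1.
have relE t0 t : ((c t0)^-1 * c t)%g = c (t - t0).
  by apply: (@mulgI _ (c t0)); rewrite mulVKg -cD addrC subrK.
have ls (t0 : R^o) : lie_smooth_at t0 c.
  split.
    have -> : c = (fun t : R => c t0 * c (t - t0))%g.
      by apply/funext => t; rewrite -cD addrC subrK.
    apply: mulg_continuous_at; first exact: cvg_cst.
    apply: (@continuous_comp _ _ _ (fun t : R => t - t0) c); last by rewrite subrr.
    by apply: cvgB; [exact: cvg_id|exact: cvg_cst].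
  have s1 : smooth_at t0 (fun t : R^o => t - t0) by exact: smooth_at_addr.
  have s2 : smooth_at t0 ((phi \o c) \o (fun t : R^o => t - t0)).
    by apply: (smooth_at_comp s1); rewrite subrr.
  by apply: smooth_at_eq s2 => t; rewrite relE.
split; first by move=> t; have [] := ls t.
move=> _ [g _ <-]; apply/smooth_onP.
  rewrite -[X in open X]setTI; apply: (@open_dom R^o) => [|t _]; first exact: openT.
  by have [] := ls t.
by move=> t gt; apply: lie_smooth_chart.
Qed.

End lie_of.

Lemma cst_continuous_at (X Y : topologicalType) (x : X) (b : Y) :
  {for x, continuous (fun _ : X => b)}.
Proof. exact: cvg_cst. Qed.

Lemma smooth_at_chain (R : realType) (V W Z : normedModType R) {hW : findim W}
    {hZ : findim Z} (f : V -> W) (g : W -> Z) x y :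
  smooth_at y g -> f x = y -> smooth_at x f -> smooth_at x (fun z => g (f z)).
Proof. by move=> sg fx sf; apply: (smooth_at_comp sf); rewrite fx. Qed.

(** * Charts of a given Lie group *)

Section chart_continuity.
Variables (R : realType) (T : topologicalType) (n : nat) (a : chart R T n).

Lemma chart_continuous_at x : chart_dom a x -> {for x, continuous a}.
Proof.
move=> ax; have := @chart_map_continuous _ _ _ a.
rewrite (continuous_open_subspace _ (@chart_dom_open _ _ _ a)); apply.
by rewrite inE.
Qed.

Lemma chart_inv_continuous_at y : chart_img a y -> {for y, continuous (chart_inv a)}.
Proof.
move=> ay; have := @chart_inv_continuous _ _ _ a.
rewrite (continuous_open_subspace _ (@chart_img_open _ _ _ a)); apply.
by rewrite inE.
Qed.

Lemma chart_map_img x : chart_dom a x -> chart_img a (a x).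
Proof. by move=> ax; apply: (@chart_map_sub _ _ _ a); exists x. Qed.

Lemma chart_near_dom (V : topologicalType) (f : V -> T) z : {for z, continuous f} ->
  chart_dom a (f z) -> \forall y \near z, chart_dom a (f y).
Proof.
move=> cf afz; apply: (near_continuous (P := chart_dom a) cf).
by apply: open_nbhs_nbhs; split => //; exact: chart_dom_open.
Qed.

End chart_continuity.

Lemma open_inI (X Y : topologicalType) (U : set X) (f : X -> Y) (W : set Y) :
  open U -> open W -> (forall x, U x -> {for x, continuous f}) ->
  open (U `&` f @^-1` W).
Proof.
move=> oU oW cf; rewrite openE => z [Uz fz]; apply: filterI; first exact: open_nbhs_nbhs.
by apply: cf => //; exact: open_nbhs_nbhs.
Qed.

Section lie_charts.
Variables (R : realType) (G : lieGroupType R).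
Local Notation n := (mdim G).
Local Notation E := 'rV[R]_n.
Implicit Types (a b d : chart R G n).

Lemma chart_mul_smooth a b d p q : atlas G a -> atlas G b -> atlas G d ->
  chart_dom a p -> chart_dom b q -> chart_dom d (p * q)%g ->
  smooth_at (a p, b q) (fun z : E * E => d (chart_inv a z.1 * chart_inv b z.2)%g).
Proof.
move=> Aa Ab Ad ap bq dpq; have [_ /(_ _ _ _ Aa Ab Ad)/= sm] := @smooth_mulg R G.
set m := (fun z : E * E => (chart_inv a z.1 * chart_inv b z.2)%g) in sm *.
apply: (smooth_onP _ _).1 sm _ _.
  apply: open_inI; first by apply: open_setX; exact: chart_img_open.
    exact: chart_dom_open.
  move=> z [z1 z2]; apply: mulg_continuous_at.
    apply: (@continuous_comp _ _ _ fst (chart_inv a)); first exact: cvg_fst.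
    exact: chart_inv_continuous_at.
  apply: (@continuous_comp _ _ _ snd (chart_inv b)); first exact: cvg_snd.
  exact: chart_inv_continuous_at.
split; first by split; exact: chart_map_img.
by rewrite /= /m /= !chart_mapK.
Qed.

Lemma chart_inv_smooth a b p : atlas G a -> atlas G b ->
  chart_dom a p -> chart_dom b p^-1%g ->
  smooth_at (a p) (fun y : E => b (chart_inv a y)^-1%g).
Proof.
move=> Aa Ab ap bp; have [_ /(_ _ _ Aa Ab) sm] := @smooth_invg R G.
apply: (smooth_onP _ _).1 sm _ _.
  apply: open_inI; [exact: chart_img_open|exact: chart_dom_open|].
  by move=> z az; apply: invg_continuous_at; exact: chart_inv_continuous_at.
split; first exact: chart_map_img.
by rewrite /= chart_mapK.
Qed.

Lemma chart_mull_smooth b d p q : atlas G b -> atlas G d ->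
  chart_dom b q -> chart_dom d (p * q)%g ->
  smooth_at (b q) (fun z : E => d (p * chart_inv b z)%g).
Proof.
move=> Ab Ad bq dpq; have [a Aa ap] := atlas_cover p.
have s1 : smooth_at (b q) (fun z : E => (a p, z) : E * E).
  by apply: smooth_at_pair; [exact: smooth_at_cst|exact: smooth_at_id].
apply: smooth_at_eq (smooth_at_comp s1 (chart_mul_smooth Aa Ab Ad ap bq dpq)) => z.
by rewrite /= chart_mapK.
Qed.

Lemma chart_mulr_smooth a d p q : atlas G a -> atlas G d ->
  chart_dom a p -> chart_dom d (p * q)%g ->
  smooth_at (a p) (fun z : E => d (chart_inv a z * q)%g).
Proof.
move=> Aa Ad ap dpq; have [b Ab bq] := atlas_cover q.
have s1 : smooth_at (a p) (fun z : E => (z, b q) : E * E).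
  by apply: smooth_at_pair; [exact: smooth_at_id|exact: smooth_at_cst].
apply: smooth_at_eq (smooth_at_comp s1 (chart_mul_smooth Aa Ab Ad ap bq dpq)) => z.
by rewrite /= chart_mapK.
Qed.

(** A chart at [1] is recentred so as to send [1] to [0]. The clause on curves accompanies the chart
    because the chart is existential: through it the circle identification is read in [phi]. *)
Lemma lie_group_local : exists (phi : G -> E) (psi : E -> G), local_lie phi psi /\
  forall c : R -> G, c 0 = 1%g -> smooth_curve c -> smooth_at (0 : R^o) (phi \o c).
Proof.
have [a Aa a1] := atlas_cover (1%g : G).
pose phi (x : G) : E := a x - a 1%g; pose psi (y : E) : G := chart_inv a (y + a 1%g).
exists phi, psi; have i1 := chart_map_img a1.
have psi0 : psi 0 = 1%g by rewrite /psi add0r chart_mapK.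
have psic : \forall y \near (0 : E), chart_img a (y + a 1%g) /\ {for y, continuous psi}.
  have ca : continuous (fun y : E => y + a 1%g).
    by move=> y; exact: smooth_at_continuous (smooth_at_addr y (a 1%g)).
  have : \forall y \near (0 : E), chart_img a (y + a 1%g).
    apply: (near_continuous (P := chart_img a) (@ca 0)).
    by apply: open_nbhs_nbhs; split; [exact: chart_img_open|rewrite add0r].
  apply: filterS => y iy; split=> //.
  by apply: continuous_comp; [exact: ca|exact: chart_inv_continuous_at].
have s0 (y0 : E) : smooth_at y0 (fun y : E => y + a 1%g) by exact: smooth_at_addr.
have sN (V : normedModType R) (z : V) (f : V -> E) : smooth_at z f ->
    smooth_at z (fun y => f y - a 1%g).
  by move=> sf; apply: smooth_atD => //; exact: smooth_at_cst.
split; first split => //.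
- by rewrite /phi subrr.
- near=> x; rewrite /psi /phi subrK chart_mapK//; near: x.
  by apply: open_nbhs_nbhs; split; [exact: chart_dom_open|].
- by apply: filterS psic => y [iy _]; rewrite /phi /psi chart_invK// addrK.
- near=> x; apply: cvgB; last exact: cvg_cst.
  apply: chart_continuous_at; near: x.
  by apply: open_nbhs_nbhs; split; [exact: chart_dom_open|].
- by apply: filterS psic => y [].
- apply: (sN _ _ (fun z : E * E => a (psi z.1 * psi z.2)%g)).
  have s1 : smooth_at (0, 0) (fun z : E * E => (z.1 + a 1%g, z.2 + a 1%g)).
    apply: smooth_at_pair; apply: smooth_atD; try exact: smooth_at_cst.
      exact: smooth_at_linear (@fst_linear _ _ _).
    exact: smooth_at_linear (@snd_linear _ _ _).
  have s2 : smooth_at (0 + a 1%g, 0 + a 1%g)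
      (fun z : E * E => a (chart_inv a z.1 * chart_inv a z.2)%g).
    by rewrite add0r; apply: chart_mul_smooth => //; rewrite mulg1.
  exact: (smooth_at_comp s1 s2).
- apply: (sN _ _ (fun z : E => a (psi z)^-1%g)).
  have s2 : smooth_at (0 + a 1%g) (fun y : E => a (chart_inv a y)^-1%g).
    by rewrite add0r; apply: chart_inv_smooth => //; rewrite invg1.
  exact: (smooth_at_comp (s0 0) s2).
- move=> g; apply: (sN _ _ (fun z : E => a (g * psi z * g^-1)%g)).
  (* Conjugation by [g] leaves the chart at [1] on the way. It factors through a chart at [g]: left
     multiplication by [g], then right multiplication by [g^-1]. *)
  have [d Ad dg] := atlas_cover g.
  have s1 : smooth_at (a 1%g) (fun z : E => d (g * chart_inv a z)%g).
    by apply: chart_mull_smooth => //; rewrite mulg1.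
  have s2 : smooth_at (d g) (fun z : E => a (chart_inv d z * g^-1)%g).
    by apply: chart_mulr_smooth => //; rewrite mulgV.
  have s3 : smooth_at (a 1%g) ((fun z : E => a (chart_inv d z * g^-1)%g) \o
      (fun z : E => d (g * chart_inv a z)%g)).
    by apply: (smooth_at_comp s1); rewrite chart_mapK// mulg1.
  have s4 : smooth_at (0 + a 1%g) (fun z : E => a (g * chart_inv a z * g^-1)%g).
    rewrite add0r; apply: smooth_at_ext s3.
    have : \forall y \near a 1%g, chart_dom d (g * chart_inv a y)%g.
      apply: chart_near_dom; last by rewrite chart_mapK// mulg1.
      have ci : {for a 1%g, continuous (chart_inv a)} by exact: chart_inv_continuous_at.
      have cg : {for a 1%g, continuous (fun _ : E => g : G)} by exact: cst_continuous_at.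
      have cm := @mulg_continuous_at G _ _ _ _ cg ci.
      refine cm.
    by apply: filterS => y dy; rewrite /= chart_mapK.
  exact: (smooth_at_comp (s0 0) s4).
move=> c c0 [cc /(_ a Aa) sc]; apply: sN.
apply: (smooth_onP _ _).1 sc _ _; last by rewrite /= c0.
apply: (@open_comp R^o) => [t _|]; [exact: cc|exact: chart_dom_open].
Unshelve. all: by end_near. Qed.

End lie_charts.

(** * Products of groups, and vector groups *)

Lemma hausdorff_prod (X Y : topologicalType) :
  hausdorff_space X -> hausdorff_space Y -> hausdorff_space (X * Y)%type.
Proof.
move=> hX hY [x y] [x' y'] cl; congr pair.
  apply: hX => A B Ax Bx'.
  have [[u v] []] := cl (fst @^-1` A) (fst @^-1` B) (cvg_fst Ax) (cvg_fst Bx').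
  by exists u.
apply: hY => A B Ay By'.
have [[u v] []] := cl (snd @^-1` A) (snd @^-1` B) (cvg_snd Ay) (cvg_snd By').
by exists v.
Qed.

Lemma second_countable_prod (X Y : topologicalType) :
  @second_countable X -> @second_countable Y -> @second_countable (X * Y)%type.
Proof.
move=> [B cB [oB bB]] [C cC [oC bC]].
exists [set p.1 `*` p.2 | p in B `*` C].
  by apply: (sub_countable (card_image_le _ _)); exact: countableX.
split=> [_ [[U V] [/= BU CV] <-]|[x y] A].
  by apply: open_setX; [exact: oB|exact: oC].
move=> [[P Q] /= [Px Qy] PQA].
have [U [BU Ux] UP] := bB x P Px; have [V [CV Vy] VQ] := bC y Q Qy.
exists (U `*` V); first by split=> //; exists (U, V).
by move=> [u v] [/= /UP ? /VQ ?]; apply: PQA.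
Qed.

Section prod_group.
Variables S T : topGroupType.

Lemma prod_mul_continuous : continuous (fun z : (S * T) * (S * T) => (z.1 * z.2)%g).
Proof.
move=> z; apply: (pair_continuous_at (f := fun z : (S * T) * (S * T) => (z.1.1 * z.2.1)%g)
   (g := fun z : (S * T) * (S * T) => (z.1.2 * z.2.2)%g)).
  apply: mulg_continuous_at.
    by apply: (@continuous_comp _ _ _ fst fst); [exact: cvg_fst|exact: cvg_fst].
  by apply: (@continuous_comp _ _ _ snd fst); [exact: cvg_snd|exact: cvg_fst].
apply: mulg_continuous_at.
  by apply: (@continuous_comp _ _ _ fst snd); [exact: cvg_fst|exact: cvg_snd].
by apply: (@continuous_comp _ _ _ snd snd); [exact: cvg_snd|exact: cvg_snd].
Qed.

Lemma prod_inv_continuous : continuous (fun x : S * T => x^-1%g).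
Proof.
move=> z; apply: (pair_continuous_at (f := fun z : S * T => (z.1^-1)%g)
   (g := fun z : S * T => (z.2^-1)%g)).
  by apply: invg_continuous_at; exact: cvg_fst.
by apply: invg_continuous_at; exact: cvg_snd.
Qed.

HB.instance Definition _ := @isTopGroup.Build (S * T)%type 1%g (fun x => x^-1)%g
  (fun x y => x * y)%g (@mulgA (S * T)%type) (@mul1g (S * T)%type)
  (@mulVg (S * T)%type) (@mulg1 (S * T)%type) (@mulgV (S * T)%type)
  prod_mul_continuous prod_inv_continuous
  (hausdorff_prod topgroup_hausdorff topgroup_hausdorff)
  (second_countable_prod topgroup_second_countable topgroup_second_countable).

End prod_group.

Section local_lie_prod.
Variables (R : realType) (S T : topGroupType) (m n : nat).
Variables (phi : S -> 'rV[R]_m) (psi : 'rV[R]_m -> S).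
Variables (phi' : T -> 'rV[R]_n) (psi' : 'rV[R]_n -> T).
Hypotheses (H : local_lie phi psi) (H' : local_lie phi' psi').

Lemma row_mx_linear : linear (fun p : 'rV[R]_m * 'rV[R]_n => row_mx p.1 p.2).
Proof. by move=> a u v; rewrite /= scale_row_mx add_row_mx. Qed.

Let lsub_linear : linear (lsubmx : 'rV[R]_(m + n) -> 'rV[R]_m).
Proof. by move=> a u v; apply/rowP => i; rewrite !mxE. Qed.

Let rsub_linear : linear (rsubmx : 'rV[R]_(m + n) -> 'rV[R]_n).
Proof. by move=> a u v; apply/rowP => i; rewrite !mxE. Qed.

Lemma smooth_at_row_mx (V : normedModType R) (z : V) f g : smooth_at z f -> smooth_at z g ->
  smooth_at z (fun y => row_mx (f y : 'rV[R]_m) (g y : 'rV[R]_n)).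
Proof. by move=> sf sg; exact: (smooth_at_linl row_mx_linear (smooth_at_pair sf sg)). Qed.

Definition prod_phi (x : S * T) : 'rV[R]_(m + n) := row_mx (phi x.1) (phi' x.2).
Definition prod_psi (y : 'rV[R]_(m + n)) : S * T := (psi (lsubmx y), psi' (rsubmx y)).

Lemma prod_phi_continuous_at x : {for x.1, continuous phi} -> {for x.2, continuous phi'} ->
  {for x, continuous prod_phi}.
Proof.
move=> c1 c2; apply: (@continuous_comp _ _ _ (fun x : S * T => (phi x.1, phi' x.2))
   (fun p : 'rV[R]_m * 'rV[R]_n => row_mx p.1 p.2)).
  apply: pair_continuous_at.
    by apply: (@continuous_comp _ _ _ fst phi); [exact: cvg_fst|].
  by apply: (@continuous_comp _ _ _ snd phi'); [exact: cvg_snd|].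
exact: (findim_linear_continuous row_mx_linear).
Qed.

Lemma prod_psi_continuous_at y : {for lsubmx y, continuous psi} ->
  {for rsubmx y, continuous psi'} -> {for y, continuous prod_psi}.
Proof.
move=> c1 c2.
have cl : {for y, continuous (lsubmx : 'rV[R]_(m + n) -> 'rV[R]_m)}.
  exact: (findim_linear_continuous lsub_linear).
have cr : {for y, continuous (rsubmx : 'rV[R]_(m + n) -> 'rV[R]_n)}.
  exact: (findim_linear_continuous rsub_linear).
exact: pair_continuous_at (continuous_comp cl c1) (continuous_comp cr c2).
Qed.

Lemma local_lie_prod : local_lie prod_phi prod_psi.
Proof.
have n1 (P : set S) (Q : set T) : (\forall x \near (1%g : S), P x) ->
    (\forall x \near (1%g : T), Q x) -> \forall x \near (1%g : (S * T)%type), P x.1 /\ Q x.2.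
  by move=> NP NQ; exists (P, Q) => // -[x y] [].
have n0 (P : set 'rV[R]_m) (Q : set 'rV[R]_n) : (\forall y \near (0 : 'rV[R]_m), P y) ->
    (\forall y \near (0 : 'rV[R]_n), Q y) ->
    \forall y \near (0 : 'rV[R]_(m + n)), P (lsubmx y) /\ Q (rsubmx y).
  move=> NP NQ.
  have cl : {for 0, continuous (lsubmx : 'rV[R]_(m + n) -> 'rV[R]_m)}.
    exact: (findim_linear_continuous lsub_linear).
  have cr : {for 0, continuous (rsubmx : 'rV[R]_(m + n) -> 'rV[R]_n)}.
    exact: (findim_linear_continuous rsub_linear).
  have l0 : lsubmx (0 : 'rV[R]_(m + n)) = 0 by exact: linear0.
  have r0 : rsubmx (0 : 'rV[R]_(m + n)) = 0 by exact: linear0.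
  apply: filterI; first by apply: (near_continuous (P := P) cl); rewrite l0.
  by apply: (near_continuous (P := Q) cr); rewrite r0.
have sl (V : normedModType R) (z : V) f : smooth_at z f ->
    smooth_at z (fun y => lsubmx (f y : 'rV[R]_(m + n))).
  by move=> sf; exact: (smooth_at_linl lsub_linear sf).
have sr (V : normedModType R) (z : V) f : smooth_at z f ->
    smooth_at z (fun y => rsubmx (f y : 'rV[R]_(m + n))).
  by move=> sf; exact: (smooth_at_linl rsub_linear sf).
split.
- by rewrite /prod_phi (ll_phi1 H) (ll_phi1 H') row_mx0.
- by rewrite /prod_psi !linear0 (ll_psi0 H) (ll_psi0 H').
- apply: filterS (n1 _ _ (ll_phiK H) (ll_phiK H')) => -[x y] /= [ex ey].
  by rewrite /prod_psi /prod_phi row_mxKl row_mxKr ex ey.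
- apply: filterS (n0 _ _ (ll_psiK H) (ll_psiK H')) => y [e1 e2].
  by rewrite /prod_phi /prod_psi /= e1 e2 hsubmxK.
- apply: filterS (n1 _ _ (ll_phic H) (ll_phic H')) => x [c1 c2].
  exact: prod_phi_continuous_at.
- apply: filterS (n0 _ _ (ll_psic H) (ll_psic H')) => y [c1 c2].
  exact: prod_psi_continuous_at.
- pose E := 'rV[R]_(m + n).
  have s1 : smooth_at (0, 0) (fst : E * E -> E) by exact: smooth_at_linear (@fst_linear _ _ _).
  have s2 : smooth_at (0, 0) (snd : E * E -> E) by exact: smooth_at_linear (@snd_linear _ _ _).
  apply: (smooth_at_row_mx (f := fun z : E * E => phi (psi (lsubmx z.1) * psi (lsubmx z.2))%g)
    (g := fun z : E * E => phi' (psi' (rsubmx z.1) * psi' (rsubmx z.2))%g)).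
    apply: (smooth_at_chain (ll_mul H) _ (smooth_at_pair (sl _ _ _ s1) (sl _ _ _ s2))).
    by rewrite /= linear0.
  apply: (smooth_at_chain (ll_mul H') _ (smooth_at_pair (sr _ _ _ s1) (sr _ _ _ s2))).
  by rewrite /= linear0.
- apply: (smooth_at_row_mx (f := fun y => phi (psi (lsubmx y))^-1%g)
    (g := fun y => phi' (psi' (rsubmx y))^-1%g)).
    by apply: (smooth_at_chain (ll_inv H) _ (sl _ _ _ (smooth_at_id 0))); rewrite /= linear0.
  by apply: (smooth_at_chain (ll_inv H') _ (sr _ _ _ (smooth_at_id 0))); rewrite /= linear0.
- move=> [g g']; apply: (smooth_at_row_mx (f := fun y => phi (g * psi (lsubmx y) * g^-1)%g)
    (g := fun y => phi' (g' * psi' (rsubmx y) * g'^-1)%g)).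
    by apply: (smooth_at_chain (ll_conj H g) _ (sl _ _ _ (smooth_at_id 0))); rewrite /= linear0.
  by apply: (smooth_at_chain (ll_conj H' g') _ (sr _ _ _ (smooth_at_id 0))); rewrite /= linear0.
Qed.

End local_lie_prod.

Lemma rV_second_countable (R : realType) k : @second_countable 'rV[R]_k.
Proof.
pose f (p : 'rV[rat]_k * rat) : set 'rV[R]_k := ball (map_mx ratr p.1 : 'rV[R]_k) (ratr p.2 : R).
exists (range f); first by apply: (sub_countable (card_image_le _ _)).
split=> [_ [p _ <-]|x A]; first exact: ball_open.
move=> /nbhs_ballP[e /= e0 eA].
have e20 : 0 < e / 2 by rewrite divr_gt0.
(* A radius below [e / 2]: any ball of that radius containing [x] stays within [e] of [x]. *)
have [r] := rat_in_itvoo e20; rewrite in_itv /= => /andP[r0 re].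
have /choice[q qP] (i : 'I_k) : exists q : rat, `|x 0 i - ratr q| < ratr r.
  have lt : x 0 i < x 0 i + ratr r by rewrite ltrDl.
  have [q] := rat_in_itvoo lt; rewrite in_itv /= => /andP[q1 q2]; exists q.
  by rewrite distrC gtr0_norm ?subr_gt0// ltrBlDl.
pose p : 'rV[rat]_k := \row_i q i.
have bx : ball (map_mx ratr p : 'rV[R]_k) (ratr r) x.
  split=> // i j; rewrite -ball_normE /= distrC ord1 !mxE; exact: qP.
exists (f (p, r)); first by split=> //; exists (p, r).
move=> y fy; apply: eA; apply: (@le_ball _ _ _ (ratr r + ratr r)).
  by rewrite (splitr e) lerD// ltW.
apply: ball_triangle fy; exact: ball_sym.
Qed.

(** An alias on which the addition of row vectors becomes the multiplication of a group. *)
Definition vgroup (R : realType) (k : nat) : Type := 'rV[R]_k.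

Section vgroup.
Variables (R : realType) (k : nat).

HB.instance Definition _ := Topological.copy (vgroup R k) 'rV[R]_k.
HB.instance Definition _ := @isTopGroup.Build (vgroup R k) (0 : 'rV[R]_k)
  (fun x : 'rV[R]_k => - x) (fun x y : 'rV[R]_k => x + y)
  (@addrA 'rV[R]_k) (@add0r 'rV[R]_k) (@addNr 'rV[R]_k) (@addr0 'rV[R]_k)
  (@addrN 'rV[R]_k) (@add_continuous 'rV[R]_k) (@opp_continuous 'rV[R]_k)
  (@norm_hausdorff R 'rV[R]_k) (@rV_second_countable R k).
HB.instance Definition _ := Group.copy (vgroup R k) (TopGroup.sort (vgroup R k : topGroupType)).

Lemma local_lie_vgroup :
  local_lie (id : vgroup R k -> 'rV[R]_k) (id : 'rV[R]_k -> vgroup R k).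
Proof.
split=> //.
- exact: filterE.
- exact: filterE.
- by apply: filterE => x; exact: cvg_id.
- by apply: filterE => x; exact: cvg_id.
- have s1 : smooth_at (0, 0) (fst : 'rV[R]_k * 'rV[R]_k -> 'rV[R]_k).
    exact: smooth_at_linear (@fst_linear _ _ _).
  have s2 : smooth_at (0, 0) (snd : 'rV[R]_k * 'rV[R]_k -> 'rV[R]_k).
    exact: smooth_at_linear (@snd_linear _ _ _).
  exact: smooth_atD s1 s2.
- have lN : linear (-%R : 'rV[R]_k -> 'rV[R]_k) by move=> a u v; rewrite opprD scalerN.
  exact: smooth_at_linear lN.
- move=> g; apply: smooth_at_eq (smooth_at_id _) => y.
  by rewrite -[RHS]/((g : 'rV[R]_k) + y - g) addrAC subrr add0r.
Qed.

End vgroup.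

(** * Quotients by a central circle *)

Section coset_space_theory.
Local Open Scope quotient_scope.
Variables (R : realType) (G : lieGroupType R) (Gamma : groupClosed G).

Definition coset_of_elt (x : G) : coset_space Gamma := \pi_(coset_space Gamma) x.
Local Notation cls := coset_of_elt.

Lemma coset_eqP (x y : G) : cls x = cls y <-> (x^-1 * y)%g \in Gamma.
Proof.
by split=> [/eqmodP //|h]; apply/eqmodP.
Qed.

Lemma coset_of_eltM (x k : G) : k \in Gamma -> cls (x * k)%g = cls x.
Proof. by move=> kG; apply/esym/coset_eqP; rewrite mulKg. Qed.

Lemma coset_of_repr (q : coset_space Gamma) : cls (repr q) = q.
Proof. exact: reprK. Qed.

Lemma coset_surj (q : coset_space Gamma) : exists x, cls x = q.
Proof. by exists (repr q); exact: coset_of_repr. Qed.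

Lemma coset_continuous : continuous cls.
Proof. exact: pi_continuous. Qed.

(** The saturation of [U] is the union of its right translates by elements of [Gamma], each of them
    open. *)
Lemma coset_open (U : set G) : open U -> open (cls @` U).
Proof.
move=> oU; suff oP : open (cls @^-1` (cls @` U)) by exact: oP.
have -> : cls @^-1` (cls @` U) = \bigcup_(k in [set` Gamma]) [set x | U (x * k^-1)%g].
  apply/seteqP; split=> [x [u Uu /coset_eqP kG]|x [k kG Uxk]].
    by exists (u^-1 * x)%g => //=; rewrite invgM invgK mulVKg.
  by exists (x * k^-1)%g => //; apply: coset_of_eltM; rewrite gpredV.
apply: bigcup_open => k _; apply: (@open_comp _ _ (fun x : G => x * k^-1)%g) => // x _.
exact: (@mulgr_continuous G).
Qed.

Lemma coset_nbhs (x : G) (A : set (coset_space Gamma)) :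
  (\forall y \near x, A (cls y)) -> nbhs (cls x) A.
Proof.
rewrite -[X in X -> _]/(nbhs x _) nbhsE => -[U [oU Ux] UA].
apply: (@filterS _ _ _ (cls @` U)); first by move=> _ [y /UA ? <-].
by apply: open_nbhs_nbhs; split; [exact: coset_open|exists x].
Qed.

End coset_space_theory.

Arguments coset_of_elt {R G Gamma} x.

(** A product of quotient maps need not be a quotient map. The neighbourhood hypotheses say that [p]
    and [p'] are open maps, and then continuity of [F] can be tested on its lift [j]. *)
Lemma quotient_pair_continuous (A A' X X' Z : topologicalType) (p : A -> X) (p' : A' -> X')
    (F : X * X' -> Z) (j : A * A' -> Z) :
  (forall a B, nbhs a (p @^-1` B) -> nbhs (p a) B) -> (forall x, exists a, p a = x) ->
  (forall a B, nbhs a (p' @^-1` B) -> nbhs (p' a) B) -> (forall x, exists a, p' a = x) ->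
  (forall a a', F (p a, p' a') = j (a, a')) -> continuous j -> continuous F.
Proof.
move=> op sp op' sp' Fj cj [x x'].
have [a <-] := sp x; have [a' <-] := sp' x'.
rewrite /continuous_at Fj => N /cj[[B B'] [/= Ba Ba'] BN].
exists (p @` B, p' @` B') => /=.
  by split; [apply: op|apply: op']; apply: filterS (Ba) || apply: filterS (Ba');
     move=> b Bb; exists b.
by move=> [_ _] [/= [b Bb <-] [b' Bb' <-]]; rewrite Fj; exact: (BN (b, b')).
Qed.

(** * The topological group of cosets of a closed central subgroup *)

Section central_quotient.
Local Open Scope quotient_scope.
Variables (R : realType) (P : lieGroupType R) (K : groupClosed P).
Hypothesis Kcentral : forall k x : P, k \in K -> commute k x.
Hypothesis Kclosed : closed [set x : P | x \in K].
Local Notation Q := (coset_space K).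
Local Notation cls := (@coset_of_elt R P K).

Let qmul (x y : Q) : Q := cls (repr x * repr y)%g.
Let qinv (x : Q) : Q := cls (repr x)^-1%g.

Let repr_cls x : exists2 k, k \in K & repr (cls x) = (x * k)%g.
Proof.
exists (x^-1 * repr (cls x))%g; last by rewrite mulVKg.
by apply/coset_eqP; rewrite coset_of_repr.
Qed.

Let qmulE x y : qmul (cls x) (cls y) = cls (x * y)%g.
Proof.
have [k kK ek] := repr_cls x; have [l lK el] := repr_cls y.
rewrite /qmul ek el; have -> : (x * k * (y * l) = (x * y) * (k * l))%g.
  by rewrite -!mulgA; congr (_ * _)%g; rewrite !mulgA (Kcentral _ kK).
by apply: coset_of_eltM; exact: gpredM.
Qed.

Let qinvE x : qinv (cls x) = cls x^-1%g.
Proof.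
have [k kK ek] := repr_cls x; rewrite /qinv ek invgM.
rewrite Kcentral ?gpredV//; apply: coset_of_eltM.
by rewrite gpredV.
Qed.

Let qmulA : associative qmul.
Proof.
move=> x y z; rewrite -(coset_of_repr x) -(coset_of_repr y) -(coset_of_repr z).
by rewrite !qmulE mulgA.
Qed.

Let qmul1 : left_id (cls 1%g) qmul.
Proof. by move=> x; rewrite -(coset_of_repr x) qmulE mul1g. Qed.

Let qmul1r : right_id (cls 1%g) qmul.
Proof. by move=> x; rewrite -(coset_of_repr x) qmulE mulg1. Qed.

Let qmulV : left_inverse (cls 1%g) qinv qmul.
Proof. by move=> x; rewrite -(coset_of_repr x) qinvE qmulE mulVg. Qed.

Let qmulVr : right_inverse (cls 1%g) qinv qmul.
Proof. by move=> x; rewrite -(coset_of_repr x) qinvE qmulE mulgV. Qed.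

Let qmul_continuous : continuous (fun z : Q * Q => qmul z.1 z.2).
Proof.
apply: (@quotient_pair_continuous P P _ _ _ cls cls _ (fun z => cls (z.1 * z.2)%g)).
- by move=> a B; exact: coset_nbhs.
- exact: coset_surj.
- by move=> a B; exact: coset_nbhs.
- exact: coset_surj.
- by move=> a a' /=; exact: qmulE.
- move=> z; apply: (@continuous_comp _ _ _ (fun z : P * P => (z.1 * z.2)%g) cls).
    exact: (@mulg_continuous P).
  exact: coset_continuous.
Qed.

Let qinv_continuous : continuous qinv.
Proof.
move=> q; have [x <-] := coset_surj q.
move=> N; rewrite qinvE => NN; apply: coset_nbhs.
have cV : {for x, continuous (fun y : P => cls y^-1%g)}.
  apply: (@continuous_comp _ _ _ (fun y : P => y^-1%g) cls); first exact: (@invg_continuous P).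
  exact: coset_continuous.
have NV : \forall y \near x, N (cls y^-1%g) by exact: cV.
by apply: filterS NV => y /=; rewrite qinvE.
Qed.

(** Since [K] is closed, [x^-1 * y] stays outside it for nearby points; the images of such
    neighbourhoods are disjoint. *)
Let quotient_hausdorff : hausdorff_space Q.
Proof.
move=> p q; have [x <-] := coset_surj p; have [y <-] := coset_surj q => cl.
apply/coset_eqP; apply: contrapT => nK.
have : \forall z \near (x, y), ~ ((z.1^-1 * z.2)%g \in K).
  have cf : {for (x, y), continuous (fun z : P * P => (z.1^-1 * z.2)%g)}.
    apply: (@mulg_continuous_at P); last exact: cvg_snd.
    by apply: (@invg_continuous_at P); exact: cvg_fst.
  apply: (near_continuous (P := ~` [set x : P | x \in K]) cf).
  by apply: open_nbhs_nbhs; split; [exact: closed_openC|].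
move=> [[A B] [/= Ax By] AB].
have NA : nbhs (cls x) (cls @` A) by apply: coset_nbhs; apply: filterS Ax => z; exists z.
have NB : nbhs (cls y) (cls @` B) by apply: coset_nbhs; apply: filterS By => z; exists z.
have [_ [[a Aa <-] [b Bb /esym/coset_eqP]]] := cl _ _ NA NB.
exact: (AB (a, b)).
Qed.

Let quotient_second_countable : @second_countable Q.
Proof.
have [B cB [oB bB]] := @manifold_second_countable R P.
exists [set cls @` U | U in B]; first exact: (sub_countable (card_image_le _ _)).
split=> [_ [U BU <-]|q A NA]; first exact: coset_open (oB _ BU).
have [x xq] := coset_surj q; rewrite -xq in NA *.
have [U [BU Ux] UA] := bB x _ (coset_continuous NA).
exists (cls @` U); first by split; [exists U|exists x].
by move=> _ [y Uy <-]; exact: UA.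
Qed.

(** As for [lie_of], the proofs are arguments so that the group structure can be inferred from the
    type. *)
Definition central_quotient (_ : forall k x : P, k \in K -> commute k x)
  (_ : closed [set x : P | x \in K]) : Type := Q.
Local Notation CQ := (central_quotient Kcentral Kclosed).

HB.instance Definition _ := Topological.copy CQ Q.
HB.instance Definition _ := @isTopGroup.Build CQ (cls 1%g) qinv qmul
  qmulA qmul1 qmulV qmul1r qmulVr qmul_continuous qinv_continuous
  quotient_hausdorff quotient_second_countable.
HB.instance Definition _ := Group.copy CQ (TopGroup.sort (CQ : topGroupType)).

Definition quotient_map (x : P) : CQ := cls x.

Lemma quotient_mapM x y : quotient_map (x * y)%g = (quotient_map x * quotient_map y)%g.
Proof. exact/esym/qmulE. Qed.

Lemma quotient_mapV x : quotient_map x^-1%g = (quotient_map x)^-1%g.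
Proof. exact/esym/qinvE. Qed.

Lemma quotient_map1 : quotient_map 1%g = 1%g.
Proof. by []. Qed.

Lemma quotient_map_eqP x y : quotient_map x = quotient_map y <-> (x^-1 * y)%g \in K.
Proof. exact: coset_eqP. Qed.

Lemma quotient_map_surj (q : CQ) : exists x, quotient_map x = q.
Proof. exact: coset_surj. Qed.

Lemma quotient_map_continuous : continuous quotient_map.
Proof. exact: coset_continuous. Qed.

Lemma quotient_map_nbhs (x : P) (A : set CQ) :
  (\forall y \near x, A (quotient_map y)) -> nbhs (quotient_map x) A.
Proof. exact: coset_nbhs. Qed.

End central_quotient.

Arguments quotient_map {R P K Kcentral Kclosed} x.

(** * The chart on a quotient by a central circle *)

Section quotient_local_lie.
Variables (R : realType) (P : lieGroupType R) (K : groupClosed P).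
Variables (Kcentral : forall k x : P, k \in K -> commute k x)
  (Kclosed : closed [set x : P | x \in K]).
Local Notation Q := (central_quotient Kcentral Kclosed).
Local Notation cls := (@quotient_map R P K Kcentral Kclosed).
Variables (n : nat) (phi : P -> 'rV[R]_n) (psi : 'rV[R]_n -> P).
Hypothesis H : local_lie phi psi.
Variables (c : R -> P) (A : R).
Hypotheses (A0 : 0 < A) (cD : forall s t, c (s + t) = (c s * c t)%g)
  (cc : continuous c) (sc : smooth_at (0 : R^o) (phi \o c))
  (cK : forall t, c t \in K)
  (Kc : forall k, k \in K -> exists2 t, `|t| <= A & c t = k)
  (c_inj : forall t, `|t| <= A -> c t = 1%g -> t = 0).
Local Notation E := 'rV[R]_n.
Local Notation E' := 'rV[R]_n.-1.

Let c0 : c 0 = 1%g.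
Proof. by apply: (@mulgI _ (c 0)); rewrite -cD addr0 mulg1. Qed.

Let mu (z : E * E) : E := phi (psi z.1 * psi z.2)%g.

Let phic1 : {for 1%g, continuous phi}.
Proof. exact: (nbhs_singleton (ll_phic H)). Qed.

Let psic0 : {for 0, continuous psi}.
Proof. exact: (nbhs_singleton (ll_psic H)). Qed.

Let cK_near : \forall t \near (0 : R), psi (phi (c t)) = c t.
Proof.
apply: (near_continuous (P := fun x => psi (phi x) = x) (@cc 0)).
by rewrite c0; exact: ll_phiK H.
Qed.

(** Zero velocity at [0] propagates by translation to all small times, so [phi \o c] is constant
    near [0] and [c t = 1] for some small [t > 0], against [c_inj]. *)
Lemma curve_not_stationary : 'D_1 (phi \o c : R^o -> E) 0 != 0.
Proof.
apply/eqP => D0.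
have sphc : \forall t \near (0 : R^o), smooth_at t (phi \o c) by exact: smooth_at_near.
have smu : \forall t \near (0 : R^o), smooth_at (phi (c t), 0) mu.
  have cp : {for 0, continuous (fun t : R^o => (phi (c t), 0 : E))}.
    apply: pair_continuous_at; first exact: smooth_at_continuous sc.
    exact: cst_continuous_at.
  have := @near_continuous _ _ _ _ (fun z : E * E => smooth_at z mu) cp; apply.
  by rewrite c0 (ll_phi1 H); apply: smooth_at_near; exact: ll_mul H.
have zero_deriv : \forall t \near (0 : R^o), 'D_1 (phi \o c : R^o -> E) t = 0.
  near=> t.
  have ct : psi (phi (c t)) = c t by near: t; exact: cK_near.
  have st : smooth_at (phi (c t), 0) mu by near: t.
  (* As [c (h + t) = c t * c h], the curve near [t] is the image of the curve near [0] under left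
     translation by [c t], which [m] expresses in coordinates. *)
  pose m (y : E) : E := mu (phi (c t), y).
  have sm : smooth_at (0 : E) m.
    by apply: (smooth_at_chain st _ (smooth_at_pair (smooth_at_cst _ _) (smooth_at_id _))).
  have e1 : {near (0 : R^o), m \o (phi \o c) =1 (fun h : R^o => (phi \o c) (h + t))}.
    by apply: filterS cK_near => h eh; rewrite /m /mu /= ct eh -cD addrC.
  have D1 : is_derive (0 : R^o) (1 : R^o) (m \o (phi \o c)) 0.
    have pc0 : phi (c 0) = 0 by rewrite c0 (ll_phi1 H).
    have dm : differentiable m ((phi \o c) 0).
      by rewrite /= pc0; exact: smooth_at_differentiable.
    have dpc : derivable (phi \o c : R^o -> E) 0 1 by exact: smooth_at_derivable.
    by apply: is_derive_eq (is_derive_comp dpc dm) _; rewrite D0 linear0.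
  have D2 : 'D_1 (fun h : R^o => (phi \o c) (h + t)) 0 = 0.
    by rewrite -(near_eq_derive _ e1) (@derive_val _ _ _ _ _ _ _ D1).
  rewrite -[RHS]D2 /derive.
  suff -> : (fun h : R => h^-1 *: (((phi \o c) \o shift t) (h *: 1) - (phi \o c) t)) =
    (fun h : R => h^-1 *: (((fun h : R^o => (phi \o c) (h + t)) \o shift 0) (h *: 1)
       - (phi \o c) (0 + t))) by [].
  by apply/funext => h; rewrite /= addr0 add0r.
have [e e0 eP] : exists2 e : R, 0 < e & forall t : R, `|t| < e ->
   [/\ smooth_at (t : R^o) (phi \o c), 'D_1 (phi \o c : R^o -> E) t = 0 & psi (phi (c t)) = c t].
  have : \forall t \near (0 : R^o), [/\ smooth_at (t : R^o) (phi \o c),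
     'D_1 (phi \o c : R^o -> E) t = 0 & psi (phi (c t)) = c t].
    by apply: filterS3 sphc zero_deriv cK_near => t; split.
  move=> /nbhs_ballP[e /= e0 eP]; exists e => // t te; apply: eP.
  by rewrite -ball_normE /= sub0r normrN.
(* Inside the range where the velocity vanishes, and at most [A], where [c_inj] applies. *)
pose t := Num.min (e / 2) A.
have t0 : 0 < t by rewrite lt_min A0 divr_gt0.
have te : t < e by rewrite gt_min; apply/orP; left; rewrite gtr_pMr// invf_lt1// ltr1n.
have tA : `|t| <= A by rewrite gtr0_norm// ge_min lexx orbT.
suff ct : c t = 1%g by have t00 := c_inj tA ct; rewrite t00 ltxx in t0.
have lte (s : R) : 0 <= s -> s <= t -> `|s| < e.
  by move=> s0 st; rewrite ger0_norm//; exact: le_lt_trans te.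
have [_ _ <-] := eP t (lte _ (ltW t0) (lexx _)).
suff -> : phi (c t) = 0 by rewrite (ll_psi0 H).
apply/rowP => i; rewrite mxE.
have dti (s : R) : 0 <= s -> s <= t -> is_derive s 1 (fun t : R => phi (c t) 0 i) 0.
  move=> s0 st; have [ss Ds _] := eP s (lte _ s0 st).
  have ds : derivable (phi \o c : R^o -> E) s 1 by exact: smooth_at_derivable.
  have := @is_derive_linear _ _ _ _ (to_linear (coord_linear 0 i)) (phi \o c) s 1
     (@coord_continuous _ _ _ 0 i) ds.
  by rewrite Ds /= mxE.
have [||xi _] := @MVT_segment _ (fun s => phi (c s) 0 i) (fun=> 0) 0 t (ltW t0).
- by move=> s; rewrite in_itv /= => /andP[/ltW ? /ltW ?]; exact: dti.
- apply: derivable_within_continuous => s; rewrite in_itv /= => /andP[s0 st].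
  by have h := dti s s0 st; apply: ex_derive.
by rewrite mul0r c0 (ll_phi1 H) mxE subr0.
Unshelve. all: by end_near. Qed.

Let row_nonzero (v : E) : v != 0 -> exists i, v 0 i != 0.
Proof.
move=> v0; apply: contrapT => h; move/eqP: v0; apply; apply/rowP => i; rewrite mxE.
by apply/eqP/negPn/negP => vi; apply: h; exists i.
Qed.

Section slice.
Variable i : 'I_n.

Definition slice_incl (s : E') : E := \row_j if unlift i j is Some k then s 0 k else 0.

Lemma slice_incl_linear : linear slice_incl.
Proof.
move=> a u v; apply/rowP => j; rewrite !mxE.
by case: unlift => [k|]; rewrite ?mxE// mulr0 addr0.
Qed.

Lemma slice_proj_linear : linear (col' i : E -> E').
Proof. by move=> a u v; apply/rowP => j; rewrite !mxE. Qed.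

Lemma slice_inclK s : col' i (slice_incl s) = s.
Proof. by apply/rowP => j; rewrite !mxE liftK. Qed.

Lemma slice_incl_coord s : slice_incl s 0 i = 0.
Proof. by rewrite mxE unlift_none. Qed.

Lemma slice_projK (y : E) : y 0 i = 0 -> slice_incl (col' i y) = y.
Proof.
move=> yi; apply/rowP => j; rewrite mxE.
by case: unliftP => [k ->|->]; rewrite ?mxE.
Qed.

End slice.

(* Every coset near the trivial one has a unique small representative in the
   hyperplane on which the [i]-th coordinate vanishes: the velocity of [c] at
   [0] is transverse to it. *)
Lemma local_lie_quotient : exists (phiQ : Q -> E') (psiQ : E' -> Q),
  local_lie phiQ psiQ /\
  forall (V : normedModType R) (hV : findim V) (f : V -> P) (z0 : V),
    {for z0, continuous f} -> f z0 = 1%g -> smooth_at z0 (phi \o f) ->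
    smooth_at z0 (fun z => phiQ (cls (f z))).
Proof.
have [i Di] := row_nonzero curve_not_stationary.
(* The [i]-th coordinate of the point [psi z.2] moved for time [z.1] along the circle; its zeros are
   the times of arrival in the slice. *)
pose F (z : R^o * E) : R^o := (phi (c z.1 * psi z.2)%g) 0 i.
have F0 : F (0, 0) = 0 by rewrite /F /= c0 (ll_psi0 H) mulg1 (ll_phi1 H) mxE.
have s_fst : smooth_at (0, 0) (fst : R^o * E -> R^o) by exact: smooth_at_linear (@fst_linear _ _ _).
have s_snd : smooth_at (0, 0) (snd : R^o * E -> E) by exact: smooth_at_linear (@snd_linear _ _ _).
pose act (z : R^o * E) : E := phi (c z.1 * psi z.2)%g.
have s_act : smooth_at (0, 0) act.
  have sc1 : smooth_at (0, 0) (fun z : R^o * E => (phi \o c) z.1).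
    exact: (smooth_at_chain sc _ s_fst).
  have cf : {for (0, 0), continuous (fst : R^o * E -> R^o)} by exact: cvg_fst.
  have fK : \forall z \near (0 : R^o, 0 : E), psi (phi (c z.1)) = c z.1.
    exact: (near_continuous (P := fun t => psi (phi (c t)) = c t) cf cK_near).
  have s2 : smooth_at (0, 0) (fun z : R^o * E => mu (phi (c z.1), z.2)).
    apply: (smooth_at_chain (ll_mul H) _ (smooth_at_pair sc1 s_snd)).
    by rewrite /= c0 (ll_phi1 H).
  by apply: smooth_at_ext s2; apply: filterS fK => z /= ez; rewrite /mu /= ez.
have sF : smooth_at (0, 0) F.
  exact: (smooth_at_linl (@coord_linear R 1 n 0 i) s_act).
have dF : 'D_(1, 0) F (0, 0) != 0.
  have dFd : derivable F (0, 0) (1, 0) by exact: smooth_at_derivable.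
  have d1 := is_derive_fst dFd.
  rewrite -(@derive_val _ _ _ _ _ _ _ d1).
  have ds : derivable (phi \o c : R^o -> E) 0 1 by exact: smooth_at_derivable.
  have d2 := @is_derive_linear _ _ _ _ (to_linear (coord_linear 0 i)) (phi \o c) 0 1
     (@coord_continuous _ _ _ 0 i) ds.
  have -> : (fun s : R => F (s, 0)) = to_linear (@coord_linear R 1 n 0 i) \o (phi \o c).
    by apply/funext => s; rewrite /F /= (ll_psi0 H) mulg1.
  by rewrite (@derive_val _ _ _ _ _ _ _ d2).
have [theta [th0 sth] [Fth [e e0 eP]]] := implicit_function F0 sF dF.
(* Slice coordinates of the arrival point, whose [i]-th coordinate vanishes and is dropped. *)
pose rho (y : E) : E' := col' i (act (theta y, y)).
have s_rho : smooth_at (0 : E) rho.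
  apply: (smooth_at_linl (slice_proj_linear i)).
  by apply: (smooth_at_chain s_act _ (smooth_at_pair sth (smooth_at_id _))); rewrite th0.
have rho0 : rho 0 = 0.
  rewrite /rho /act /= th0 c0 (ll_psi0 H) mulg1 (ll_phi1 H).
  by apply/rowP => j; rewrite !mxE.
(* Arrival times are unique only locally, whereas two points of a coset may differ by any [c t] with
   [t] in [[- A, A]]. Since [c t] differs from [1] for nonzero [t] in this compact segment, an
   element of [K] close to [1] has only small parameters. *)
have small : \forall m \near (1%g : P), forall t, `|t| <= A -> c t = m -> `|t| < e / 2.
  have cpt : compact `[- A, A]%classic by exact: segment_compact.
  have cov := (compact_near_coveringP `[- A, A]%classic).1 cpt.
  have e20 : 0 < e / 2 by rewrite divr_gt0.
  have H1 : forall t, `[- A, A]%classic t -> \forall t' \near t & m \near (1%g : P),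
      c t' = m -> `|t'| < e / 2.
    move=> t; rewrite /= in_itv /= -ler_norml => tA.
    have [te|te] := ltP `|t| (e / 2).
      have nt : \forall t' \near t, `|t'| < e / 2.
        have cn : {for t, continuous (fun t' : R => `|t'|)} by exact: norm_continuous.
        by apply: (near_continuous (P := fun r : R => r < e / 2) cn); exact: lt_nbhsl.
      exists ([set t' | `|t'| < e / 2], setT); first by split=> //; exact: filterT.
      by move=> [t' m] [].
    have ct1 : c t != 1%g.
      apply/eqP => /(c_inj tA) t0; move: te; rewrite t0 normr0 leNgt e20 //.
    have cg : {for (t, 1%g : P), continuous (fun z : R * P => ((c z.1)^-1 * z.2)%g)}.
      apply: (@mulg_continuous_at P); last exact: cvg_snd.
      apply: (@invg_continuous_at P); apply: (@continuous_comp _ _ _ fst c).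
        exact: cvg_fst.
      exact: cc.
    have cl1 : closed [set (1%g : P)].
      by apply: accessible_closed_set1; apply: hausdorff_accessible; exact: manifold_hausdorff.
    have : \forall z \near (t, 1%g : P), ((c z.1)^-1 * z.2)%g != 1%g.
      apply: (near_continuous (P := [set x : P | x != 1%g]) cg).
      apply: open_nbhs_nbhs; split; last by rewrite /= mulg1 invg_eq1.
      have -> : [set x : P | x != 1%g] = ~` [set (1%g : P)].
        by apply/seteqP; split=> x /= /eqP.
      exact: closed_openC.
    move=> [[B C] [/= Bt C1] BC]; exists (B, C) => // -[t' m] [/= Bt' Cm] ctm.
    by have := BC (t', m) (conj Bt' Cm); rewrite /= ctm mulVg eqxx.
  have H2 := cov P (nbhs (1%g : P)) (fun m t => c t = m -> `|t| < e / 2) (nbhs_filter _) H1.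
  apply: filterS H2 => m hm t tA ctm; apply: hm => //.
  by rewrite /= in_itv /= -ler_norml.
have [N N1 Nsmall] : exists2 N : set P, nbhs (1%g : P) N & forall x x', N x -> N x' ->
    forall t, `|t| <= A -> c t = (x^-1 * x')%g -> `|t| < e / 2.
  have cg : {for (1%g, 1%g), continuous (fun z : P * P => (z.1^-1 * z.2)%g)}.
    by apply: (@mulg_continuous_at P); [apply: (@invg_continuous_at P); exact: cvg_fst|exact: cvg_snd].
  have : \forall z \near (1%g : P, 1%g : P), forall t, `|t| <= A ->
      c t = (z.1^-1 * z.2)%g -> `|t| < e / 2.
    apply: (near_continuous (P := fun m => forall t, `|t| <= A -> c t = m -> `|t| < e / 2) cg).
    by rewrite /= mulVg.
  move=> [[B C] [/= B1 C1] BC]; exists (B `&` C); first exact: filterI.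
  by move=> x x' [Bx _] [_ Cx'] t tA; exact: (BC (x, x')).
(* The two bounds [e / 2], on the arrival time here and on the parameter of [x^-1 * x'] from
   [Nsmall], add up to the uniqueness radius [e]. *)
pose good x := N x /\ [/\ psi (phi x) = x, F (theta (phi x), phi x) = 0,
  (forall t, `|t| < e -> F (t, phi x) = 0 -> t = theta (phi x)) & `|theta (phi x)| < e / 2].
have near_phi (S : set E) : (\forall y \near (0 : E), S y) -> \forall x \near (1%g : P), S (phi x).
  by move=> NS; apply: (near_continuous (P := S) phic1); rewrite (ll_phi1 H).
have good1 : \forall x \near (1%g : P), good x.
  have g2 := near_phi _ Fth; have g3 := near_phi _ eP.
  have g4 : \forall x \near (1%g : P), `|theta (phi x)| < e / 2.
    apply: (near_phi (fun y => `|theta y| < e / 2)).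
    apply: (near_continuous (P := fun r : R^o => `|r| < e / 2) (smooth_at_continuous sth)).
    rewrite th0; have cn : {for 0, continuous (fun r : R^o => `|r|)} by exact: norm_continuous.
    apply: (near_continuous (P := fun r : R => r < e / 2) cn); apply: lt_nbhsl.
    by rewrite normr0 divr_gt0.
  have g1 := ll_phiK H.
  apply: filterS (filterI N1 (filterI g1 (filterI g2 (filterI g3 g4)))) => x.
  by move=> [Nx [e1 [e2 [e3 e4]]]]; split.
have rhoE x x' : good x -> good x' -> cls x = cls x' -> rho (phi x) = rho (phi x').
  move=> [Nx [xK Fx xU xe]] [Nx' [xK' Fx' xU' xe']] /quotient_map_eqP kK.
  have [t tA ct] := Kc kK; have te := Nsmall _ _ Nx Nx' t tA ct.
  have x'E : x' = (x * c t)%g by rewrite ct mulVKg.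
  (* Moving [x] for time [theta (phi x') + t] reaches the same point as moving [x' = x * c t] for
     time [theta (phi x')]. By uniqueness this is the arrival time of [x], so both points arrive at
     the same place. *)
  have ctE : (c (theta (phi x') + t) * x)%g = (c (theta (phi x')) * x')%g.
    by rewrite cD x'E -mulgA (Kcentral x (cK t)).
  have th : theta (phi x') + t = theta (phi x).
    apply: xU.
      by rewrite (splitr e); apply: le_lt_trans (ler_normD _ _) (ltrD xe' te).
    by rewrite /F /= xK ctE -[in RHS]Fx' /F /= xK'.
  by rewrite /rho /act /= xK xK' -ctE th.
(* Any good representative gives the same value by [rhoE]; the default [1] only serves cosets
   without one. *)
pose phiQ (q : Q) : E' := rho (phi (xget 1%g [set x : P | good x /\ cls x = q])).
have phiQE x : good x -> phiQ (cls x) = rho (phi x).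
  move=> gx; rewrite /phiQ; have [] := @xgetPex _ 1%g [set y : P | good y /\ cls y = cls x].
    by exists x.
  by move=> g1 e1; exact: rhoE.
pose psiQ (s : E') : Q := cls (psi (slice_incl i s)).
have c_incl : continuous (slice_incl i) by exact: findim_linear_continuous (@slice_incl_linear i).
have incl0 : slice_incl i 0 = 0.
  by apply/rowP => j; rewrite !mxE; case: unlift => // k; rewrite mxE.
have quot_smooth (V : normedModType R) (hV : findim V) (f : V -> P) (z0 : V) :
    {for z0, continuous f} -> f z0 = 1%g -> smooth_at z0 (phi \o f) ->
    smooth_at z0 (fun z => phiQ (cls (f z))).
  move=> cf f1 sf.
  have s1 : smooth_at z0 (fun z => rho ((phi \o f) z)).
    by apply: (smooth_at_chain s_rho _ sf); rewrite /= f1 (ll_phi1 H).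
  apply: smooth_at_ext s1.
  have gf : \forall z \near z0, good (f z) by apply: (near_continuous (P := good) cf); rewrite f1.
  by apply: filterS gf => z /phiQE.
exists phiQ, psiQ; split; last by move=> V hV f z0; exact: quot_smooth.
have goodone : good 1%g by exact: nbhs_singleton good1.
have cpsi : {for 0, continuous (fun s : E' => psi (slice_incl i s))}.
  by apply: (continuous_comp (@c_incl 0)); rewrite incl0; exact: psic0.
have psi1 : psi (slice_incl i 0) = 1%g by rewrite incl0 (ll_psi0 H).
have s_incl (s : E') : smooth_at s (slice_incl i) by exact: smooth_at_linear (@slice_incl_linear i).
have near_incl (S : set E) : (\forall y \near (0 : E), S y) -> \forall s \near (0 : E'), S (slice_incl i s).
  by move=> NS; apply: (near_continuous (P := S) (@c_incl 0)); rewrite incl0.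
split.
- by rewrite -(quotient_map1 Kcentral Kclosed) phiQE// (ll_phi1 H).
- by rewrite /psiQ psi1.
- apply: (@quotient_map_nbhs _ _ _ Kcentral Kclosed 1%g).
  have sl : \forall x \near (1%g : P), psi (phi (c (theta (phi x)) * x)%g) = (c (theta (phi x)) * x)%g.
    have cl : {for 1%g, continuous (fun x : P => (c (theta (phi x)) * x)%g)}.
      apply: (@mulg_continuous_at P); last exact: cvg_id.
      apply: (@continuous_comp _ _ _ (theta \o phi) c); last exact: cc.
      apply: continuous_comp phic1 _; rewrite (ll_phi1 H); exact: smooth_at_continuous sth.
    apply: (near_continuous (P := fun x => psi (phi x) = x) cl).
    by rewrite (ll_phi1 H) th0 c0 mulg1; exact: ll_phiK H.
  apply: filterS2 good1 sl => x gx slx.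
  have [_ [xK Fx _ _]] := gx.
  rewrite phiQE// /psiQ /rho slice_projK; last exact: Fx.
  (* Moving into the slice multiplies [x] by [c (theta (phi x))], an element of [K], so the coset is
     kept. *)
  rewrite /act /= xK slx; apply/quotient_map_eqP.
  by rewrite invgM -mulgA (Kcentral x) ?mulKg ?gpredV//.
- have g1 : \forall s \near (0 : E'), good (psi (slice_incl i s)).
    by apply: (near_continuous (P := good) cpsi); rewrite psi1.
  have g2 := near_incl _ (ll_psiK H).
  apply: filterS2 g1 g2 => s gs sK; rewrite /psiQ phiQE// sK.
  have [_ [_ _ U _]] := gs.
  (* Points of the slice have arrival time [0]. *)
  have th : 0 = theta (slice_incl i s).
    rewrite -[in RHS]sK; apply: U; first by rewrite normr0.
    by rewrite /F /= c0 mul1g sK sK slice_incl_coord.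
  by rewrite /rho /act /= -th c0 mul1g sK slice_inclK.
- apply: (@quotient_map_nbhs _ _ _ Kcentral Kclosed 1%g).
  have gg : \forall x \near (1%g : P), \forall y \near x, good y by apply: nbhs_interior.
  have rc : \forall x \near (1%g : P), {for phi x, continuous rho}.
    apply: (near_phi (fun y => {for y, continuous rho})).
    by apply: filterS (smooth_at_near s_rho) => y; exact: smooth_at_continuous.
  apply: filterS3 gg rc (ll_phic H) => x gx rx px A' NA'.
  apply: quotient_map_nbhs.
  have gx0 : good x by exact: nbhs_singleton gx.
  rewrite phiQE// in NA'.
  have crp : {for x, continuous (rho \o phi)} by exact: continuous_comp px rx.
  have NA2 : \forall y \near x, A' (rho (phi y)) by exact: crp.
  by apply: filterS2 gx NA2 => y gy; rewrite /= phiQE.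
- have np : \forall s \near (0 : E'), {for slice_incl i s, continuous psi}.
    exact: near_incl (ll_psic H).
  apply: filterS np => s cs.
  apply: (@continuous_comp _ _ _ (fun s => psi (slice_incl i s)) cls).
    exact: continuous_comp (@c_incl s) cs.
  exact: quotient_map_continuous.
- have sf1 : smooth_at (0, 0) (fst : E' * E' -> E') by exact: smooth_at_linear (@fst_linear _ _ _).
  have sf2 : smooth_at (0, 0) (snd : E' * E' -> E') by exact: smooth_at_linear (@snd_linear _ _ _).
  have q := @quot_smooth _ _ (fun z : E' * E' => psi (slice_incl i z.1) * psi (slice_incl i z.2))%g (0, 0).
  apply: smooth_at_eq (q _ _ _ _).
  + by move=> z; rewrite quotient_mapM.
  + apply: (@mulg_continuous_at P).
      by apply: (@continuous_comp _ _ _ fst (fun s => psi (slice_incl i s))); [exact: cvg_fst|exact: cpsi].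
    by apply: (@continuous_comp _ _ _ snd (fun s => psi (slice_incl i s))); [exact: cvg_snd|exact: cpsi].
  + by rewrite /= psi1 mulg1.
  + have si1 := smooth_at_linl (@slice_incl_linear i) sf1.
    have si2 := smooth_at_linl (@slice_incl_linear i) sf2.
    apply: (smooth_at_chain (ll_mul H) _ (smooth_at_pair (smooth_at_linl (@slice_incl_linear i) sf1)
      (smooth_at_linl (@slice_incl_linear i) sf2))).
    by rewrite /= incl0.
- have q := @quot_smooth _ _ (fun s : E' => (psi (slice_incl i s))^-1)%g 0.
  apply: smooth_at_eq (q _ _ _ _).
  + by move=> z; rewrite quotient_mapV.
  + exact: (@invg_continuous_at P).
  + by rewrite psi1 invg1.
  + by apply: (smooth_at_chain (ll_inv H) _ (s_incl 0)).
- move=> g0; have [g <-] := quotient_map_surj g0.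
  have q := @quot_smooth _ _ (fun s : E' => g * psi (slice_incl i s) * g^-1)%g 0.
  apply: smooth_at_eq (q _ _ _ _).
  + by move=> z; rewrite !quotient_mapM quotient_mapV.
  + apply: (@mulg_continuous_at P); last exact: cst_continuous_at.
    by apply: (@mulg_continuous_at P); [exact: cst_continuous_at|].
  + by rewrite psi1 mulg1 mulgV.
  + by apply: (smooth_at_chain (ll_conj H g) _ (s_incl 0)).
Qed.

End quotient_local_lie.

(** * Uniform limits and nilsequences *)

Section expi.
Variable R : realType.
Implicit Types (s t : R) (z : R[i]).

Lemma expiD s t : expi (s + t) = expi s * expi t.
Proof.
by rewrite /expi cosD sinD; apply/eqP; rewrite eq_complex /= eqxx /= addrC.
Qed.

Lemma expi0 : expi (0 : R) = 1.
Proof. by rewrite /expi cos0 sin0. Qed.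

Lemma normr_expi t : `|expi t| = 1.
Proof. by rewrite normc_def /= cos2Dsin2 sqrtr1. Qed.

Lemma circle_expi t : circle R (expi t).
Proof. exact: normr_expi. Qed.

Lemma conjc_expi t : conjc (expi t) = expi (- t).
Proof. by rewrite /expi cosN sinN. Qed.

Lemma expiN t : expi (- t) = (expi t)^-1.
Proof.
apply: (mulIf (x := expi t)); first by rewrite -normr_eq0 normr_expi oner_eq0.
by rewrite -expiD addNr expi0 mulVf// -normr_eq0 normr_expi oner_eq0.
Qed.

Lemma expi_inj0 t : `|t| <= pi -> expi t = 1 -> t = 0.
Proof.
move=> tpi [ct _].
have c0 : cos `|t| = cos 0 by rewrite cos0; case: (ler0P t) => _; rewrite ?cosN.
have := @cos_inj R `|t| 0; rewrite !in_itv /= normr_ge0 tpi lexx pi_ge0.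
by move=> /(_ isT isT c0)/eqP; rewrite normr_eq0 => /eqP.
Qed.

(** The arccosine of the real part gives the angle up to sign, and the sign of the imaginary part
    decides. *)
Lemma circleP z : circle R z -> exists2 t, `|t| <= pi & expi t = z.
Proof.
case: z => x y; rewrite /circle /= normc_def /= => /complexI n1.
have n2 : x ^+ 2 + y ^+ 2 = 1.
  have h0 : 0 <= x ^+ 2 + y ^+ 2 by rewrite addr_ge0 ?sqr_ge0.
  by rewrite -(sqr_sqrtr h0) n1 expr1n.
have x1 : -1 <= x <= 1.
  by rewrite -ler_norml -(@expr_le1 _ 2)// real_normK ?num_real// -n2 lerDl sqr_ge0.
have [/andP[a0 api] ca] := acos_def x1.
have sa : sin (acos x) ^+ 2 = y ^+ 2 by rewrite sin2cos2 ca -n2 addrAC subrr add0r.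
have s0 : 0 <= sin (acos x) by apply: sin_ge0_pi; rewrite a0.
have [y0|y0] := leP 0 y.
  exists (acos x); first by rewrite ger0_norm.
  rewrite /expi ca; congr (_ +i* _); apply/eqP; rewrite -(@eqrXn2 _ 2)// sa//.
exists (- acos x); first by rewrite normrN ger0_norm.
rewrite /expi cosN sinN ca; congr (_ +i* _); apply/eqP.
by rewrite eqr_oppLR -(@eqrXn2 _ 2)// ?sqrrN ?sa// oppr_ge0 ltW.
Qed.

Lemma expi_int (m : int) : expi (2 * pi * m%:~R) = 1 :> R[i].
Proof.
have e1 : expi (2 * pi) = 1 :> R[i].
  by rewrite mulr2n mulrDl mul1r expiD /expi cospi sinpi; apply/eqP; rewrite eq_complex /=; apply/andP; split; apply/eqP; ring.
have en (n : nat) : expi (2 * pi * n%:R) = 1 :> R[i].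
  elim: n => [|n IH]; first by rewrite mulr0 expi0.
  by rewrite -(natr1 n) mulrDr mulr1 expiD IH e1 mul1r.
case: m => n; first exact: en.
by rewrite NegzE mulrNz mulrN expiN en invr1.
Qed.

Lemma real_complex_continuous : continuous (fun x : R => x%:C : R[i]).
Proof.
move=> x; apply/cvgrPdist_lt => e e0.
have eR : e = (complex.Re e)%:C :> R[i].
    by case: e e0 => u v /ltW/ger0_Im /= ->.
have e0' : 0 < complex.Re e by move: e0; rewrite {1}eR ltcR.
near=> y; rewrite -rmorphB normc_def /= expr0n addr0 sqrtr_sqr eR ltcR.
near: y; exact: cvgr_dist_lt.
Unshelve. all: by end_near. Qed.

Lemma expi_continuous : continuous (@expi R).
Proof.
have -> : @expi R = fun t => (cos t)%:C + 'i%C * (sin t)%:C.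
  by apply/funext => t; rewrite [LHS]complexE.
move=> t; apply: cvgD.
  by apply: (@continuous_comp _ _ _ cos (fun x : R => x%:C)); [exact: continuous_cos|exact: real_complex_continuous].
apply: cvgM; first exact: cvg_cst.
by apply: (@continuous_comp _ _ _ sin (fun x : R => x%:C)); [exact: continuous_sin|exact: real_complex_continuous].
Qed.

Lemma normc_conj z : `|conjc z| = `|z|.
Proof. by case: z => x y; rewrite !normc_def /= sqrrN. Qed.

Lemma conjc_continuous : continuous (@conjc R).
Proof.
move=> z; apply/(@cvgrPdist_lt _ _ _ (nbhs z) (nbhs_filter z)) => e e0.
apply: (@filterS _ _ (nbhs_filter z) (ball z e)); last exact: nbhsx_ballx.
by move=> w; rewrite -ball_normE /= -rmorphB normc_conj.
Qed.

Lemma conjc_circle z : circle R z -> circle R (conjc z).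
Proof. by rewrite /circle /= normc_conj. Qed.

End expi.

(** * Uniform limits of sequences *)

Section uniform_limits.
Variable R : realType.
Implicit Types (P : (int -> R[i]) -> Prop) (a b : int -> R[i]).

Lemma uniform_cvgP (u : nat -> int -> R[i]) a :
  {uniform, u @ \oo --> a} <->
  forall e : R[i], 0 < e -> \forall k \near \oo, forall n, `|a n - u k n| < e.
Proof.
split=> [ua e e0|H].
  have : nbhs (a : {uniform int -> R[i]}) [set h | forall n, `|a n - h n| < e].
    apply/uniform_nbhs; exists [set xy | ball xy.1 e xy.2].
    split; first by rewrite -entourage_ballE; exists e.
    by move=> h /= hn n; have := hn n I; rewrite -ball_normE.
  by move=> /ua.
move=> A /uniform_nbhs[E [/=]]; rewrite -entourage_ballE => -[e e0 eE] EA.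
have He := H e e0; apply: filterS He => k hk; apply: EA => n _ /=; apply: eE.
by rewrite -ball_normE /=; exact: hk.
Qed.

Lemma uniform_limitP P a : uniform_limit_of P a <->
  forall e : R, 0 < e -> exists2 b, P b & forall n, `|a n - b n| < e%:C.
Proof.
split=> [[u Pu /uniform_cvgP ua] e e0|H].
  have e0C : 0 < e%:C :> R[i] by rewrite ltcR.
  have [k _ hk] := ua _ e0C; exists (u k) => //.
  exact: (hk k (leqnn k)).
have /choice[u uP] (k : nat) : exists b, P b /\ forall n, `|a n - b n| < (k.+1%:R^-1 : R)%:C.
  have [b Pb ab] := H k.+1%:R^-1 (ltac:(by rewrite invr_gt0)).
  by exists b.
exists u => [k|]; first by have [] := uP k.
apply/uniform_cvgP => e e0.
(* A positive complex number is real. *)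
have eR : e = (complex.Re e)%:C by case: e e0 => x y /ltW/ger0_Im /= ->.
have e0' : 0 < complex.Re e by move: e0; rewrite {1}eR ltcR.
have := near_infty_natSinv_lt (PosNum e0'); apply: filterS => k /= ke n.
have [_ /(_ n) h] := uP k; apply: lt_trans h _.
by rewrite eR ltcR.
Qed.

Lemma uniform_limit_closed P a :
  (forall e : R, 0 < e -> exists2 b, uniform_limit_of P b & forall n, `|a n - b n| < e%:C) ->
  uniform_limit_of P a.
Proof.
move=> H; apply/uniform_limitP => e e0.
have e20 : 0 < e / 2 by rewrite divr_gt0.
have [b /uniform_limitP/(_ _ e20)[d Pd bd] ab] := H _ e20.
exists d => // n; rewrite (splitr e) rmorphD /= -(subrKA (b n)).
exact: le_lt_trans (ler_normD _ _) (ltrD (ab n) (bd n)).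
Qed.

Lemma uniform_limit_map (P Q : (int -> R[i]) -> Prop) (F : (int -> R[i]) -> int -> R[i]) a :
  (forall b, P b -> Q (F b)) ->
  (forall b (e : R), 0 < e -> (forall n, `|a n - b n| < e%:C) ->
     forall n, `|F a n - F b n| < e%:C) ->
  uniform_limit_of P a -> uniform_limit_of Q (F a).
Proof.
move=> PQ FF /uniform_limitP H; apply/uniform_limitP => e e0.
by have [b Pb ab] := H e e0; exists (F b); [exact: PQ|exact: FF].
Qed.

Definition bounded_seq b : Prop := exists M : R, forall n, `|b n| <= M%:C.

(** The order of choices matters: the limit [b] is bounded, being within [1] of a bounded sequence,
    and this fixes the precision for [c]; only then does a bound on [c] fix the precision for
    [d]. *)
Lemma uniform_limit_mul (P1 P2 Q : (int -> R[i]) -> Prop) a b :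
  (forall c d, P1 c -> P2 d -> Q (fun n => c n * d n)) ->
  (forall c, P1 c -> bounded_seq c) -> (forall d, P2 d -> bounded_seq d) ->
  uniform_limit_of P1 a -> uniform_limit_of P2 b ->
  uniform_limit_of Q (fun n => a n * b n).
Proof.
move=> PQ bP1 bP2 /uniform_limitP Ha /uniform_limitP Hb; apply/uniform_limitP => e e0.
have [d0 Pd0 bd0] := Hb 1 ltr01; have [M HM] := bP2 _ Pd0.
pose M1 := `|M| + 1.
have M10 : 0 < M1 by rewrite /M1 ltr_pwDr.
have bM n : `|b n| <= M1%:C.
  rewrite /M1 rmorphD /= -[b n](subrK (d0 n)) addrC.
  apply: le_trans (ler_normD _ _) (lerD _ _); last exact: ltW.
  by apply: le_trans (HM n) _; rewrite lecR ler_norm.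
have e1 : 0 < e / (2 * M1) by rewrite divr_gt0// mulr_gt0.
have [c Pc ac] := Ha _ e1; have [N HN] := bP1 _ Pc.
pose N1 := `|N| + 1.
have N10 : 0 < N1 by rewrite /N1 ltr_pwDr.
have cN n : `|c n| <= N1%:C.
  by apply: le_trans (HN n) _; rewrite lecR /N1 ler_wpDr// ler_norm.
have e2 : 0 < e / (2 * N1) by rewrite divr_gt0// mulr_gt0.
have [d Pd bd] := Hb _ e2.
exists (fun n => c n * d n); first exact: PQ.
move=> n.
have -> : a n * b n - c n * d n = (a n - c n) * b n + c n * (b n - d n) by ring.
have -> : e%:C = (e / (2 * M1))%:C * M1%:C + N1%:C * (e / (2 * N1))%:C.
  rewrite -!rmorphM -rmorphD /=; congr (_%:C); field.
  by rewrite !gt_eqF.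
apply: le_lt_trans (ler_normD _ _) _; rewrite !normrM; apply: ltr_leD.
  have [b0|b0] := eqVneq (b n) 0.
    by rewrite b0 normr0 mulr0 -rmorphM ltcR mulr_gt0.
  apply: (@lt_le_trans _ _ ((e / (2 * M1))%:C * `|b n|)).
    by rewrite ltr_pM2r ?normr_gt0.
  by rewrite ler_wpM2l// lecR ltW.
apply: ler_pM => //; exact: ltW.
Qed.

End uniform_limits.

(** * Trigonometric polynomials and almost periodic sequences *)

Section trigonometric_polynomials.
Variable R : realType.
Implicit Types a b : int -> R[i].

Lemma conjcM (z w : R[i]) : conjc (z * w) = conjc z * conjc w.
Proof. exact: rmorphM. Qed.

Lemma conjcB (z w : R[i]) : conjc (z - w) = conjc z - conjc w.
Proof. exact: rmorphB. Qed.

Lemma trig_conj a : trigonometric_polynomial a ->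
  trigonometric_polynomial (fun n => conjc (a n)).
Proof.
move=> [s sE]; exists [seq (conjc p.1, - p.2) | p <- s] => n.
rewrite sE rmorph_sum big_map /=; apply: eq_bigr => p _.
by rewrite conjcM conjc_expi mulrN.
Qed.

Lemma trig_shift a : trigonometric_polynomial a -> trigonometric_polynomial (shift_seq a).
Proof.
move=> [s sE]; exists [seq (p.1 * expi (2 * pi * p.2), p.2) | p <- s] => n.
rewrite /shift_seq sE big_map /=; apply: eq_bigr => p _.
rewrite -[RHS]mulrA -expiD intrD mulrDr mulrDl [2 * pi * 1%:~R]mulr1.
by rewrite addrC.
Qed.

Lemma trig_mul a b : trigonometric_polynomial a -> trigonometric_polynomial b ->
  trigonometric_polynomial (fun n => a n * b n).
Proof.
move=> [s sE] [t tE].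
exists [seq (p.1 * q.1, p.2 + q.2) | p <- s, q <- t] => n.
rewrite sE tE big_distrl /= big_allpairs_dep; apply: eq_bigr => p _.
rewrite big_distrr /=; apply: eq_bigr => q _.
by rewrite [in RHS]mulrDr expiD mulrACA.
Qed.

Lemma normcE (z : R[i]) : `|z| = (complex.Re `|z|)%:C.
Proof. by rewrite normc_def. Qed.

Lemma normr_real_complex (x : R) : `|x%:C| = `|x|%:C :> R[i].
Proof. by rewrite normc_def /= expr0n addr0 sqrtr_sqr. Qed.

Lemma trig_bounded a : trigonometric_polynomial a -> bounded_seq a.
Proof.
move=> [s sE]; exists (\sum_(p <- s) complex.Re `|p.1|) => n.
rewrite sE rmorph_sum /=; apply: le_trans (ler_norm_sum _ _ _) _.
by apply: ler_sum => p _; rewrite normrM normr_expi mulr1 -normcE.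
Qed.

Lemma almost_periodic_conj a : almost_periodic a -> almost_periodic (fun n => conjc (a n)).
Proof.
apply: (@uniform_limit_map _ _ _ (fun a n => conjc (a n))); first exact: trig_conj.
by move=> b e e0 ab n; rewrite -conjcB normc_conj.
Qed.

Lemma almost_periodic_shift a : almost_periodic a -> almost_periodic (shift_seq a).
Proof.
apply: (@uniform_limit_map _ _ _ (@shift_seq R)); first exact: trig_shift.
by move=> b e e0 ab n; exact: ab.
Qed.

Lemma almost_periodic_mul a b : almost_periodic a -> almost_periodic b ->
  almost_periodic (fun n => a n * b n).
Proof. by apply: uniform_limit_mul; [exact: trig_mul|exact: trig_bounded|exact: trig_bounded]. Qed.

End trigonometric_polynomials.

Section integer_powers.
Variable G : groupType.

Definition zpow (x : G) (n : int) : G :=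
  match n with
  | Posz k => x ^+ k
  | Negz k => x^-1 ^+ k.+1
  end%g.

Lemma zpowS x n : zpow x (n + 1) = (zpow x n * x)%g.
Proof.
case: n => [k|[|k]].
- by rewrite -PoszD addn1 /= expgSr.
- by rewrite /= expg1 mulVg.
- have -> : Negz k.+1 + 1 = Negz k by rewrite !NegzE -[k.+2]addn1 PoszD opprD subrK.
  by rewrite -[RHS]/(x^-1 ^+ k.+2 * x)%g expgSr mulgVK.
Qed.

End integer_powers.

Section group_morphisms.
Implicit Types G H : groupType.

Lemma morph_one G H (f : G -> H) : {morph f : x y / (x * y)%g} -> f 1%g = 1%g.
Proof. by move=> fM; apply: (@mulgI _ (f 1%g)); rewrite -fM !mulg1. Qed.

Lemma morph_inv G H (f : G -> H) : {morph f : x y / (x * y)%g} ->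
  {morph f : x / x^-1%g}.
Proof. by move=> fM x; apply: (@mulgI _ (f x)); rewrite -fM !mulgV morph_one. Qed.

Lemma zpow_morph G H (f : G -> H) x n : {morph f : u v / (u * v)%g} ->
  f (zpow x n) = zpow (f x) n.
Proof.
move=> fM; have fX y k : f (y ^+ k)%g = (f y ^+ k)%g.
  by elim: k => [|k IH]; rewrite ?expg0 ?(morph_one fM)// !expgS fM IH.
by case: n => k; rewrite /zpow fX ?(morph_inv fM).
Qed.

End group_morphisms.

Section smooth_curve_theory.
Variables (R : realType) (M : manifoldType R).

Lemma smooth_curve_opp (c : R -> M) : smooth_curve c -> smooth_curve (fun t => c (- t)).
Proof.
move=> [cc sc]; have cN : continuous (fun t : R => c (- t)).
  move=> t; apply: (@continuous_comp _ _ _ -%R c); first exact: opp_continuous.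
  exact: cc.
have lN : linear (-%R : R^o -> R^o) by move=> a u v; rewrite opprD scalerN.
split=> // a Aa; have oc : open ((c : R^o -> M) @^-1` chart_dom a).
  by apply: open_comp => [t _|]; [exact: cc|exact: chart_dom_open].
have ocN : open ((fun t : R^o => c (- t)) @^-1` chart_dom a).
  by apply: open_comp => [t _|]; [exact: cN|exact: chart_dom_open].
apply/(smooth_onP _ ocN) => t /= ct.
have sa := (smooth_onP _ oc).1 (sc a Aa) (- t) ct.
exact: (smooth_at_chain sa erefl (smooth_at_linear t lN)).
Qed.

End smooth_curve_theory.

(** * Basic elementary nilsequences, lifted to the group *)

Section nilsequences.
Variable R : realType.
Implicit Types (X : nilmanifold R) (a : int -> R[i]).

Local Notation proj := coset_of_elt.

Lemma translation_cls X (g x : nil_group X) :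
  translation g (proj x : nil_space X) = proj (g * x)%g.
Proof. exact: translation_pi. Qed.

Lemma translation_iter_cls X (tau x : nil_group X) n :
  translation_iter tau n (proj x) = proj (zpow tau n * x)%g.
Proof.
have iterE g k : iter k (translation g) (proj x : nil_space X) = proj (g ^+ k * x)%g.
  elim: k => [|k IH]; first by rewrite expg0 mul1g.
  by rewrite iterS IH translation_cls mulgA -expgS.
by case: n => k; rewrite /translation_iter iterE.
Qed.

(* The functions on [G] which descend to [C1 iota] on [G / Gamma]. *)
Record C1_lift X (iota : R[i] -> nil_group X) (h : nil_group X -> R[i]) : Prop := C1Lift {
  lift_continuous : continuous h;
  lift_invariant : forall x g, g \in nil_lattice X -> h (x * g)%g = h x;
  lift_equivariant : forall u x, circle R u -> h (iota u * x)%g = u * h x }.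

(** A lift is constant on cosets, so it descends by evaluation at representatives, and its
    continuity passes to the quotient topology. Later constructions can thus stay on the group. *)
Lemma basic_nilsequenceP a : basic_elementary_nilsequence a <->
  exists X (iota : R[i] -> nil_group X) tau h x0,
    [/\ circle_identification iota, C1_lift iota h
      & forall n, a n = h (zpow tau n * x0)%g].
Proof.
split=> [[X [iota [tau [f [q0 [ci [cf ef] aE]]]]]]|[X [iota [tau [h [x0 [ci [ch hG hu] aE]]]]]]].
  have [x0 x0E] := coset_surj q0.
  exists X, iota, tau, (fun x => f (proj x)), x0; split=> //.
    split=> [x|x g gG|u x cu].
    - by apply: (@continuous_comp _ _ _ proj f); [exact: coset_continuous|exact: cf].
    - by rewrite coset_of_eltM.
    - by rewrite -translation_cls ef.
  by move=> n; rewrite aE -x0E translation_iter_cls.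
pose f (q : nil_space X) := h (repr q).
have fE x : f (proj x) = h x.
  have : proj (repr (proj x : nil_space X)) = proj x :> nil_space X by exact: coset_of_repr.
  move=> /coset_eqP kG; rewrite /f -[in RHS](mulVKg (repr (proj x : nil_space X)) x).
  by rewrite hG.
exists X, iota, tau, f, (proj x0); split=> //.
- split.
    have := @quotient_continuous (nil_group X) _ R[i] f.
    case=> _; apply => x.
    have -> : f \o \pi_(coset_space (nil_lattice X))%qT = h by apply/funext => y; exact: fE.
    exact: ch.
  move=> u q cu; have [x <-] := coset_surj q.
  by rewrite translation_cls !fE hu.
- by move=> n; rewrite translation_iter_cls fE aE.
Qed.

Lemma normC_Re_continuous : continuous (fun z : R[i] => complex.Re `|z|).
Proof.
move=> z; apply/(@cvgrPdist_lt _ _ _ (nbhs z) (nbhs_filter z)) => e e0.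
have e0C : 0 < e%:C :> R[i] by rewrite ltcR.
apply: (@filterS _ _ (nbhs_filter z) (ball z e%:C)); last exact: nbhsx_ballx.
move=> w; rewrite -ball_normE => zw; rewrite -ltcR; apply: le_lt_trans zw.
have -> : (`|complex.Re `|z| - complex.Re `|w| |)%:C = `| `|z| - `|w| | :> R[i].
  by rewrite [in RHS](normcE z) [in RHS](normcE w) -rmorphB normr_real_complex.
exact: ler_dist_dist.
Qed.

(** The modulus of [f] is continuous on a compact space. This supplies the bounds that
    [uniform_limit_mul] asks for. *)
Lemma basic_nilsequence_bounded a : basic_elementary_nilsequence a -> bounded_seq a.
Proof.
move=> [X [iota [tau [f [q0 [_ [cf _] aE]]]]]].
have cN : continuous (fun q => complex.Re `|f q|).
  move=> q; apply: (@continuous_comp _ _ _ f (fun z : R[i] => complex.Re `|z|)); first exact: cf.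
  exact: normC_Re_continuous.
have cpt : compact ((fun q => complex.Re `|f q|) @` [set: nil_space X]).
  apply: continuous_compact; last exact: nil_cocompact.
  exact: continuous_subspaceT.
have [M [_ HM]] := compact_bounded cpt.
exists (M + 1) => n; rewrite aE.
have := HM (M + 1) (ltac:(by rewrite ltrDl)) (complex.Re `|f (translation_iter tau n q0)|) _.
rewrite normcE.
by rewrite lecR => /(_ (ex_intro2 _ _ _ I erefl)); apply: le_trans; exact: ler_norm.
Qed.

Lemma basic_nilsequence_shift a : basic_elementary_nilsequence a ->
  basic_elementary_nilsequence (shift_seq a).
Proof.
move=> /basic_nilsequenceP[X [iota [tau [h [x0 [ci hl aE]]]]]].
apply/basic_nilsequenceP; exists X, iota, tau, h, (tau * x0)%g; split=> // n.
by rewrite /shift_seq aE zpowS mulgA.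
Qed.

Lemma circle_identification_conj X (iota : R[i] -> nil_group X) :
  circle_identification iota -> circle_identification (fun u => iota (conjc u)).
Proof.
move=> [im [isub iinj isur] ism]; split.
- move=> u v; rewrite !inE => cu cv; rewrite conjcM.
  by apply: im; rewrite inE; exact: conjc_circle.
- split.
  + by move=> u /conjc_circle /isub.
  + move=> u v; rewrite !inE => cu cv e.
    by rewrite -(conjcK u) -(conjcK v); congr conjc;
      apply: iinj e; rewrite inE; exact: conjc_circle.
  + by move=> g /isur[u cu <-]; exists (conjc u); [exact: conjc_circle|rewrite conjcK].
- have -> : (fun t : R => iota (conjc (expi t))) = (fun t => iota (expi (- t))).
    by apply/funext => t; rewrite conjc_expi.
  exact: (smooth_curve_opp ism).
Qed.

Lemma basic_nilsequence_conj a : basic_elementary_nilsequence a ->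
  basic_elementary_nilsequence (fun n => conjc (a n)).
Proof.
move=> /basic_nilsequenceP[X [iota [tau [h [x0 [ci [ch hG hu] aE]]]]]].
apply/basic_nilsequenceP.
exists X, (fun u => iota (conjc u)), tau, (fun x => conjc (h x)), x0; split.
- exact: circle_identification_conj.
- split.
  + move=> x; apply: (@continuous_comp _ _ _ h (@conjc R)); first exact: ch.
    exact: conjc_continuous.
  + by move=> x g gG; rewrite hG.
  + move=> u x cu; rewrite hu; last exact: conjc_circle.
    by rewrite conjcM conjcK.
- by move=> n; rewrite aE.
Qed.

End nilsequences.

(** * Nilmanifolds from local charts *)

Section subgroup_of.
Variables (G : groupType) (S : set G).
Hypotheses (S1 : S 1%g) (SV : forall x, S x -> S x^-1%g)
  (SM : forall x y, S x -> S y -> S (x * y)%g).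

(** The closure proofs are dummy arguments, from which the subgroup structure of the predicate is
    inferred. *)
Definition subgroup_of_pred (_ : S 1%g) (_ : forall x, S x -> S x^-1%g)
  (_ : forall x y, S x -> S y -> S (x * y)%g) := fun x : G => `[< S x >].
Local Notation K := (subgroup_of_pred S1 SV SM).

Lemma subgroup_of_predP x : x \in K <-> S x.
Proof. by split=> /asboolP. Qed.

Let K1 : 1%g \in K.
Proof. exact/subgroup_of_predP. Qed.

Let KV : invg_closed K.
Proof. by move=> x /subgroup_of_predP Sx; apply/subgroup_of_predP; exact: SV. Qed.

Let KM : mulg_closed K.
Proof.
by move=> x y /subgroup_of_predP Sx /subgroup_of_predP Sy; apply/subgroup_of_predP; exact: SM.
Qed.

HB.instance Definition _ := isInvClosed.Build G K KV.
HB.instance Definition _ := isMulClosed.Build G K KM.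
HB.instance Definition _ := isMul1Closed.Build G K K1.

Definition subgroup_of : groupClosed G := GroupClosed.clone G K _.

Lemma subgroup_ofP x : x \in subgroup_of <-> S x.
Proof. exact: subgroup_of_predP. Qed.

End subgroup_of.

Section commutator_subgroups.
Implicit Types G H : groupType.

Lemma commutator_subgroup_min G (S : set G) : S 1%g -> (forall x, S x -> S x^-1%g) ->
  (forall x y, S x -> S y -> S (x * y)%g) -> (forall x y, S [~ x, y]%g) ->
  commutator_subgroup G `<=` S.
Proof.
move=> S1 SV SM SC; apply: smallest_sub; last by move=> _ [[x y] _ <-]; exact: SC.
split; first by rewrite inE.
by move=> x y; rewrite !inE => Sx Sy; apply: SM => //; exact: SV.
Qed.

Lemma commutator_subgroup_group G :
  [/\ commutator_subgroup G 1%g, forall x, commutator_subgroup G x -> commutator_subgroup G x^-1%g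
    & forall x y, commutator_subgroup G x -> commutator_subgroup G y ->
        commutator_subgroup G (x * y)%g].
Proof.
split=> [H [[H1 _] _]|x cx H [Hg HC]|x y cx cy H [Hg HC]].
- by rewrite inE in H1.
- have Hx : x \in H by rewrite inE; apply: cx.
  by have := group_closedV Hg Hx; rewrite inE.
- have Hx : x \in H by rewrite inE; apply: cx.
  have Hy : y \in H by rewrite inE; apply: cy.
  by have := group_closedM Hg Hx Hy; rewrite inE.
Qed.

Lemma commutator_subgroup_commutator G (x y : G) : commutator_subgroup G [~ x, y]%g.
Proof. by move=> H [_ HC]; apply: HC; exists (x, y). Qed.

Lemma morph_commg G H (f : G -> H) x y : {morph f : x y / (x * y)%g} ->
  f [~ x, y]%g = [~ f x, f y]%g.
Proof. by move=> fM; rewrite /commg /conjg !fM !(morph_inv fM). Qed.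

(** Applied to a morphism from [G] to a larger group or to its quotient, it places the circle in the
    commutator subgroup there without writing its elements as commutators. *)
Lemma commutator_subgroup_morph G H (f : G -> H) u : {morph f : x y / (x * y)%g} ->
  commutator_subgroup G u -> commutator_subgroup H (f u).
Proof.
move=> fM; have [H1 HV HM] := commutator_subgroup_group H.
apply: (@commutator_subgroup_min G (fun u => commutator_subgroup H (f u))).
- by rewrite morph_one.
- by move=> x fx; rewrite (morph_inv fM); exact: HV.
- by move=> x y fx fy; rewrite fM; exact: HM.
- by move=> x y; rewrite morph_commg//; exact: commutator_subgroup_commutator.
Qed.

End commutator_subgroups.

Section circle_morphisms.
Variable R : realType.

Lemma circle1 : circle R 1.
Proof. by rewrite /circle /= normr1. Qed.

Lemma circleM u v : circle R u -> circle R v -> circle R (u * v).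
Proof. by rewrite /circle /= normrM => -> ->; rewrite mulr1. Qed.

Lemma circleV u : circle R u -> circle R u^-1.
Proof. by rewrite /circle /= normfV => ->; rewrite invr1. Qed.

Lemma circle_neq0 u : circle R u -> u != 0.
Proof. by rewrite /circle /= -normr_eq0 => ->; exact: oner_neq0. Qed.

Variables (G : groupType) (iota : R[i] -> G).
Hypothesis iM : {in circle R &, {morph iota : u v / u * v >-> (u * v)%g}}.

Lemma circle_morphM u v : circle R u -> circle R v -> iota (u * v) = (iota u * iota v)%g.
Proof. by move=> cu cv; apply: iM; rewrite inE. Qed.

Lemma circle_morph1 : iota 1 = 1%g.
Proof. by apply: (@mulgI _ (iota 1)); rewrite -circle_morphM ?mulr1 ?mulg1//; exact: circle1. Qed.

Lemma circle_morphV u : circle R u -> iota u^-1 = (iota u)^-1%g.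
Proof.
move=> cu; have cu' := circleV cu; apply: (@mulgI _ (iota u)).
by rewrite -circle_morphM// mulgV mulfV ?circle_morph1//; exact: circle_neq0.
Qed.

Lemma circle_morph_inj : (forall u, circle R u -> iota u = 1%g -> u = 1) ->
  {in circle R &, injective iota}.
Proof.
move=> i1 u v; rewrite !inE => cu cv e; have cu' := circleV cu.
suff : v * u^-1 = 1 by move/divr1_eq.
apply: i1; first exact: circleM.
by rewrite circle_morphM// circle_morphV// e mulgV.
Qed.

(** The image of the circle is a subgroup, so it is enough that it contains the single
    commutators. *)
Lemma commutator_subgroup_circle : (forall x y, exists2 u, circle R u & [~ x, y]%g = iota u) ->
  commutator_subgroup G `<=` iota @` circle R.
Proof.
move=> iC; apply: commutator_subgroup_min.
- by exists 1; [exact: circle1|exact: circle_morph1].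
- by move=> _ [u cu <-]; exists u^-1; [exact: circleV|exact: circle_morphV].
- by move=> _ _ [u cu <-] [v cv <-]; exists (u * v); [exact: circleM|exact: circle_morphM].
- by move=> x y; have [u cu ->] := iC x y; exists u.
Qed.

End circle_morphisms.

Section discrete_subgroups.
Variables (T : topGroupType) (L : set T).
Hypotheses (L1 : L 1%g) (LV : forall x, L x -> L x^-1%g)
  (LM : forall x y, L x -> L y -> L (x * y)%g).

(** Translations reduce isolation of every point of a subgroup to isolation of [1]. *)
Lemma discrete_subgroupP : L `<=` isolated L <-> \forall x \near (1%g : T), L x -> x = 1%g.
Proof.
split=> [dL|N1 x Lx].
  have [_ [V V1 VL]] := dL 1%g L1.
  apply: filterS V1 => x Vx Lx.
  by have : (V `&` L) x by []; rewrite VL.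
split; first by rewrite inE.
have cx : {for x, continuous (fun y => x^-1 * y)%g} by exact: mulgl_continuous.
have Nx : \forall y \near x, L (x^-1 * y)%g -> (x^-1 * y)%g = 1%g.
  by apply: (near_continuous (P := fun y => L y -> y = 1%g) cx); rewrite mulVg.
exists [set y | L (x^-1 * y)%g -> (x^-1 * y)%g = 1%g] => //.
apply/seteqP; split=> [y [/= Vy Ly]|_ ->]; last by split=> //= _; rewrite mulVg.
by apply: (@mulgI _ x^-1%g); rewrite mulVg; apply: Vy; apply: LM => //; exact: LV.
Qed.

(** Here [p] may lie outside [L]. Two points of [L] near [p] differ by an element of [L] near [1],
    so they agree; the only candidate, if distinct from [p], is removed by the Hausdorff
    property. *)
Lemma discrete_subgroup_avoid p : L `<=` isolated L ->
  \forall x \near p, L x -> x = p.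
Proof.
move=> /discrete_subgroupP N1.
have : \forall z \near (p, p), L (z.1^-1 * z.2)%g -> (z.1^-1 * z.2)%g = 1%g.
  have cg : {for (p, p), continuous (fun z : T * T => (z.1^-1 * z.2)%g)}.
    by apply: mulg_continuous_at; [apply: invg_continuous_at; exact: cvg_fst|exact: cvg_snd].
  apply: (near_continuous (P := fun y => L y -> y = 1%g) cg).
  by rewrite /= mulVg.
move=> [[B C] [/= Bp Cp] BC].
have U x y : B x -> C y -> L x -> L y -> x = y.
  move=> Bx Cy Lx Ly; have := BC (x, y) (conj Bx Cy) (LM (LV Lx) Ly).
  by move=> /= e; apply: (@mulgI _ x^-1%g); rewrite e mulVg.
have [[d [Bd Cd Ld]]|nd] := pselect (exists d, [/\ B d, C d & L d]); last first.
  apply: filterS (filterI Bp Cp) => x [Bx Cx] Lx.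
  by exfalso; apply: nd; exists x.
have [pd|/eqP pd] := eqVneq p d.
  by apply: filterS Cp => x Cx Lx; rewrite pd; apply/esym; exact: U.
have cl : closed [set d].
  by apply: accessible_closed_set1; apply: hausdorff_accessible; exact: topgroup_hausdorff.
have pD : \forall x \near p, ~ [set d] x.
  by apply: open_nbhs_nbhs; split; [exact: closed_openC|].
by apply: filterS2 Cp pD => x Cx xd Lx; exfalso; apply: xd; apply/esym; exact: U.
Qed.

End discrete_subgroups.

(** * Cocompactness and compact sets of representatives *)

Section cocompact.
Variables (R : realType) (G : lieGroupType R) (Gamma : groupClosed G).
Local Notation cls := (@coset_of_elt R G Gamma).

HB.instance Definition _ := isPointed.Build (coset_space Gamma) (cls 1%g).

Lemma cocompactW (C : set G) : compact C ->
  (forall x, exists2 y, C y & cls y = cls x) -> compact [set: coset_space Gamma].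
Proof.
move=> cC CG; have -> : [set: coset_space Gamma] = cls @` C.
  by apply/seteqP; split=> // q _; have [x <-] := coset_surj q; have [y Cy <-] := CG x; exists y.
apply: continuous_compact cC; apply: continuous_subspaceT; exact: coset_continuous.
Qed.

Lemma lie_group_locally_compact : exists2 N : set G, compact N & nbhs 1%g N.
Proof.
have [phi [psi [H _]]] := lie_group_local G.
have /nbhs_ballP[e /= e0 eP] := ll_psic H.
(* Half the radius, so that the closed cube lies in the ball where [psi] is continuous. *)
pose N0 : set 'rV[R]_(mdim G) := [set y | forall i, `[- (e / 2), e / 2]%classic (y 0 i)].
have cN0 : compact N0 by apply: (@rV_compact R _ (fun=> `[- (e / 2), e / 2]%classic)) => i; exact: segment_compact.
have e20 : 0 < e / 2 by rewrite divr_gt0.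
exists (psi @` N0).
  apply: continuous_compact cN0; apply: continuous_in_subspaceT => y; rewrite inE => Ny.
  apply: eP; split=> // i j; rewrite ord1 -ball_normE /= mxE sub0r normrN.
  have := Ny j; rewrite /= in_itv /= -ler_norml => /le_lt_trans; apply.
  by rewrite gtr_pMr// invf_lt1// ltr1n.
have phic1 : {for 1%g, continuous phi} by exact: nbhs_singleton (ll_phic H).
have N1 : \forall x \near (1%g : G), N0 (phi x).
  apply: (near_continuous (P := N0) phic1); rewrite (ll_phi1 H).
  apply/nbhs_ballP; exists (e / 2) => //= y [_ ye] i.
  have := ye 0 i; rewrite -ball_normE /= mxE sub0r normrN => /ltW.
  by rewrite ler_norml in_itv.
by apply: filterS2 N1 (ll_phiK H) => x Nx ex; exists (phi x).
Qed.

(** Finitely many translates of a compact neighbourhood of [1] have images covering the compact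
    coset space, and their union is compact. Compact sets of representatives pass directly to
    products and to quotients. *)
Lemma compact_fundamental_set : compact [set: coset_space Gamma] ->
  exists2 C : set G, compact C & forall x, exists2 y, C y & cls y = cls x.
Proof.
have [N cN N1] := lie_group_locally_compact.
rewrite (@compact_cover (coset_space Gamma)) => /(_ G setT (fun g => cls @` [set x | interior N (g^-1 * x)%g])) [].
- move=> g _; apply: coset_open; apply: (@open_comp _ _ (fun x : G => g^-1 * x)%g).
    by move=> x _; exact: (@mulgl_continuous G).
  exact: open_interior.
- move=> q _; have [x <-] := coset_surj q; exists x => //=; exists x => //=.
  by rewrite mulVg.
move=> D _ DP; exists (\big[setU/set0]_(g <- finmap.enum_fset D) [set (g * y)%g | y in N]).
  apply: (@bigsetU_compact G G (fun g => [set (g * y)%g | y in N])) => g _; apply: continuous_compact cN.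
  by apply: continuous_subspaceT; exact: (@mulgl_continuous G).
move=> x; have [g /= gD [y /= /interior_subset Ny yx]] := DP (cls x) I.
exists y => //; rewrite -bigcup_seq; exists g => //=.
by exists (g^-1 * y)%g => //; rewrite mulVKg.
Qed.

End cocompact.

Section basic_nilsequence_of_local_lie.
Variables (R : realType) (T : topGroupType) (n : nat).
Variables (phi : T -> 'rV[R]_n) (psi : 'rV[R]_n -> T).
Hypothesis H : local_lie phi psi.
Variables (L C : set T) (iota : R[i] -> T).
Hypotheses (L1 : L 1%g) (LV : forall x, L x -> L x^-1%g)
  (LM : forall x y, L x -> L y -> L (x * y)%g)
  (L_discrete : \forall x \near (1%g : T), L x -> x = 1%g)
  (cC : compact C) (CL : forall x : T, exists2 y, C y & L (y^-1 * x)%g).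
Hypotheses (iM : {in circle R &, {morph iota : u v / u * v >-> (u * v)%g}})
  (iZ : forall u (x : T), circle R u -> commute (iota u) x)
  (i1 : forall u, circle R u -> iota u = 1%g -> u = 1)
  (iC : forall u, circle R u -> commutator_subgroup T (iota u))
  (Ci : forall x y : T, exists2 u, circle R u & [~ x, y]%g = iota u)
  (ci : {for 0, continuous (fun t : R => iota (expi t))})
  (si : smooth_at (0 : R^o) (fun t => phi (iota (expi t)))).

Local Notation G := (lie_of H).

Let two_step : two_step_nilpotent G.
Proof.
move=> u x /(commutator_subgroup_circle iM Ci)[v cv <-]; exact: iZ.
Qed.

Let Gamma : groupClosed G := @subgroup_of G L L1 LV LM.

Let GammaE : [set` Gamma] = L.
Proof. by apply/seteqP; split=> x; [move/subgroup_ofP|move=> Lx; exact/subgroup_ofP]. Qed.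

Let discrete : [set` Gamma] `<=` isolated [set` Gamma].
Proof. by rewrite GammaE; exact/(@discrete_subgroupP T L L1 LV LM). Qed.

Let cocompact : compact [set: @coset_space R G Gamma].
Proof.
apply: (cocompactW (G := G) (C := C) cC) => x; have [y Cy yx] := CL x.
by exists y => //; apply/coset_eqP/subgroup_ofP.
Qed.

Let X : nilmanifold R := Nilmanifold two_step discrete cocompact.

Let identification : @circle_identification R (nil_group X) iota.
Proof.
split; first exact: iM.
- split=> [u|u v|]; first exact: iC.
    exact: circle_morph_inj.
  exact: (commutator_subgroup_circle iM Ci).
- apply: (@lie_of_smooth_curve _ _ _ _ _ H (fun t => iota (expi t))) => // s t.
  by rewrite expiD (circle_morphM iM)//; exact: circle_expi.
Qed.

(** The interface for both constructions below: a topological group with a local chart, a subgroup,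
    a compact set of representatives and a central circle are supplied, and the section turns them
    into a nilmanifold with an identification. *)
Lemma basic_nilsequence_of_local_lie (h : T -> R[i]) (tau x0 : T) (a : int -> R[i]) :
  continuous h -> (forall x g, L g -> h (x * g)%g = h x) ->
  (forall u x, circle R u -> h (iota u * x)%g = u * h x) ->
  (forall n, a n = h (zpow tau n * x0)%g) -> basic_elementary_nilsequence a.
Proof.
move=> ch hL hu aE; apply/basic_nilsequenceP.
by exists X, iota, tau, h, x0; split=> //; split=> // x g /subgroup_ofP; exact: hL.
Qed.

End basic_nilsequence_of_local_lie.

(** * Products of nilsequences *)

Lemma mul_continuous_at (K : numFieldType) (X : topologicalType) (f g : X -> K) x :
  {for x, continuous f} -> {for x, continuous g} -> {for x, continuous (fun y => f y * g y)}.
Proof. exact: cvgM. Qed.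

Section circle_identification_theory.
Variables (R : realType) (X : nilmanifold R) (iota : R[i] -> nil_group X).
Hypothesis ci : circle_identification iota.
Local Notation G := (nil_group X).

Let iM := circle_morph ci.

Lemma identification_commutator u : circle R u -> commutator_subgroup G (iota u).
Proof. by have [iC _ _] := circle_bij ci; exact: iC. Qed.

Lemma identification_central u x : circle R u -> commute (iota u) x.
Proof. by move=> /identification_commutator; exact: nil_two_step. Qed.

Lemma identification_inj1 u : circle R u -> iota u = 1%g -> u = 1.
Proof.
have [_ inj _] := circle_bij ci => cu; rewrite -(circle_morph1 iM) => e.
by apply: inj e; rewrite inE//; exact: circle1.
Qed.

Lemma identification_surj x y : exists2 u, circle R u & [~ x, y]%g = iota u.
Proof.
have [_ _ sur] := circle_bij ci.
by have [u cu <-] := sur _ (commutator_subgroup_commutator x y); exists u.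
Qed.

Lemma identification_smooth : exists (phi : G -> 'rV[R]_(mdim G)) (psi : 'rV[R]_(mdim G) -> G),
  local_lie phi psi /\ smooth_at (0 : R^o) (fun t => phi (iota (expi t))).
Proof.
have [phi [psi [H sH]]] := lie_group_local G; exists phi, psi; split=> //.
apply: (sH (fun t => iota (expi t))); last exact: circle_smooth ci.
by rewrite expi0 (circle_morph1 iM).
Qed.

Lemma identification_continuous : continuous (fun t : R => iota (expi t)).
Proof. by have [] := circle_smooth ci. Qed.

End circle_identification_theory.

Lemma lattice_near1 (R : realType) (X : nilmanifold R) :
  \forall x \near (1%g : nil_group X), x \in nil_lattice X -> x = 1%g.
Proof.
apply: (@discrete_subgroupP (nil_group X) [set` nil_lattice X] _ _ _).1.
- exact: gpred1.
- by move=> x; exact: gpredVr.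
- by move=> x y; exact: gpredM.
- exact: nil_lattice_discrete.
Qed.

Lemma vgroup_zpow (R : realType) k (t : vgroup R k) n j : (zpow t n : 'rV[R]_k) 0 j = n%:~R * (t : 'rV[R]_k) 0 j.
Proof.
have XE (y : vgroup R k) m : (y ^+ m : 'rV[R]_k)%g 0 j = m%:R * (y : 'rV[R]_k) 0 j.
  elim: m => [|m IH]; first by rewrite mxE mul0r.
  by rewrite expgS mxE -[RHS]/(m.+1%:R * _) -natr1 mulrDl mul1r addrC; congr (_ + _).
case: n => m; rewrite /zpow XE//.
by rewrite mxE mulrN NegzE mulrNz mulNr.
Qed.

(** * Extension by a torus *)

Section torus_extension.
Variables (R : realType) (X : nilmanifold R) (iota : R[i] -> nil_group X).
Hypothesis ci : circle_identification iota.
Variable k : nat.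
Local Notation G := (nil_group X).
Local Notation V := (vgroup R k).
Local Notation T := (G * V)%type.

Definition torus_lattice (x : T) : Prop :=
  x.1 \in nil_lattice X /\ forall j, exists m : int, (x.2 : 'rV[R]_k) 0 j = m%:~R.

Lemma torus_lattice1 : torus_lattice 1%g.
Proof. by split=> [|j]; [exact: gpred1|exists 0; rewrite mxE]. Qed.

Lemma torus_latticeV x : torus_lattice x -> torus_lattice x^-1%g.
Proof.
move=> [x1 x2]; split=> [|j]; first exact: gpredVr.
by have [m mE] := x2 j; exists (- m); rewrite mxE mE rmorphN.
Qed.

Lemma torus_latticeM x y : torus_lattice x -> torus_lattice y -> torus_lattice (x * y)%g.
Proof.
move=> [x1 x2] [y1 y2]; split=> [|j]; first exact: gpredM.
have [m mE] := x2 j; have [p pE] := y2 j.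
by exists (m + p); rewrite mxE mE pE rmorphD.
Qed.

Let discrete : \forall x \near (1%g : T), torus_lattice x -> x = 1%g.
Proof.
have N1 := lattice_near1 X.
have N2 : \forall y \near (1%g : V), forall j, `|(y : 'rV[R]_k) 0 j| < 1.
  apply/(@nbhs_ballP _ 'rV[R]_k); exists 1 => //= y [_ y1] j.
  by have := y1 0 j; rewrite -ball_normE /= mxE sub0r normrN.
exists ([set x | x \in nil_lattice X -> x = 1%g], [set y | forall j, `|(y : 'rV[R]_k) 0 j| < 1]) => //.
move=> [x y] [/= Nx Ny] [/= /Nx -> yZ]; congr pair.
apply/rowP => j; have [m mE] := yZ j; have := Ny j; rewrite mE mxE -intr_norm.
(* An integer of absolute value below [1] is [0]. *)
by rewrite -[1]/((0 + 1)%:~R) ltr_int ltzD1 normr_le0 => /eqP ->.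
Qed.

Let pi1M : {morph (fst : T -> G) : x y / (x * y)%g}. Proof. by []. Qed.
Let pi2M : {morph (snd : T -> V) : x y / (x * y)%g}. Proof. by []. Qed.

Let cocompact : exists2 C : set T, compact C & forall x : T, exists2 y, C y & torus_lattice (y^-1 * x)%g.
Proof.
have [C cC CG] := compact_fundamental_set (@nil_cocompact R X).
pose Q : set V := [set y : 'rV[R]_k | forall i, `[0, 1]%classic (y 0 i)].
exists (C `*` Q).
  apply: compact_setX => //; apply: (@rV_compact R _ (fun=> `[0, 1]%classic)) => i.
  exact: segment_compact.
move=> [x y]; have [x' Cx' /coset_eqP xG] := CG x.
pose f : 'rV[R]_k := \row_i ((y : 'rV[R]_k) 0 i - (Num.floor ((y : 'rV[R]_k) 0 i))%:~R).
exists (x', f).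
  split=> // i; rewrite /= in_itv /= mxE subr_ge0 floor_le_tmp //=.
  by rewrite lerBlDl ltW// -[X in _ + X]/(1%:~R) -intrD floorD1_gt.
split=> // j; exists (Num.floor ((y : 'rV[R]_k) 0 j)).
by rewrite !mxE opprB subrK.
Qed.

(** Only [h] carries the weight of the circle: as [R^k] is abelian, the commutator subgroup is that
    of [G], embedded by [(iota u, 1)], and it does not move the argument of [g]. *)
Lemma basic_nilsequence_mul_periodic (h : G -> R[i]) (tau x0 : G) (g : V -> R[i]) (t : V) :
  C1_lift iota h -> continuous g ->
  (forall y z : V, (forall j, exists m : int, (z : 'rV[R]_k) 0 j = m%:~R) -> g (y * z)%g = g y) ->
  basic_elementary_nilsequence (fun n => h (zpow tau n * x0)%g * g (zpow t n)).
Proof.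
move=> [ch hG hu] cg gZ.
have [phi [psi [H si]]] := identification_smooth ci.
have [C cC CL] := cocompact.
have iM := circle_morph ci.
pose iota' (u : R[i]) : T := (iota u, 1%g).
have cir := identification_continuous ci.
apply: (@basic_nilsequence_of_local_lie R T _ _ _ (local_lie_prod H (@local_lie_vgroup R k))
  torus_lattice C iota' torus_lattice1 torus_latticeV torus_latticeM discrete cC CL
  _ _ _ _ _ _ _ (fun x => h x.1 * g x.2) (tau, t) (x0, 1%g)).
- by move=> u v cu cv; rewrite /iota' iM//; congr pair; rewrite mulg1.
- move=> u [x y] cu; congr pair; first exact: (identification_central ci).
  by rewrite mul1g mulg1.
- by move=> u cu [/(identification_inj1 ci cu)].
- move=> u cu; apply: (@commutator_subgroup_morph G T (fun x => (x, 1%g))).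
    by move=> x y; congr pair; rewrite mulg1.
  exact: (identification_commutator ci).
- move=> [x y] [x' y']; have [u cu xE] := identification_surj ci x x'.
  exists u => //; apply: (congr2 pair xE _ : _ = iota' u).
  by apply/rowP => j; rewrite !mxE; lra.
- by apply: pair_continuous_at; [exact: cir|exact: cst_continuous_at].
- have s0 : smooth_at (0 : R^o) (fun _ : R^o => 0 : 'rV[R]_k) by exact: smooth_at_cst.
  exact: (smooth_at_row_mx si s0).
- move=> x; apply: cvgM.
    by apply: (@continuous_comp _ _ _ fst h); [exact: cvg_fst|exact: ch].
  by apply: (@continuous_comp _ _ _ snd g); [exact: cvg_snd|exact: cg].
- by move=> x y [yG yZ]; rewrite /= hG// gZ.
- by move=> u x cu; rewrite /= hu// mul1g mulrA.
- move=> n; have e1 : (zpow ((tau, t) : T) n).1 = zpow tau n by exact: (zpow_morph _ _ pi1M).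
  have e2 : (zpow ((tau, t) : T) n).2 = zpow t n by exact: (zpow_morph _ _ pi2M).
  by rewrite /= e1 e2 mulg1.
Qed.

End torus_extension.

Lemma basic_nilsequence_mul_trig (R : realType) (a b : int -> R[i]) :
  basic_elementary_nilsequence a -> trigonometric_polynomial b ->
  basic_elementary_nilsequence (fun n => a n * b n).
Proof.
move=> /basic_nilsequenceP[X [iota [tau [h [x0 [ci lh aE]]]]]] [s sE].
(* One coordinate per term of the sum: the frequencies form the translation vector [t], and each
   exponential becomes a character of [R^k] trivial on [Z^k]. *)
pose k := size s.
pose f (j : 'I_k) (y : vgroup R k) := (nth (0, 0) s j).1 * expi (2 * pi * (y : 'rV[R]_k) 0 j).
pose g (y : vgroup R k) := \sum_(j < k) f j y.
pose t : 'rV[R]_k := \row_(j < k) (nth (0, 0) s j).2.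
have -> : (fun n => a n * b n) = (fun n => h (zpow tau n * x0)%g * g (zpow (t : vgroup R k) n)).
  apply/funext => n; rewrite aE sE; congr (_ * _).
  rewrite (big_nth (0, 0)) big_mkord /g; apply: eq_bigr => j _.
  by rewrite /f vgroup_zpow mxE mulrA.
apply: (basic_nilsequence_mul_periodic ci _ _ _ lh).
  have cf j : continuous (f j).
    have c0 : continuous (fun y : 'rV[R]_k => 2 * pi * y 0 j).
      move=> y; apply: (@mul_continuous_at R 'rV[R]_k (fun=> 2 * pi) (fun y => y 0 j)).
        exact: cst_continuous_at.
      exact: coord_continuous.
    move=> y; apply: (@mul_continuous_at R[i] 'rV[R]_k (fun=> (nth (0, 0) s j).1)
      (fun y => expi (2 * pi * y 0 j))); first exact: cst_continuous_at.
    exact: (continuous_comp (c0 y) (@expi_continuous R _)).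
  rewrite /g; elim: (index_enum _) => [|j r IH] y.
    have -> : (fun y : vgroup R k => \sum_(j <- [::]) f j y) = cst 0.
      by apply/funext => z; rewrite big_nil.
    exact: cst_continuous_at.
  have -> : (fun y : vgroup R k => \sum_(i <- j :: r) f i y) =
      (fun y => f j y + \sum_(i <- r) f i y) by apply/funext => z; rewrite big_cons.
  exact: cvgD (cf j y) (IH y).
move=> y z zZ; apply: eq_bigr => j _; rewrite /f; have [m mE] := zZ j.
by rewrite mxE mE mulrDr expiD expi_int mulr1.
Qed.

Lemma lattice_avoid (R : realType) (X : nilmanifold R) (p : nil_group X) :
  \forall x \near p, x \in nil_lattice X -> x = p.
Proof.
apply: (@discrete_subgroup_avoid (nil_group X) [set` nil_lattice X]).
- exact: gpred1.
- by move=> x; exact: gpredVr.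
- by move=> x y; exact: gpredM.
- exact: nil_lattice_discrete.
Qed.

(** * Joining two nilmanifolds along their circles *)

Section joining.
Variables (R : realType) (X X' : nilmanifold R).
Variables (iota : R[i] -> nil_group X) (iota' : R[i] -> nil_group X').
Hypotheses (ci : circle_identification iota) (ci' : circle_identification iota').
Local Notation G := (nil_group X).
Local Notation G' := (nil_group X').
Variables (phi : G -> 'rV[R]_(mdim G)) (psi : 'rV[R]_(mdim G) -> G).
Variables (phi' : G' -> 'rV[R]_(mdim G')) (psi' : 'rV[R]_(mdim G') -> G').
Hypotheses (H : local_lie phi psi) (H' : local_lie phi' psi').
Hypotheses (si : smooth_at (0 : R^o) (fun t => phi (iota (expi t))))
  (si' : smooth_at (0 : R^o) (fun t => phi' (iota' (expi t)))).

Definition join_group : lieGroupType R := lie_of (local_lie_prod H H').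
Local Notation P := join_group.

Let iM := circle_morph ci.
Let iM' := circle_morph ci'.
(** Pairs built with [mk] have type [P], so that its Lie group structure is the one found on
    them. *)
Let mk (x : G) (x' : G') : P := (x, x').

Let mkM x x' y y' : (mk x x' * mk y y')%g = mk (x * y)%g (x' * y')%g.
Proof. by []. Qed.

Let mkV x x' : (mk x x')^-1%g = mk x^-1%g x'^-1%g.
Proof. by []. Qed.

Definition antidiagonal (x : P) : Prop :=
  exists2 u, circle R u & x = mk (iota u) (iota' u^-1).

Lemma antidiagonal1 : antidiagonal 1%g.
Proof.
exists 1; first exact: circle1.
by rewrite invr1 (circle_morph1 iM) (circle_morph1 iM').
Qed.

Lemma antidiagonalV x : antidiagonal x -> antidiagonal x^-1%g.
Proof.
move=> [u cu ->]; exists u^-1; first exact: circleV.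
by rewrite mkV (circle_morphV iM)// -(circle_morphV iM')//; exact: circleV.
Qed.

Lemma antidiagonalM x y : antidiagonal x -> antidiagonal y -> antidiagonal (x * y)%g.
Proof.
move=> [u cu ->] [v cv ->]; exists (u * v); first exact: circleM.
by rewrite mkM (circle_morphM iM)// invfM (circle_morphM iM')//; exact: circleV.
Qed.

Let K : groupClosed P := subgroup_of antidiagonal1 antidiagonalV antidiagonalM.

Lemma antidiagonal_central (k x : P) : k \in K -> commute k x.
Proof.
move=> /subgroup_ofP[u cu ->]; case: x => x x'.
rewrite /commute; apply: (congr2 pair).
  exact: (identification_central ci).
by apply: (identification_central ci'); exact: circleV.
Qed.

Let c (t : R) : P := mk (iota (expi t)) (iota' (expi (- t))).

Let cD s t : c (s + t) = (c s * c t)%g.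
Proof.
rewrite /c opprD !expiD mkM (circle_morphM iM)//; try exact: circle_expi.
by rewrite (circle_morphM iM')//; exact: circle_expi.
Qed.

Let c_continuous : continuous c.
Proof.
move=> t; apply: pair_continuous_at; first exact: (identification_continuous ci).
apply: (@continuous_comp _ _ _ -%R (fun t : R => iota' (expi t))); first exact: opp_continuous.
exact: (identification_continuous ci').
Qed.

Let cK t : c t \in K.
Proof.
by apply/subgroup_ofP; exists (expi t); [exact: circle_expi|rewrite -expiN].
Qed.

Let Kc (k : P) : k \in K -> exists2 t, `|t| <= pi & c t = k.
Proof.
move=> /subgroup_ofP[u /circleP[t tpi <-] ->]; exists t => //.
by rewrite /c expiN.
Qed.

(** It is the image of the compact segment [[- pi, pi]] in a Hausdorff space. *)
Lemma antidiagonal_closed : closed [set x : P | x \in K].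
Proof.
have -> : [set x : P | x \in K] = c @` `[- pi, pi].
  apply/seteqP; split=> [x /Kc[t tpi <-]|_ [t _ <-]]; last exact: cK.
  by exists t => //; rewrite /= in_itv /= -ler_norml.
apply: compact_closed; first exact: manifold_hausdorff.
apply: continuous_compact; last exact: segment_compact.
exact: continuous_subspaceT.
Qed.

Local Notation Q := (central_quotient antidiagonal_central antidiagonal_closed).
Local Notation q := (@quotient_map R P K antidiagonal_central antidiagonal_closed).

Let c_inj t : `|t| <= pi -> c t = 1%g -> t = 0.
Proof.
move=> tpi [e _]; apply: (expi_inj0 tpi).
by apply: (identification_inj1 ci) => //; exact: circle_expi.
Qed.

Let c_smooth : smooth_curve c.
Proof.
apply: (@lie_of_smooth_curve _ _ _ _ _ (local_lie_prod H H') c) => //.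
  exact: c_continuous.
have lN : linear (-%R : R^o -> R^o) by move=> a u v; rewrite opprD scalerN.
apply: (smooth_at_row_mx si).
by apply: (smooth_at_chain si' _ (smooth_at_linear 0 lN)); rewrite oppr0.
Qed.

(** The circle of the first factor; its image in the quotient will be the whole commutator
    subgroup. *)
Let c1 (t : R) : P := mk (iota (expi t)) 1%g.

Let c1_smooth : smooth_curve c1.
Proof.
have cc : continuous c1.
  move=> t; apply: pair_continuous_at; first exact: (identification_continuous ci).
  exact: cst_continuous_at.
apply: (@lie_of_smooth_curve _ _ _ _ _ (local_lie_prod H H') c1).
- move=> s t; rewrite /c1 expiD mkM mulg1 (circle_morphM iM)//; exact: circle_expi.
- exact: cc.
have s0 : smooth_at (0 : R^o) (fun _ : R^o => phi' 1%g) by exact: smooth_at_cst.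
exact: (smooth_at_row_mx si s0).
Qed.

Let c1_1 : c1 0 = 1%g.
Proof. by rewrite /c1 expi0 (circle_morph1 iM). Qed.

Let q_eqP x x' y y' : q (mk x x') = q (mk y y') <->
  exists2 u, circle R u & y = (x * iota u)%g /\ y' = (x' * iota' u^-1%R)%g.
Proof.
split=> [/quotient_map_eqP/subgroup_ofP[u cu [e e']]|[u cu [-> ->]]].
  by exists u => //; rewrite -e -e' !mulVKg.
apply/quotient_map_eqP/subgroup_ofP; exists u => //.
by rewrite mkV mkM !mulKg.
Qed.

Let q_commg x x' y y' : [~ q (mk x x'), q (mk y y')]%g = q (mk [~ x, y]%g [~ x', y']%g).
Proof. exact/esym/(@morph_commg P Q q (mk x x') (mk y y'))/quotient_mapM. Qed.

Definition join_lattice (z : Q) : Prop := exists x x',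
  [/\ x \in nil_lattice X, x' \in nil_lattice X' & q (mk x x') = z].

Lemma join_lattice1 : join_lattice 1%g.
Proof. by exists 1%g, 1%g; split; [exact: gpred1|exact: gpred1|exact: quotient_map1]. Qed.

Lemma join_latticeV z : join_lattice z -> join_lattice z^-1%g.
Proof.
move=> [x [x' [xG xG' <-]]]; exists x^-1%g, x'^-1%g.
by split; [exact: gpredVr|exact: gpredVr|rewrite -quotient_mapV].
Qed.

Lemma join_latticeM z w : join_lattice z -> join_lattice w -> join_lattice (z * w)%g.
Proof.
move=> [x [x' [xG xG' <-]]] [y [y' [yG yG' <-]]]; exists (x * y)%g, (x' * y')%g.
by split; [exact: gpredM|exact: gpredM|rewrite -quotient_mapM].
Qed.

(* No element of the product lattice other than [p] is close to [p]; compactness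
   of the antidiagonal makes this uniform along it. *)
Let discrete : \forall z \near (1%g : Q), join_lattice z -> z = 1%g.
Proof.
apply: (@quotient_map_nbhs _ _ _ antidiagonal_central antidiagonal_closed 1%g).
pose D (y : P) := y.1 \in nil_lattice X /\ y.2 \in nil_lattice X'.
have avoid (p : P) : \forall y \near p, D y -> y = p.
  case: p => p p'; have N := lattice_avoid p; have N' := lattice_avoid p'.
  exists ([set x | x \in nil_lattice X -> x = p], [set x | x \in nil_lattice X' -> x = p']) => //.
  by move=> [y y'] [/= Ny Ny'] [yG yG']; rewrite Ny// Ny'.
have cpt : compact `[- pi, pi : R]%classic by exact: segment_compact.
have cov := (compact_near_coveringP `[- pi, pi : R]%classic).1 cpt.
have near_c : forall t, `[- pi, pi : R]%classic t -> \forall t' \near t & m \near (1%g : P),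
    D (m * c t')%g -> m \in K.
  move=> t _.
  have cg : {for (t, 1%g : P), continuous (fun z : R * P => (z.2 * c z.1)%g)}.
    apply: (@mulg_continuous_at P); first exact: cvg_snd.
    by apply: (@continuous_comp _ _ _ fst c); [exact: cvg_fst|exact: c_continuous].
  have Nc : \forall z \near (t, 1%g : P), D (z.2 * c z.1)%g -> (z.2 * c z.1)%g = c t.
    apply: (near_continuous (P := fun y : P => D y -> y = c t) cg).
    by rewrite /= mul1g; exact: avoid.
  apply: filterS Nc => -[t' m] /= e Dm; have em := e Dm.
  have -> : m = (c t * (c t')^-1)%g by rewrite -em mulgK.
  by apply: gpredM; [exact: cK|apply: gpredVr; exact: cK].
have := cov P (nbhs (1%g : P)) (fun m t => D (m * c t)%g -> m \in K) (nbhs_filter _) near_c.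
(* If the class of [m] is in the lattice, some [c t] with [t] in [[- pi, pi]] carries [m] to a point
   of [D]; the uniform statement [Hm] then puts [m] in [K]. *)
apply: filterS => m Hm [x [x' [xG xG' /esym/quotient_map_eqP/Kc[t tpi ct]]]].
have mE : (m * c t)%g = mk x x' by rewrite ct mulVKg.
rewrite -(quotient_map1 antidiagonal_central antidiagonal_closed); apply/quotient_map_eqP.
rewrite mulg1; apply: gpredVr; apply: (Hm t); last by rewrite mE.
by rewrite /= in_itv /= -ler_norml.
Qed.

Let cocompact : exists2 C : set Q, compact C & forall z : Q, exists2 y, C y & join_lattice (y^-1 * z)%g.
Proof.
have [C cC CG] := compact_fundamental_set (@nil_cocompact R X).
have [C' cC' CG'] := compact_fundamental_set (@nil_cocompact R X').
exists (q @` (C `*` C' : set P)).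
  apply: (@continuous_compact P Q); last exact: (compact_setX cC cC').
  by apply: continuous_subspaceT; exact: quotient_map_continuous.
move=> z; have [[x x'] <-] := quotient_map_surj z.
have [y Cy /coset_eqP yG] := CG x; have [y' Cy' /coset_eqP yG'] := CG' x'.
exists (q (mk y y')); first by exists (mk y y').
exists (y^-1 * x)%g, (y'^-1 * x')%g; split=> //.
by rewrite -quotient_mapV -quotient_mapM.
Qed.

Lemma basic_nilsequence_mul_aux h h' tau tau' x0 x0' :
  C1_lift iota h -> C1_lift iota' h' ->
  basic_elementary_nilsequence
    (fun n => h (zpow tau n * x0)%g * h' (zpow tau' n * x0')%g).
Proof.
move=> [ch hG hu] [ch' hG' hu'].
have [phiP [psiP [HP sP]]] := lie_group_local P.
have pi0 : 0 < pi :> R by exact: pi_gt0.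
have sc : smooth_at (0 : R^o) (phiP \o c) by apply: sP c_smooth; rewrite /c oppr0 expi0 (circle_morph1 iM) (circle_morph1 iM').
have sc1 := sP c1 c1_1 c1_smooth.
have [phiQ [psiQ [HQ sQ]]] := local_lie_quotient antidiagonal_central antidiagonal_closed HP pi0 cD c_continuous sc cK Kc c_inj.
have [C cC CL] := cocompact.
(* Modulo the antidiagonal [(iota u, 1)] and [(1, iota' u)] agree, so either factor could carry the
   circle. *)
pose iotaQ (u : R[i]) : Q := q (mk (iota u) 1%g).
(* A lift is chosen; changing it by [(iota u, iota' u^-1)] multiplies the two factors by [u] and
   [u^-1], so the value does not depend on it. *)
pose hQ (z : Q) := let x := projT1 (cid (quotient_map_surj z)) in h x.1 * h' x.2.
have hQE x x' : hQ (q (mk x x')) = h x * h' x'.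
  rewrite /hQ; case: cid => -[y y'] /= /esym/q_eqP[u cu [-> ->]].
  have cu' := circleV cu.
  rewrite -(identification_central ci x cu) -(identification_central ci' x' cu').
  by rewrite hu// hu'// mulrACA mulfV ?mul1r//; exact: circle_neq0.
apply: (@basic_nilsequence_of_local_lie R Q _ _ _ HQ join_lattice C iotaQ join_lattice1
  join_latticeV join_latticeM discrete cC CL _ _ _ _ _ _ _ hQ (q (mk tau tau')) (q (mk x0 x0'))).
- by move=> u v cu cv; rewrite /iotaQ iM// -quotient_mapM mkM mulg1.
- move=> u z cu; have [[x x'] <-] := quotient_map_surj z.
  rewrite /commute /iotaQ -!quotient_mapM; congr q; apply: (congr2 pair).
    exact: (identification_central ci).
  by rewrite mul1g mulg1.
(* If [(iota u, 1)] is trivial in the quotient, the second coordinate makes the antidiagonal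
   parameter [v] equal to [1], and the first then gives [u = 1]. *)
- move=> u cu /(q_eqP (iota u) 1%g 1%g 1%g)[v cv [e e']].
  apply: (identification_inj1 ci) => //.
  have cv' := circleV cv.
  have v1 : v^-1 = 1 by apply: (identification_inj1 ci' cv'); rewrite e' mul1g.
  by move: e; rewrite -[v]invrK v1 invr1 (circle_morph1 iM) mulg1.
- move=> u cu; apply: (@commutator_subgroup_morph G Q (fun x => q (mk x 1%g))).
    by move=> x y; rewrite -quotient_mapM mkM mulg1.
  exact: (identification_commutator ci).
(* A commutator in [G x G'] is some [(iota u, iota' v)]; multiplying by [(iota v, iota' v^-1)]
   carries it to the first circle, as [(iota (u * v), 1)]. *)
- move=> z w; have [[x x'] <-] := quotient_map_surj z.
  have [[y y'] <-] := quotient_map_surj w.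
  have [u cu xE] := identification_surj ci x y.
  have [v cv yE] := identification_surj ci' x' y'.
  exists (u * v); first exact: circleM.
  have -> : [~ q (mk x x'), q (mk y y')]%g = q (mk (iota u) (iota' v)).
    by rewrite -xE -yE; exact: q_commg.
  apply/q_eqP; exists v => //.
  by rewrite (circle_morphM iM)// -(circle_morphM iM') ?mulfV ?(circle_morph1 iM')//;
    [exact: circle_neq0|exact: circleV].
- apply: (@continuous_comp _ _ _ c1 q).
    by have [+ _] := c1_smooth; exact.
  exact: quotient_map_continuous.
- apply: (sQ R^o _ c1 0) => //.
  by have [+ _] := c1_smooth; exact.
- move=> z; have [[x x'] <-] := quotient_map_surj z => N.
  rewrite -[q (x, x')]/(q (mk x x')) hQE => NN; apply: quotient_map_nbhs.
  have cj : {for (x, x'), continuous (fun y : G * G' => h y.1 * h' y.2)}.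
    apply: mul_continuous_at.
      by apply: (@continuous_comp _ _ _ fst h); [exact: cvg_fst|exact: ch].
    by apply: (@continuous_comp _ _ _ snd h'); [exact: cvg_snd|exact: ch'].
  have Nj : \forall y \near ((x, x') : P), N (h y.1 * h' y.2) by exact: cj.
  by apply: filterS Nj => -[y y'] /=; rewrite -[q (y, y')]/(q (mk y y')) hQE.
- move=> z _ [y [y' [yG yG' <-]]]; have [[x x'] <-] := quotient_map_surj z.
  by rewrite -quotient_mapM mkM !hQE hG// hG'.
- move=> u z cu; have [[x x'] <-] := quotient_map_surj z.
  by rewrite /iotaQ -quotient_mapM mkM !hQE hu// mul1g mulrA.
- move=> n; rewrite -(zpow_morph _ _ (quotient_mapM _ _)).
  have e1 : (zpow (mk tau tau') n).1 = zpow tau n by exact: (@zpow_morph P G fst).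
  have e2 : (zpow (mk tau tau') n).2 = zpow tau' n by exact: (@zpow_morph P G' snd).
  rewrite -quotient_mapM; case: (zpow _ n) e1 e2 => y y' /= -> ->.
  by rewrite mkM hQE.
Qed.

End joining.

Lemma basic_nilsequence_mul (R : realType) (a b : int -> R[i]) :
  basic_elementary_nilsequence a -> basic_elementary_nilsequence b ->
  basic_elementary_nilsequence (fun n => a n * b n).
Proof.
move=> /basic_nilsequenceP[X [iota [tau [h [x0 [ci lh aE]]]]]].
move=> /basic_nilsequenceP[X' [iota' [tau' [h' [x0' [ci' lh' bE]]]]]].
have [phi [psi [H si]]] := identification_smooth ci.
have [phi' [psi' [H' si']]] := identification_smooth ci'.
have -> : (fun n => a n * b n) =
    (fun n => h (zpow tau n * x0)%g * h' (zpow tau' n * x0')%g).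
  by apply/funext => n; rewrite aE bE.
exact: (basic_nilsequence_mul_aux ci ci' H H' si si').
Qed.

(** * Closure properties of elementary nilsequences *)

Section elementary_nilsequences.
Variable R : realType.
Implicit Types a b : int -> R[i].

Lemma elementary_nilsequence_conj a : elementary_nilsequence a ->
  elementary_nilsequence (fun n => conjc (a n)).
Proof.
move=> [apa|na]; [left; exact: almost_periodic_conj|right].
apply: (@uniform_limit_map _ _ _ (fun a n => conjc (a n))) na.
  exact: basic_nilsequence_conj.
by move=> b e e0 ab n; rewrite -conjcB normc_conj.
Qed.

Lemma elementary_nilsequence_shift a : elementary_nilsequence a ->
  elementary_nilsequence (shift_seq a).
Proof.
move=> [apa|na]; [left; exact: almost_periodic_shift|right].
apply: (@uniform_limit_map _ _ _ (@shift_seq R)) na.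
  exact: basic_nilsequence_shift.
by move=> b e e0 ab n; exact: ab.
Qed.

(** Almost periodic sequences belong to the class by convention, so the product splits into cases: a
    product with at least one limit of basic elementary nilsequences is again such a limit, and two
    almost periodic factors give an almost periodic product. *)
Lemma elementary_nilsequence_mul a b : elementary_nilsequence a ->
  elementary_nilsequence b -> elementary_nilsequence (fun n => a n * b n).
Proof.
have nilap c d : uniform_limit_of (@basic_elementary_nilsequence R) c -> almost_periodic d ->
    uniform_limit_of (@basic_elementary_nilsequence R) (fun n => c n * d n).
  apply: uniform_limit_mul; [exact: basic_nilsequence_mul_trig|exact: basic_nilsequence_bounded|].
  exact: trig_bounded.
move=> [apa|na] [apb|nb]; first by left; exact: almost_periodic_mul.
- right; have -> : (fun n => a n * b n) = (fun n => b n * a n).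
    by apply/funext => n; rewrite mulrC.
  exact: nilap.
- by right; exact: nilap.
- right; apply: uniform_limit_mul na nb; first exact: basic_nilsequence_mul.
    exact: basic_nilsequence_bounded.
  exact: basic_nilsequence_bounded.
Qed.

(* Elementary nilsequences form a union of two uniformly closed classes: one of
   them contains approximants of arbitrarily small error. *)
Lemma elementary_nilsequence_limit (u : nat -> int -> R[i]) a :
  (forall k, elementary_nilsequence (u k)) -> {uniform, u @ \oo --> a} ->
  elementary_nilsequence a.
Proof.
move=> eu ua.
have H e : 0 < e -> exists2 b, elementary_nilsequence b & forall n, `|a n - b n| < e%:C.
  by apply: (uniform_limitP (@elementary_nilsequence R) a).1; exists u.
have [apH|/existsNP[e0 /not_implyP[e00 nap]]] := pselect (forall e : R, 0 < e ->
    exists2 b, almost_periodic b & forall n, `|a n - b n| < e%:C).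
  by left; exact: uniform_limit_closed.
right; apply: uniform_limit_closed => e e_gt0.
(* Error below [e0] excludes almost periodic approximants; error below [e] is what is asked for. *)
have m0 : 0 < Num.min e e0 by rewrite lt_min e_gt0.
have [b [apb|nb] ab] := H _ m0.
  exfalso; apply: nap; exists b => // n; apply: lt_le_trans (ab n) _.
  by rewrite lecR ge_min lexx orbT.
exists b => // n; apply: lt_le_trans (ab n) _.
by rewrite lecR ge_min lexx.
Qed.

End elementary_nilsequences.

Theorem proposition3 (R : realType) :
  [/\ forall a : int -> R[i], elementary_nilsequence a ->
        elementary_nilsequence (fun n => (a n)^*),
      forall a : int -> R[i], elementary_nilsequence a ->
        elementary_nilsequence (shift_seq a),
      forall a b : int -> R[i],
        elementary_nilsequence a -> elementary_nilsequence b ->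
        elementary_nilsequence (fun n => a n * b n)
    & forall (u : nat -> int -> R[i]) (a : int -> R[i]),
        (forall k, elementary_nilsequence (u k)) ->
        {uniform, u @ \oo --> a} -> elementary_nilsequence a].
Proof.
split.
- exact: elementary_nilsequence_conj.
- exact: elementary_nilsequence_shift.
- exact: elementary_nilsequence_mul.
- exact: elementary_nilsequence_limit.
Qed.
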